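(* Let $\mathcal H$ be a separable complex Hilbert space and let $\Phi\in L^\infty\big(\mu_{\mathbf G};\mathbf{HS}(\mathcal H)\big)$. Suppose that $$\lim_{|z|\to\infty}\int_{\mathbb C^n}\|\Xi_\Phi(z,w)\|_{\mathrm{HS}}^2\,\mathrm d\mu_{\mathbf G}(w)=0,$$ where $\Xi_\Phi(z,w)\in\mathbf B(\mathcal H)$ is given by $\Xi_\Phi(z,w)g=\int_{\mathbb C^n}\Phi(u+z)g\,\overline{k_w(u)}\,\mathrm d\mu_{\mathbf G}(u)$ for $g\in\mathcal H$, $z,w\in\mathbb C^n$. Then the vectorial Toeplitz operator $\mathsf T_\Phi$ on $\mathcal B\otimes\mathcal H$ is compact.
   Context: $n\in\mathbb N$; $|\cdot|$ and $\langle z,w\rangle=\sum_j z_j\overline{w_j}$ are the Euclidean norm and inner product on $\mathbb C^n$. $\mu_{\mathbf G}$ is the Gaussian measure $\mathrm d\mu_{\mathbf G}(z)=\pi^{-n}e^{-|z|^2}\,\mathrm dV(z)$ on the Borel sets of $\mathbb C^n$, with $V$ Lebesgue measure. For $\lambda\in\mathbb C^n$, $k_\lambda(z)=\exp\langle z,\lambda\rangle$. $\mathbf B(\mathcal H)$ is the algebra of bounded operators on $\mathcal H$, $\mathbf{HS}(\mathcal H)$ the space of Hilbert-Schmidt operators with norm $\|\cdot\|_{\mathrm{HS}}$; $\|A\|_{\mathrm{HS}}=\infty$ by convention if $A\in\mathbf B(\mathcal H)$ is not Hilbert-Schmidt. $L^\infty(\mu_{\mathbf G};\mathbf{HS}(\mathcal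 H))$ is the space of measurable $\mathbf{HS}(\mathcal H)$-valued functions on $\mathbb C^n$ that are $\mu_{\mathbf G}$-essentially bounded in $\|\cdot\|_{\mathrm{HS}}$. $\mathcal B$ is the Segal-Bargmann space of entire functions in $L^2(\mu_{\mathbf G})$. $L^2(\mu_{\mathbf G})\otimes\mathcal H$ is identified with the space of $\mathcal H$-valued functions square-integrable with respect to $\mu_{\mathbf G}$, and $\mathcal B\otimes\mathcal H$ with its closed subspace of analytic functions $F:\mathbb C^n\to\mathcal H$ with $\int\|F\|^2\,\mathrm d\mu_{\mathbf G}<\infty$. $\mathsf P$ is the orthogonal projection from $L^2(\mu_{\mathbf G})\otimes\mathcal H$ onto $\mathcal B\otimes\mathcal H$. For a Borel function $\Phi:\mathbb C^n\to\mathbf B(\mathcal H)$ the vectorial Toeplitz operator $\mathsf T_\Phi$ has domain $\{F\in\mathcal B\otimes\mathcal H:\Phi F\in L^2(\mu_{\mathbf G})\otimes\mathcal H\}$ and acts by $\mathsf T_\Phi F=\mathsf P(\Phi F)$, where $(\Phi F)(z)=\Phi(z)F(z)$. Operator-kernel integrals are understood in the weak sense. *)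

(* Defs.v *)
From HB Require Import structures.
From mathcomp Require Import all_boot all_order all_algebra complex.
From mathcomp Require Import sesquilinear.
From mathcomp Require Import all_classical all_reals all_analysis.
From mathcomp Require Import measurable_realfun ess_sup_inf.

Set Implicit Arguments.
Unset Strict Implicit.
Unset Printing Implicit Defensive.

Import Order.TTheory GRing.Theory Num.Theory numFieldNormedType.Exports.

Local Open Scope classical_set_scope.
Local Open Scope ring_scope.
Local Open Scope complex_scope.

(* The topology of R[i] given by the modulus. *)
HB.instance Definition _ (R : rcfType) := NormedModule.copy R[i] R[i]^o.

Notation borel T := (g_sigma_algebraType (@open T)).

Section measure_power.
Local Open Scope ereal_scope.
Context d (T : measurableType d) (R : realType).

Section step.
Variables (m : {sigma_finite_measure set T -> \bar R}) (n : nat).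
Variable mn : {sigma_finite_measure set (n.-tuple T) -> \bar R}.

Definition tuple_of_pair (p : T * n.-tuple T) : n.+1.-tuple T :=
  [the n.+1.-tuple T of p.1 :: p.2].

Let measurable_tuple_of_pair : measurable_fun setT tuple_of_pair.
Proof. exact: measurable_cons. Qed.

HB.instance Definition _ :=
  isMeasurableFun.Build _ _ _ _ tuple_of_pair measurable_tuple_of_pair.

Definition measure_cons : set (n.+1.-tuple T) -> \bar R :=
  pushforward (m \x mn) tuple_of_pair.

Let measure_cons0 : measure_cons set0 = 0.
Proof. exact: measure0. Qed.

Let measure_cons_ge0 A : 0 <= measure_cons A.
Proof. exact: measure_ge0. Qed.

Let measure_cons_sigma_additive : semi_sigma_additive measure_cons.
Proof. exact: measure_semi_sigma_additive. Qed.

HB.instance Definition _ := isMeasure.Build _ _ _ measure_cons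
  measure_cons0 measure_cons_ge0 measure_cons_sigma_additive.

Let measure_cons_sigma_finite : sigma_finite setT measure_cons.
Proof.
have /sigma_finiteP[F [FT ndF Ffin]] := sigma_finiteT m.
have /sigma_finiteP[G [GT ndG Gfin]] := sigma_finiteT mn.
pose g (t : n.+1.-tuple T) := (thead t, [tuple of behead t]).
have mg : measurable_fun setT g.
  apply/measurable_fun_pairP; split.
    exact: (measurable_tnth ord0).
  exact: measurable_behead.
have fK : cancel tuple_of_pair g.
  by case=> x t; rewrite /g theadE; congr (_, _); exact: val_inj.
exists (fun k => g @^-1` (F k `*` G k)).
  apply/esym; rewrite -subTset => t _.
  have : setT (g t).1 by [].
  rewrite FT => -[a _ Fa]; have : setT (g t).2 by [].
  rewrite GT => -[b _ Gb]; exists (maxn a b) => //; split.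
    by move: Fa; exact/subsetPset/ndF/leq_maxl.
  by move: Gb; exact/subsetPset/ndG/leq_maxr.
move=> k; have [mF Fk] := Ffin k; have [mG Gk] := Gfin k; split.
  by rewrite -[X in measurable X]setTI; apply: mg => //; exact: measurableX.
rewrite /measure_cons /pushforward -comp_preimage (_ : g \o _ = id).
  by rewrite preimage_id product_measure1E// lte_mul_pinfty// ge0_fin_numE.
by apply/funext => x /=; rewrite fK.
Qed.

HB.instance Definition _ := Measure_isSigmaFinite.Build _ _ _ measure_cons
  measure_cons_sigma_finite.

End step.

(* The n-fold product of m. *)
Fixpoint measure_power (m : {sigma_finite_measure set T -> \bar R}) (n : nat) :
    {sigma_finite_measure set (n.-tuple T) -> \bar R} :=
  match n with
  | 0 => dirac ([tuple] : 0.-tuple T)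
  | k.+1 => measure_cons m (measure_power m k)
  end.

End measure_power.

Notation Cn R n := (borel 'rV[R[i]]_n).

Section gaussian.
Context (R : realType) (n : nat).

(* The identification of R^n x R^n with C^n, (x, y) |-> x + iy. *)
Definition cvec (t : (n + n).-tuple (measurableTypeR R)) : Cn R n :=
  \row_j (tnth t (lshift n j) +i* tnth t (rshift n j)).

Let box_sub (x y a b e : R) : 0 < e -> `|x - a| < e -> `|y - b| < e ->
  `|(x +i* y) - (a +i* b) | < (e + e)%:C :> R[i].
Proof.
move=> e0 xa yb; rewrite normc_def/= ltcR.
rewrite -(@ger0_norm _ (e + e)) ?addr_ge0 ?ltW// -sqrtr_sqr ltr_sqrt.
  rewrite -(real_normK (num_real (x - a))) -(real_normK (num_real (y - b))).
  rewrite sqrrD; apply: (@lt_le_trans _ _ (e ^+ 2 + e ^+ 2)).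
    by rewrite ltrD// ltrXn2r// ?normr_ge0 ?ltW.
  by rewrite lerD2r lerDl mulrn_wge0// mulr_ge0 ?ltW.
by rewrite exprn_gt0// addr_gt0.
Qed.

Let box (q : (n + n).-tuple rat * nat) : set ((n + n).-tuple (measurableTypeR R)) :=
  [set t | forall j, `|tnth t j - ratr (tnth q.1 j)| < q.2.+1%:R^-1].

Let measurable_box q : measurable (box q).
Proof.
rewrite (_ : box q = \bigcap_(j in [set: 'I_(n + n)])
    ((fun t => tnth t j) @^-1` ball (ratr (tnth q.1 j) : R) q.2.+1%:R^-1)).
  apply: fin_bigcap_measurable => // j _; rewrite -[X in measurable X]setTI.
  by apply: measurable_tnth => //; by rewrite ball_itv; exact: measurable_itv.
apply/seteqP; split => t/= h j; first by move=> _; rewrite /ball/= distrC; exact: h.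
by have := h j I; rewrite /ball/= distrC.
Qed.

Let cvec_open_box (U : set 'rV[R[i]]_n) (t : (n + n).-tuple (measurableTypeR R)) :
  open U -> U (cvec t) -> exists2 q, box q t & box q `<=` cvec @^-1` U.
Proof.
rewrite openE => oU /oU /nbhs_ballP[e e0 eU].
have e'0 : 0 < complex.Re e / 4.
  by rewrite divr_gt0//; move: e0 => /=; rewrite ltcE/= => /andP[].
have [k _ /(_ k (leqnn _)) ke] := near_infty_natSinv_lt (PosNum e'0).
pose d : R := k.+1%:R^-1.
have d0 : 0 < d by rewrite invr_gt0.
have rd (x : R) : exists q : rat, `|x - ratr q| < d.
  have [|q] := @rat_in_itvoo R (x - d) (x + d).
    by rewrite ltrD2l gtrN.
  rewrite in_itv/= => /andP[q1 q2]; exists q.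
  by rewrite ltr_distlC q1.
pose q := [tuple xget 0 [set q : rat | `|tnth t j - ratr q| < d] | j < n + n].
have qP j : `|tnth t j - ratr (tnth q j)| < d.
  rewrite tnth_mktuple; case: xgetP => [y _ //|].
  by have [r rP] := rd (tnth t j) => /(_ r).
exists (q, k) => // s sq; apply: eU; split => // i j.
have dist l : `|tnth t l - tnth s l| < d + d.
  apply: le_lt_trans (ler_distD (ratr (tnth q l)) _ _) _.
  by rewrite ltrD// distrC; exact: sq.
rewrite /ball/= !mxE; apply: lt_le_trans (box_sub _ (dist _) (dist _)) _.
  by rewrite addr_gt0.
move: e0 ke => /=; rewrite ltcE/= => /andP[/eqP ie _]; rewrite -/d => dlt.
rewrite lecE/= -ie eqxx/=.
by rewrite -!mulr2n -mulrnA -[leLHS]mulr_natr -ler_pdivlMr// ltW.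
Qed.

Let measurable_cvec : measurable_fun setT cvec.
Proof.
apply: (@measurability _ _ _ (Cn R n) _ _ (@open 'rV[R[i]]_n)) => //.
move=> _ [U oU <-]; rewrite setTI.
rewrite (_ : _ @^-1` _ = \bigcup_(q in [set q | box q `<=` cvec @^-1` U]) box q).
  rewrite bigcup_mkcond; apply: countable_bigcupT_measurable => // q.
  by case: ifPn.
apply/seteqP; split => [t Ut|t [q]]; last exact.
by have [q qt qU] := cvec_open_box oU Ut; exists q.
Qed.

HB.instance Definition _ :=
  isMeasurableFun.Build _ _ _ _ cvec measurable_cvec.

(* Lebesgue measure on the Borel sets of C^n. *)
Definition lebesgueC : set (Cn R n) -> \bar R :=
  pushforward (measure_power (@lebesgue_measure R) (n + n)) cvec.

Let lebesgueC0 : lebesgueC set0 = 0%E.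
Proof. exact: measure0. Qed.

Let lebesgueC_ge0 A : (0 <= lebesgueC A)%E.
Proof. exact: measure_ge0. Qed.

Let lebesgueC_sigma_additive : semi_sigma_additive lebesgueC.
Proof. exact: measure_semi_sigma_additive. Qed.

HB.instance Definition _ := isMeasure.Build _ _ _ lebesgueC
  lebesgueC0 lebesgueC_ge0 lebesgueC_sigma_additive.

Definition cdot (z w : 'rV[R[i]]_n) : R[i] := \sum_j z 0 j * (w 0 j)^*.

Definition cnorm (z : 'rV[R[i]]_n) : R := Num.sqrt (complex.Re (cdot z z)).

Definition gauss_density (z : 'rV[R[i]]_n) : R :=
  (pi ^+ n)^-1 * expR (- cnorm z ^+ 2).

Let continuous_lip1 (f : {additive R[i] -> R}) :
  (forall x, `|f x|%:C <= `|x|) -> continuous f.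
Proof.
move=> f1 x U /= /nbhs_ballP[e e0 eU]; apply/nbhs_ballP.
exists e%:C => /=; first by rewrite ltcR.
move=> y; rewrite /ball/= => xy; apply: eU; rewrite /ball/= -ltcR -raddfB.
exact: le_lt_trans xy.
Qed.

Let Re_continuous : continuous (@complex.Re R).
Proof. by apply: continuous_lip1; exact: normc_ge_Re. Qed.

Let Im_continuous : continuous (@complex.Im R).
Proof.
apply: continuous_lip1 => x; rewrite normc_def lecR/= -sqrtr_sqr ler_sqrt.
  by rewrite lerDr sqr_ge0.
by rewrite addr_ge0 ?sqr_ge0.
Qed.

Let continuous_measurable (f : 'rV[R[i]]_n -> R) : continuous f ->
  measurable_fun [set: Cn R n] (f : Cn R n -> R).
Proof.
move=> cf; apply: (measurability _ (RGenOpens.measurableE R)).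
move=> _ [_ [a [b ->] <-]]; rewrite setTI; apply: sub_sigma_algebra.
by apply: open_comp => [? _|]; [exact: cf|exact: interval_open].
Qed.

Let measurable_gauss_density :
  measurable_fun [set: Cn R n] (gauss_density : Cn R n -> R).
Proof.
apply: measurable_funM => //; apply: measurableT_comp => //.
rewrite (_ : (fun _ => _) = fun z : Cn R n =>
  - \sum_(j < n) (complex.Re ((z : 'rV_n) 0 j) ^+ 2 + complex.Im ((z : 'rV_n) 0 j) ^+ 2)).
  apply: measurableT_comp => //; apply: measurable_sum => j.
  apply: measurable_funD; apply: measurable_funX; apply: continuous_measurable.
    move=> z; apply: (@continuous_comp _ _ _ (fun z : 'rV[R[i]]_n => z 0 j)).
      exact: coord_continuous.
    exact: Re_continuous.
  move=> z; apply: (@continuous_comp _ _ _ (fun z : 'rV[R[i]]_n => z 0 j)).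
    exact: coord_continuous.
  exact: Im_continuous.
apply/funext => z; congr (- _).
have E : complex.Re (cdot z z) =
    \sum_(j < n) (complex.Re (z 0 j) ^+ 2 + complex.Im (z 0 j) ^+ 2).
  rewrite /cdot raddf_sum; apply: eq_bigr => j _.
  by case: (z 0 j) => a b /=; rewrite mulrN opprK.
rewrite /cnorm sqr_sqrtr E//.
by apply: sumr_ge0 => j _; rewrite addr_ge0// sqr_ge0.
Qed.

(* The Gaussian measure. *)
Definition muG (A : set (Cn R n)) : \bar R :=
  (\int[lebesgueC]_(z in A) (gauss_density z)%:E)%E.

Let gauss_density_ge0 z : 0 <= gauss_density z.
Proof. by rewrite mulr_ge0 ?expR_ge0// invr_ge0 exprn_ge0// pi_ge0. Qed.

Let muG0 : muG set0 = 0%E.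
Proof. by rewrite /muG integral_set0. Qed.

Let muG_ge0 A : (0 <= muG A)%E.
Proof. by apply: integral_ge0 => z _; rewrite lee_fin. Qed.

Let muG_sigma_additive : semi_sigma_additive muG.
Proof.
move=> F mF tF mUF; rewrite /muG ge0_integral_bigcup//.
- apply: is_cvg_ereal_nneg_natsum_cond => k _ _.
  by apply: integral_ge0 => z _; rewrite lee_fin.
- by apply/measurable_EFinP; exact: measurable_funTS.
- by move=> z _; rewrite lee_fin.
Qed.

HB.instance Definition _ := isMeasure.Build _ _ _ muG
  muG0 muG_ge0 muG_sigma_additive.

End gaussian.
Arguments muG {R n}.

Section integrals.
Context d (T : measurableType d) (R : realType).
Variable mu : {measure set T -> \bar R}.

Definition cintegrable (f : T -> R[i]) : Prop :=
  mu.-integrable setT (fun x => (complex.Re (f x))%:E) /\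
  mu.-integrable setT (fun x => (complex.Im (f x))%:E).

Definition cintegral (f : T -> R[i]) : R[i] :=
  (\int[mu]_x complex.Re (f x)) +i* (\int[mu]_x complex.Im (f x)).

(* The default value 0 is taken only if the weak integral does not exist. *)
Definition weak_integral (H : completeNormedModType R[i])
    (dot : {dot H for @conjc R}) (F : T -> H) : H :=
  xget 0 [set x | forall h, cintegrable (fun t => dot (F t) h) /\
                            dot x h = cintegral (fun t => dot (F t) h)].

End integrals.

Section operators.
Context (R : realType) (H : completeNormedModType R[i]).
Variable dot : {dot H for @conjc R}.

Definition separable : Prop := exists2 D : set H, countable D & dense D.

(* The norm of H takes its values in R[i]; hnorm is the same norm in R. *)
Definition hnorm (x : H) : R := complex.Re `|x|.

Definition bounded_op (A : H -> H) : Prop :=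
  linear A /\ exists M : R, forall x, hnorm (A x) <= M * hnorm x.

Definition orthonormal_basis (E : set H) : Prop :=
  [/\ forall e, E e -> dot e e = 1,
      forall e f, E e -> E f -> e <> f -> dot e f = 0 &
      forall x, (forall e, E e -> dot x e = 0) -> x = 0].

(* For bounded A the sum does not depend on the basis; the supremum only avoids
   choosing one. The value is +oo when A is not Hilbert-Schmidt. *)
Definition hs_norm (A : H -> H) : \bar R :=
  sqrte (ereal_sup
    [set (\esum_(e in E) (hnorm (A e) ^+ 2)%:E)%E | E in orthonormal_basis]).

Definition hilbert_schmidt (A : H -> H) : Prop :=
  bounded_op A /\ (hs_norm A < +oo)%E.

Definition hs_open (U : set (H -> H)) : Prop :=
  U `<=` hilbert_schmidt /\
  forall A, U A -> exists2 r : R, 0 < r &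
    forall B, hilbert_schmidt B -> (hs_norm (B \- A)%R < r%:E)%E -> U B.

End operators.

Section toeplitz.
Context (R : realType) (H : completeNormedModType R[i]).
Variables (dot : {dot H for @conjc R}) (n : nat).
Implicit Types (F G K : 'rV[R[i]]_n -> H) (Phi : 'rV[R[i]]_n -> H -> H).

Definition Linfty_HS Phi : Prop :=
  [/\ forall z, hilbert_schmidt dot (Phi z),
      forall U, hs_open dot U -> measurable (Phi @^-1` U : set (Cn R n)) &
      (ess_sup (@muG R n) (fun z => hs_norm dot (Phi z)) < +oo)%E].

Definition cexp (a : R[i]) : R[i] :=
  let: x +i* y := a in (expR x * cos y) +i* (expR x * sin y).

Definition bargmann_kernel (w z : 'rV[R[i]]_n) : R[i] := cexp (cdot z w).

Definition Xi Phi (z w : 'rV[R[i]]_n) (g : H) : H :=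
  weak_integral (@muG R n) dot
    (fun u : 'rV[R[i]]_n => (bargmann_kernel w u)^* *: Phi (u + z) g).

(* The filter of neighbourhoods of infinity, for the Euclidean norm. *)
Definition cinfty : set_system 'rV[R[i]]_n :=
  [set P | exists M : R, forall z, M < cnorm z -> P z].

Definition L2norm F : \bar R :=
  sqrte (\int[@muG R n]_z (hnorm (F z) ^+ 2)%:E)%E.

Definition L2 F : Prop :=
  measurable_fun [set: Cn R n] (F : Cn R n -> borel H) /\ (L2norm F < +oo)%E.

Definition L2dot F G : R[i] :=
  cintegral (@muG R n) (fun z => dot (F z) (G z)).

(* differentiable is over the scalar field R[i], so the first clause says that
   F is entire. *)
Definition bargmann F : Prop := (forall z, differentiable F z) /\ L2 F.

(* G is the orthogonal projection of F onto the Segal-Bargmann space. *)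
Definition bargmann_proj F G : Prop :=
  [/\ L2 F, bargmann G & forall K, bargmann K -> L2dot (F \- G) K = 0].

Definition toeplitz Phi F G : Prop :=
  [/\ bargmann F, L2 (fun z => Phi z (F z)) &
      bargmann_proj (fun z => Phi z (F z)) G].

(* T is the graph of an operator in the Segal-Bargmann space. *)
Definition compact_operator
    (T : ('rV[R[i]]_n -> H) -> ('rV[R[i]]_n -> H) -> Prop) : Prop :=
  (forall F, bargmann F -> exists G, T F G) /\
  forall F_ G_ : nat -> 'rV[R[i]]_n -> H,
    (forall k, T (F_ k) (G_ k)) ->
    (exists M : R, forall k, (L2norm (F_ k) <= M%:E)%E) ->
    exists (s : nat -> nat) (L : 'rV[R[i]]_n -> H),
      [/\ {homo s : a b / (a < b)%N}, bargmann L &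
          L2norm (G_ (s k) \- L) @[k --> \oo] --> 0%E].

End toeplitz.

(* Main.v *)
(* Let P be the projection onto the Segal-Bargmann space. Since
   P F (w) = int exp<w,u> F(u) dmu(u) and P reproduces entire functions, Fubini
   and a translation by z give, for F = P F,
     T_Phi F (w) = int exp<w,z> Xi_Phi(z, w - z) F(z) dmu(z).
   A Schur test then bounds |T_Phi F|^2 by a constant times
     int int exp(- 7|v|^2/8) |Xi_Phi(z, v) F(z)|^2 dV(v) dmu(z).
   A bounded sequence has a subsequence converging weakly, pointwise in z, to
   some element of the space; subtract that limit. For large z the inner
   integral is at most a small multiple of |F(z)|^2 by the hypothesis on Xi_Phi
   and AM-GM. For bounded z it tends to 0 by dominated convergence, because each
   Xi_Phi(z, v) is Hilbert-Schmidt, hence maps weakly null sequences to null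
   sequences. Hence T_Phi maps the subsequence to a convergent one.
   The reproducing property reduces, by translation, to the mean value property
   of an entire function g under mu: by rotation invariance of mu it follows from
   the means over the circles exp(it) v, and these follow from Goursat's theorem
   for s + it |-> g(exp(s + it) v), which has period 2 pi i, on a long rectangle. *)

Require Import Defs.
From HB Require Import structures.
From mathcomp Require Import all_boot all_order all_algebra complex.
From mathcomp Require Import sesquilinear ring lra.
From mathcomp Require Import all_classical all_reals all_analysis.
From mathcomp Require Import measurable_realfun ess_sup_inf.
Import Order.TTheory GRing.Theory Num.Theory numFieldNormedType.Exports.

Set Implicit Arguments.
Unset Strict Implicit.
Unset Printing Implicit Defensive.

Local Open Scope classical_set_scope.
Local Open Scope ring_scope.

(** * Real part of a complex inner product *)

(** The weights shape the argument. Part of the kernel's exponent is spent on the first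
    Cauchy-Schwarz factor of the Schur test, so the remaining weight [exp (- 7/8 |v|^2)] is heavier
    than the Gaussian of the hypothesis on [Xi]. The surplus [exp (|v|^2 / 8)] is paid for by an a
    priori bound: [|Xi z v g|] is at most [B exp (|v|^2 / 4) |g|], whose square leaves enough room
    below [exp (|v|^2)]. A second obstacle is that the symbol is bounded only almost everywhere,
    while [Xi] evaluates it at translated points. The symbol is set to 0 on a null set; translates
    of null sets are null for the Gaussian measure, so [Xi] does not change at any point. Finally,
    all vector integrals are weak. Hilbert-Schmidt bounds are therefore expressed through finite
    orthonormal lists, and measurability and convergence through real inner products with fixed
    vectors. *)

Section hilbert.
Local Open Scope complex_scope.
Context {R : realType} {H : completeNormedModType R[i]}.
Context {dot : {dot H for @conjc R}}.
Hypothesis dot_norm : forall x : H, dot x x = `|x| ^+ 2.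
Implicit Types (x y z h : H).

(** The real form keeps every integrand real-valued. Nothing is lost: by [Im_dot] the imaginary part
    of an inner product is [rdot] against ['i *: y]. *)
Definition rdot x y : R := complex.Re (dot x y).

Definition cabs (a : R[i]) : R := complex.Re `|a|.

Lemma ge0_complexE (a : R[i]) : 0 <= a -> a = (complex.Re a)%:C.
Proof. by case: a => a b; rewrite lecE => /andP[/= /eqP -> _]. Qed.

Lemma cabsE (a : R[i]) : `|a| = (cabs a)%:C.
Proof. by rewrite /cabs normc_def. Qed.

Lemma cabs_ge0 a : 0 <= cabs a.
Proof. by rewrite -lecR -cabsE; exact: normr_ge0. Qed.

Lemma cabsM a b : cabs (a * b) = cabs a * cabs b.
Proof. by apply: complexI; rewrite -cabsE normrM !cabsE -rmorphM. Qed.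

Lemma cabs_sqr (a : R[i]) : cabs a ^+ 2 = complex.Re a ^+ 2 + complex.Im a ^+ 2.
Proof. by rewrite /cabs normc_def/= sqr_sqrtr// addr_ge0 ?sqr_ge0. Qed.

Lemma hnormE x : `|x| = (hnorm x)%:C.
Proof. exact: ge0_complexE. Qed.

Lemma hnorm_ge0 x : 0 <= hnorm x.
Proof. by rewrite -lecR -hnormE; exact: normr_ge0. Qed.

Lemma hnormD x y : hnorm (x + y) <= hnorm x + hnorm y.
Proof. by rewrite -lecR rmorphD/= -!hnormE ler_normD. Qed.

Lemma hnormN x : hnorm (- x) = hnorm x.
Proof. by rewrite /hnorm normrN. Qed.

Lemma hnormB x y : hnorm (x - y) <= hnorm x + hnorm y.
Proof. by rewrite -(hnormN y) hnormD. Qed.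

Lemma hdistC x y : hnorm (x - y) = hnorm (y - x).
Proof. by rewrite -hnormN opprB. Qed.

Lemma hnormZ (a : R[i]) x : hnorm (a *: x) = cabs a * hnorm x.
Proof. by apply: complexI; rewrite -hnormE normrZ hnormE cabsE -rmorphM. Qed.

Lemma hnorm0 : hnorm (0 : H) = 0.
Proof. by rewrite /hnorm normr0. Qed.

Lemma hnorm0_eq0 x : hnorm x = 0 -> x = 0.
Proof. by move=> x0; apply/eqP; rewrite -normr_eq0 hnormE x0. Qed.

Lemma rdotDl z : {morph rdot^~ z : x y / x + y}.
Proof. by move=> x y; rewrite /rdot linearDl raddfD. Qed.

Lemma rdotDr z : {morph rdot z : x y / x + y}.
Proof. by move=> x y; rewrite /rdot linearDr raddfD. Qed.

Lemma rdotNl z : {morph rdot^~ z : x / - x}.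
Proof. by move=> x; rewrite /rdot linearNl raddfN. Qed.

Lemma rdotNr z : {morph rdot z : x / - x}.
Proof. by move=> x; rewrite /rdot linearNr raddfN. Qed.

Lemma rdotBl z : {morph rdot^~ z : x y / x - y}.
Proof. by move=> x y; rewrite rdotDl rdotNl. Qed.

Lemma rdotBr z : {morph rdot z : x y / x - y}.
Proof. by move=> x y; rewrite rdotDr rdotNr. Qed.

Lemma rdot0r x : rdot x 0 = 0.
Proof. by rewrite /rdot linear0r. Qed.

Lemma dotC x y : dot x y = (dot y x)^*.
Proof. by rewrite hermC expr0 mul1r. Qed.

Lemma dotZl (a : R[i]) x y : dot (a *: x) y = a * dot x y.
Proof. exact: linearZl_LR. Qed.

Lemma dotZr (a : R[i]) x y : dot x (a *: y) = a^* * dot x y.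
Proof. exact: linearZr_LR. Qed.

Lemma dotBl x y z : dot (x - y) z = dot x z - dot y z.
Proof. exact: linearBl. Qed.

Lemma rdotC x y : rdot x y = rdot y x.
Proof. by rewrite /rdot dotC; case: (dot y x). Qed.

Lemma rdotZ_adj (a : R[i]) x y : rdot (a *: x) y = rdot x (a^* *: y).
Proof.
rewrite /rdot dotZl dotZr; congr (complex.Re (_ * _)).
exact: esym (conjcK a).
Qed.

Lemma Im_dot x y : complex.Im (dot x y) = rdot x ('i *: y).
Proof. by rewrite /rdot dotZr; case: (dot x y) => a b /=; ring. Qed.

Lemma rdotZl (a : R) x y : rdot (a%:C *: x) y = a * rdot x y.
Proof. by rewrite /rdot dotZl; case: (dot x y) => c d /=; ring. Qed.

Lemma rdotZr (a : R) x y : rdot x (a%:C *: y) = a * rdot x y.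
Proof. by rewrite rdotC rdotZl rdotC. Qed.

Lemma rdotZcl (a : R[i]) x y : rdot (a *: x) y =
  complex.Re a * rdot x y - complex.Im a * rdot x ('i *: y).
Proof. by rewrite -Im_dot /rdot dotZl; case: a => a b; case: (dot x y). Qed.

Lemma rdotxx x : rdot x x = hnorm x ^+ 2.
Proof. by rewrite /rdot dot_norm hnormE -rmorphXn. Qed.

Lemma hnormD_sqr x y :
  hnorm (x + y) ^+ 2 = hnorm x ^+ 2 + 2 * rdot x y + hnorm y ^+ 2.
Proof.
by rewrite -!rdotxx rdotDl !rdotDr (rdotC y x); ring.
Qed.

Lemma hnormB_sqr x y :
  hnorm (x - y) ^+ 2 = hnorm x ^+ 2 - 2 * rdot x y + hnorm y ^+ 2.
Proof. by rewrite hnormD_sqr hnormN rdotNr; ring. Qed.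

Lemma hnormZ_sqr (a : R) x : hnorm (a%:C *: x) ^+ 2 = a ^+ 2 * hnorm x ^+ 2.
Proof. by rewrite hnormZ exprMn cabs_sqr/= expr0n addr0. Qed.

Lemma cauchy_schwarz x y : `|rdot x y| <= hnorm x * hnorm y.
Proof.
have [y0|y0] := eqVneq (hnorm y) 0.
  by rewrite (hnorm0_eq0 y0) rdot0r hnorm0 mulr0 normr0.
have yp : 0 < hnorm y by rewrite lt_neqAle eq_sym y0 hnorm_ge0.
rewrite -(@ler_pXn2r _ 2)// ?nnegrE ?mulr_ge0 ?hnorm_ge0//.
rewrite real_normK ?num_real// exprMn.
have := sqr_ge0 (hnorm (x - (rdot x y / hnorm y ^+ 2)%:C *: y)).
rewrite hnormB_sqr rdotZr hnormZ_sqr.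
set t := rdot x y; set b := hnorm y => h.
have bp : 0 < b ^+ 2 by rewrite exprn_gt0.
have {}h : 0 <= hnorm x ^+ 2 - t ^+ 2 / b ^+ 2.
  apply: le_trans h _; rewrite le_eqVlt; apply/orP; left; apply/eqP.
  by field.
by move: h; rewrite subr_ge0 ler_pdivrMr.
Qed.

Lemma rdot_le x y : rdot x y <= hnorm x * hnorm y.
Proof. exact: le_trans (ler_norm _) (cauchy_schwarz _ _). Qed.

Lemma rdot_inj x y : (forall h, rdot x h = rdot y h) -> x = y.
Proof.
move=> xy; apply/eqP; rewrite -subr_eq0; apply/eqP/hnorm0_eq0/eqP.
by rewrite -sqrf_eq0 -rdotxx rdotBl xy subrr.
Qed.

Lemma hcauchy_cvg (u : nat -> H) :
  (forall e, 0 < e -> exists N, forall m k, (N <= m)%N -> (N <= k)%N ->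
     hnorm (u m - u k) < e) ->
  exists x, forall e, 0 < e -> exists N, forall k, (N <= k)%N ->
     hnorm (x - u k) < e.
Proof.
move=> cu.
have /cvg_ex[l ul] : cvg (u @ \oo).
  apply: cauchy_cvg; apply/cauchy_ballP => e e0.
  have er := ge0_complexE (ltW e0).
  have r0 : 0 < complex.Re e by rewrite -ltcR -er.
  have [N uN] := cu _ r0.
  exists (u @` [set k | (N <= k)%N], u @` [set k | (N <= k)%N]) => /=.
    by split; exists N => // k Nk /=; exists k.
  move=> [_ _] /= [[a Na <-] [b Nb <-]].
  by rewrite -ball_normE/= er hnormE ltcR; exact: uN.
exists l => e e0; move/cvgrPdist_lt : ul => /(_ e%:C).
rewrite ltcR => /(_ e0)[N _ uN]; exists N => k Nk.
by rewrite -ltcR -hnormE; exact: uN.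
Qed.

(* The representing vector minimises |x|^2 - 2 l(x); minimising sequences are
   Cauchy by the parallelogram law. *)
Lemma riesz (l : H -> R) (B : R) : 0 <= B -> (forall x y, l (x + y) = l x + l y) ->
  (forall (a : R) x, l (a%:C *: x) = a * l x) ->
  (forall x, `|l x| <= B * hnorm x) ->
  exists x, forall h, rdot x h = l h.
Proof.
move=> B0 lD lZ lB.
pose q x := hnorm x ^+ 2 - 2 * l x.
pose E := range q.
have lbE : lbound E (- B ^+ 2).
  move=> _ [x _ <-]; rewrite /q.
  have := le_trans (ler_norm _) (lB x); have := sqr_ge0 (hnorm x - B).
  by rewrite !expr2; lra.
have hE : has_inf E by split; [exists (q 0), 0 | exists (- B ^+ 2)].
pose m := inf E.
have mE x : m <= q x by apply: ge_inf; [exists (- B ^+ 2)|exists x].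
have approx (k : nat) : {x | q x < m + k.+1%:R^-1}.
  apply: cid; have /inf_adherent/(_ hE)[_ [x _ <-] ?] : 0 < k.+1%:R^-1 :> R.
    by rewrite invr_gt0.
  by exists x.
pose u k := sval (approx k).
have uq k : q (u k) < m + k.+1%:R^-1 := svalP (approx k).
(* Parallelogram law: the value of [q] at the midpoint is at least [m]. *)
have par x y : hnorm (x - y) ^+ 2 <= 2 * (q x + q y - 2 * m).
  have := mE ((2^-1)%:C *: (x + y)).
  rewrite /q lZ lD hnormZ_sqr hnormB_sqr hnormD_sqr (_ : 2^-1 ^+ 2 = 4^-1 :> R); [lra|by field].
have uE (e : R) : 0 < e -> exists N, forall k, (N <= k)%N -> k.+1%:R^-1 < e.
  move=> e0; have [N _ hN] := near_infty_natSinv_lt (PosNum e0).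
  by exists N => k /hN.
have [|x xu] := @hcauchy_cvg u.
  move=> e e0; have e20 : 0 < e ^+ 2 / 4 by rewrite divr_gt0 ?exprn_gt0.
  have [N hN] := uE _ e20; exists N => a b Na Nb.
  rewrite -(@ltr_pXn2r _ 2)// ?nnegrE ?hnorm_ge0 ?(ltW e0)//.
  apply: le_lt_trans (par _ _) _.
  have := uq a; have := uq b; have := hN _ Na; have := hN _ Nb.
  move: (b.+1%:R^-1) (a.+1%:R^-1) => rb ra; lra.
have qx : q x <= m.
  apply/ler_addgt0Pr => e e0.
  (* With [d = x - u k], the difference [q x - q (u k)] is at most [|d| (2 |u k| + |d| + 2 B)], and
     [c] bounds the second factor once [|d| < 1]. *)
  pose c := 2 * hnorm x + 2 * B + 3.
  have x0 := hnorm_ge0 x.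
  have c0 : 0 < c by rewrite /c; lra.
  have ec : 0 < Num.min 1 (e / 2 / c) by rewrite lt_min ltr01 !divr_gt0.
  have [N1 xu1] := xu _ ec.
  have e20 : 0 < e / 2 by rewrite divr_gt0.
  have [N2 hN2] := uE _ e20.
  pose k := maxn N1 N2; pose d := x - u k.
  have /= := xu1 k (leq_maxl _ _); rewrite lt_min -/d => /andP[d1 d2].
  have h2 := hN2 k (leq_maxr _ _).
  have d0 := hnorm_ge0 d.
  have -> : q x = q (u k) + 2 * rdot (u k) d + hnorm d ^+ 2 - 2 * l d.
    have -> : x = u k + d by rewrite /d addrC subrK.
    by rewrite /q hnormD_sqr lD; ring.
  have := uq k; have := rdot_le (u k) d.
  have : hnorm (u k) <= hnorm x + hnorm d.
    by rewrite (_ : u k = x - d) ?hnormB// /d opprB addrC subrK.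
  move=> /(ler_wpM2r d0) h3 h4 h5.
  have := lB d; rewrite ler_norml => /andP[h6 _].
  have h7 : hnorm d ^+ 2 <= hnorm d by rewrite expr2 ler_piMr// ltW.
  move: d2; rewrite ltr_pdivlMr// /c => d2.
  rewrite expr2 in h7.
  rewrite expr2; move: (k.+1%:R^-1) h2 h5 => r h2 h5; nra.
exists x => h.
(* First variation: moving from [x] by [- a / b] along [h] changes [q] by [- (a / b)^2 (|h|^2 + 2)],
   which minimality forbids unless [a = 0]. The summand 1 in [b] covers [h = 0]. *)
pose a := rdot x h - l h; pose b := hnorm h ^+ 2 + 1.
have b0 : 0 < b by rewrite /b ltr_wpDl// sqr_ge0.
have := le_trans qx (mE (x + (- a / b)%:C *: h)).
rewrite /q hnormD_sqr lD lZ rdotZr hnormZ_sqr => ineq.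
have : 0 <= (- a / b) * (2 * a + (- a / b) * hnorm h ^+ 2).
  by move: (- a / b) ineq => t; rewrite /a; lra.
have -> : (- a / b) * (2 * a + (- a / b) * hnorm h ^+ 2) =
    - ((a / b) ^+ 2 * (hnorm h ^+ 2 + 2)).
  by rewrite /b in b0 *; field; rewrite gt_eqF.
rewrite oppr_ge0 pmulr_lle0 ?ltr_wpDl ?sqr_ge0// => a0.
have /eqP : (a / b) ^+ 2 = 0 by apply/eqP; rewrite eq_le a0 sqr_ge0.
rewrite sqrf_eq0 mulf_eq0 invr_eq0 (gt_eqF b0) orbF subr_eq0 => /eqP//.
Qed.

End hilbert.
Arguments rdot {R H} dot x y.

Lemma cvg_sumr (K : realType) T (F : set_system T) {FF : Filter F} (I : Type)
    (r : seq I) (f : I -> T -> K) (a : I -> K) :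
  (forall i, f i x @[x --> F] --> a i) ->
  \sum_(i <- r) f i x @[x --> F] --> \sum_(i <- r) a i.
Proof.
move=> fa; apply: (@cvg_big K I +%R 0 predT _ T F r f a FF) => [x|i _].
  exact: add_continuous.
exact: fa.
Qed.

(** * Hilbert-Schmidt operators and weakly null sequences *)

Section hilbert_schmidt.
Local Open Scope complex_scope.
Context {R : realType} {H : completeNormedModType R[i]}.
Context {dot : {dot H for @conjc R}}.
Hypothesis dot_norm : forall x : H, dot x x = `|x| ^+ 2.
Implicit Types (x y z h e : H) (A B : H -> H) (J : seq H).
Local Notation rdot := (rdot dot).

Definition ons (E : set H) : Prop :=
  (forall e, E e -> dot e e = 1) /\
  (forall e f, E e -> E f -> e <> f -> dot e f = 0).

Lemma dot_unit x : x != 0 -> dot ((hnorm x)^-1%:C *: x) ((hnorm x)^-1%:C *: x) = 1.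
Proof.
move=> x0; rewrite dotZl dotZr dot_norm hnormE.
have hx : hnorm x != 0 by apply: contra x0 => /eqP/hnorm0_eq0/eqP.
apply/eqP; rewrite eq_complex/=; apply/andP; split; apply/eqP => //=; last by ring.
by field.
Qed.

(** [hs_norm] ranges over complete bases, but the estimates use finite orthonormal lists, which must
    therefore be completed. Zorn is applied to the sets that can be added to [E]; a nonzero vector
    orthogonal to a maximal family could be normalised and added as well. *)
Lemma ons_extend (E : set H) : ons E ->
  exists2 F, E `<=` F & orthonormal_basis dot F.
Proof.
move=> oE; have [F cF tF|B [oB maxB]] := @Zorn_bigcup H [set B | ons (E `|` B)].
  have mem a b : (E `|` \bigcup_(X in F) X) a -> (E `|` \bigcup_(X in F) X) b ->
      exists2 B, ons (E `|` B) & (E `|` B) a /\ (E `|` B) b.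
    move=> [Ea|[X FX Xa]] [Eb|[Y FY Yb]].
    - by exists set0; [rewrite setU0|split; left].
    - by exists Y; [exact: cF|split; [left|right]].
    - by exists X; [exact: cF|split; [right|left]].
    - have [XY|YX] := tF _ _ FX FY.
        by exists Y; [exact: cF|split; right => //; exact: XY].
      by exists X; [exact: cF|split; right => //; exact: YX].
  split=> [e Fe|e f Fe Ff ef].
    by have [B [nB _] [Be _]] := mem _ _ Fe Fe; exact: nB.
  by have [B [_ oB] [Be Bf]] := mem _ _ Fe Ff; exact: oB.
exists (E `|` B); first exact: subsetUl.
move: oB => [nB oB]; split => // x xB; apply: contrapT => /eqP x0.
pose e := (hnorm x)^-1%:C *: x.
have eF f : (E `|` B) f -> dot e f = 0 by move=> /xB xf; rewrite dotZl xf mulr0.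
have fe f : (E `|` B) f -> dot f e = 0 by move=> /eF; rewrite (dotC f) => ->; exact: conjc0.
apply: (maxB (B `|` [set e])); last first.
  split=> [f|f g]; rewrite setUA.
    by move=> [/nB//|-> /=]; exact: dot_unit.
  move=> [Bf [Bg|-> _]|-> [Bg _|-> //]]; [exact: oB|exact: fe|exact: eF].
split; last first.
  move=> /(_ e (or_intror erefl)) Be.
  have := eF e (or_intror Be); rewrite dot_unit// => /eqP.
  by rewrite oner_eq0.
by move=> f; left.
Qed.

Lemma sum_le_hs_norm A J : uniq J -> ons [set` J] ->
  ((\sum_(e <- J) hnorm (A e) ^+ 2)%:E <= hs_norm dot A ^+ 2)%E.
Proof.
move=> uJ /ons_extend[E JE oE].
set S := [set (\esum_(e in F) (hnorm (A e) ^+ 2)%:E)%E | F in orthonormal_basis dot].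
have SE : S (\esum_(e in E) (hnorm (A e) ^+ 2)%:E)%E by exists E.
have le1 := ereal_sup_ubound SE.
have E0 : (0 <= \esum_(e in E) (hnorm (A e) ^+ 2)%:E)%E.
  by apply: esum_ge0 => e _; rewrite lee_fin sqr_ge0.
rewrite /hs_norm sqr_sqrte; last exact: le_trans E0 le1.
apply: le_trans le1.
apply: esum_ge; exists [set` J]; first by split => //; exact: finite_seq.
by rewrite -fsbig_seq// sumEFin.
Qed.

Lemma sum_le_hs_bound A (c : R) J : (hs_norm dot A <= c%:E)%E ->
  uniq J -> ons [set` J] -> \sum_(e <- J) hnorm (A e) ^+ 2 <= c ^+ 2.
Proof.
move=> Ac uJ oJ; rewrite -lee_fin; apply: le_trans (sum_le_hs_norm _ uJ oJ) _.
by rewrite EFin_expe lee_sqr ?sqrte_ge0// (le_trans _ Ac)// sqrte_ge0.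
Qed.

Lemma linear_opD A : linear A -> {morph A : x y / x + y}.
Proof. by move=> lA x y; have := lA 1 x y; rewrite !scale1r. Qed.

Lemma linear_op0 A : linear A -> A 0 = 0.
Proof.
move=> lA; have := linear_opD lA 0 0; rewrite addr0 => /eqP.
by rewrite -subr_eq subrr => /eqP <-.
Qed.

Lemma linear_opZ A : linear A -> forall a x, A (a *: x) = a *: A x.
Proof. by move=> lA a x; have := lA a x 0; rewrite (linear_op0 lA) !addr0. Qed.

Lemma linear_opB A : linear A -> {morph A : x y / x - y}.
Proof.
move=> lA x y; rewrite (linear_opD lA) -scaleN1r (linear_opZ lA).
by rewrite scaleN1r.
Qed.

Lemma hnorm_le_hs_bound A (c : R) x : linear A -> 0 <= c ->
  (hs_norm dot A <= c%:E)%E -> hnorm (A x) <= c * hnorm x.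
Proof.
move=> linA c0 Ac; have [->|x0] := eqVneq x 0.
  rewrite (linear_op0 linA).
  by rewrite !hnorm0 mulr0.
have hx : 0 < hnorm x.
  by rewrite lt_neqAle hnorm_ge0 eq_sym andbT; apply: contra x0 => /eqP/hnorm0_eq0/eqP.
pose e := (hnorm x)^-1%:C *: x.
have : \sum_(f <- [:: e]) hnorm (A f) ^+ 2 <= c ^+ 2.
  apply: sum_le_hs_bound => //.
  split=> [f|f g] /=; rewrite !inE => /eqP->; first exact: dot_unit.
  by move=> /eqP->.
rewrite big_seq1 (linear_opZ linA) hnormZ_sqr -exprMn.
rewrite ler_pXn2r ?nnegrE ?mulr_ge0 ?invr_ge0 ?hnorm_ge0//.
by rewrite mulrC ler_pdivrMr.
Qed.

(** A bound on the squared Hilbert-Schmidt norm in terms of finite lists alone. In this form it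
    passes through an integral over a parameter, since finite sums commute with it; see
    [Xi_hs_bounded]. *)
Definition hs_bounded A (c : R) : Prop :=
  forall J, uniq J -> ons [set` J] -> \sum_(e <- J) hnorm (A e) ^+ 2 <= c.

(* A finite orthonormal family J nearly exhausting the Hilbert-Schmidt norm
   leaves little room for A on the orthogonal complement of J. *)
Lemma hs_bounded_compact A (c M : R) (x : nat -> H) : linear A ->
  hs_bounded A c -> (forall k, hnorm (x k) <= M) ->
  (forall h, rdot (x k) h @[k --> \oo] --> (0 : R)) ->
  hnorm (A (x k)) @[k --> \oo] --> (0 : R).
Proof.
move=> linA Ac xM x0.
have AD := linear_opD linA; have A0 := linear_op0 linA; have AZ := linear_opZ linA.
have M0 : 0 <= M by apply: le_trans (xM 0); exact: hnorm_ge0.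
pose S := [set s | exists J, [/\ uniq J, ons [set` J] & s = \sum_(e <- J) hnorm (A e) ^+ 2]].
have hS : has_sup S.
  split; last by exists c => _ [J [uJ oJ ->]]; exact: Ac.
  by exists 0, [::]; rewrite big_nil; split => //; split.
(* A unit vector orthogonal to a nearly optimal list [J] can be added to it; the supremum then
   leaves at most [e ^+ 2] for the squared norm of its image. *)
have tail (e : R) : 0 < e -> exists J, [/\ uniq J, ons [set` J] &
    forall y, (forall f, f \in J -> dot y f = 0) -> hnorm (A y) <= e * hnorm y].
  move=> e0; have e20 : 0 < e ^+ 2 by rewrite exprn_gt0.
  have [_ [J [uJ oJ ->]] JS] := sup_adherent e20 hS.
  exists J; split => // y yJ; have [->|y0] := eqVneq y 0.
    by rewrite A0 !hnorm0 mulr0.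
  have hy : 0 < hnorm y.
    by rewrite lt_neqAle hnorm_ge0 eq_sym andbT; apply: contra y0 => /eqP/hnorm0_eq0/eqP.
  pose u := (hnorm y)^-1%:C *: y.
  have uf f : f \in J -> dot u f = 0 by move=> /yJ yf; rewrite dotZl yf mulr0.
  have fu f : f \in J -> dot f u = 0 by move=> /uf; rewrite (dotC f) => ->; exact: conjc0.
  have uu : dot u u = 1 by exact: dot_unit.
  have uNJ : u \notin J.
    by apply/negP => /uf; rewrite uu => /eqP; rewrite oner_eq0.
  have : \sum_(e <- u :: J) hnorm (A e) ^+ 2 <= sup S.
    apply: sup_upper_bound => //; exists (u :: J); split => //.
      by rewrite /= uNJ.
    move: oJ => [nJ oJ]; split=> [f|f g] /=; rewrite !inE.
      by move=> /orP[/eqP->//|]; exact: nJ.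
    move=> /orP[/eqP->|fJ] /orP[/eqP->|gJ] //; [by move=> _; exact: uf|by move=> _; exact: fu|exact: oJ].
  rewrite big_cons AZ hnormZ_sqr -exprMn => le1.
  have {}le1 : ((hnorm y)^-1 * hnorm (A y)) ^+ 2 <= e ^+ 2 by move: le1 JS; lra.
  move: le1; rewrite ler_pXn2r ?nnegrE ?mulr_ge0 ?invr_ge0 ?hnorm_ge0 ?(ltW e0)//.
  by rewrite mulrC ler_pdivrMr.
apply/cvgrPdist_le => e e0.
have e'0 : 0 < e / 2 / (M + 1) by rewrite !divr_gt0// ltr_wpDl.
have [J [uJ [nJ oJ] tJ]] := tail _ e'0.
(* [P k] is the projection of [x k] onto the span of [J]. Its image tends to 0 through finitely many
   coefficients, and [tail] takes care of [x k - P k]. *)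
pose P k := \sum_(f <- J) dot (x k) f *: f.
have dP k f : f \in J -> dot (P k) f = dot (x k) f.
  move=> fJ; rewrite /P linear_sumlz (bigD1_seq f)//= big_seq_cond big1.
    by rewrite addr0 dotZl (nJ f)// mulr1.
  move=> g /andP[gJ gf]; by rewrite dotZl (oJ g f) ?mulr0//; exact/eqP.
have yP k : hnorm (x k - P k) <= hnorm (x k).
  rewrite -(@ler_pXn2r _ 2)// ?nnegrE ?hnorm_ge0//.
  have {2}-> : x k = (x k - P k) + P k by rewrite subrK.
  rewrite [leRHS](hnormD_sqr dot_norm) (_ : rdot (x k - P k) (P k) = 0).
    by rewrite mulr0 addr0 lerDl sqr_ge0.
  rewrite /rdot {2}/P linear_sumr big_seq_cond big1//= => f /andP[fJ _].
  by rewrite dotZr dotBl (dP k f)// subrr mulr0.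
have cvgP : (\sum_(f <- J) (`|rdot (x k) f| + `|rdot (x k) ('i *: f)|) * hnorm (A f))
    @[k --> \oo] --> (0 : R).
  have := @cvg_sumr R nat \oo _ H J (fun f k =>
    (`|rdot (x k) f| + `|rdot (x k) ('i *: f)|) * hnorm (A f)) (fun=> 0).
  rewrite big1//; apply => f; rewrite -[X in _ --> X](mul0r (hnorm (A f))).
  apply: cvgMr_tmp; rewrite -[X in _ --> X](addr0 0) -[in X in _ --> X + _](normr0 R).
  rewrite -[in X in _ --> _ + X](normr0 R).
  by apply: cvgD; apply: cvg_norm; exact: x0.
have e20 : 0 < e / 2 by rewrite divr_gt0.
move/cvgrPdist_le : cvgP => /(_ _ e20); apply: filterS => k.
rewrite !sub0r !normrN => le1; rewrite ger0_norm ?hnorm_ge0//.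
have -> : x k = (x k - P k) + P k by rewrite subrK.
rewrite AD; apply: le_trans (hnormD _ _) _.
rewrite [leRHS](splitr e) lerD//.
  apply: le_trans (tJ _ _) _.
    by move=> f fJ; rewrite dotBl (dP k f)// subrr.
  apply: le_trans (ler_wpM2l (ltW e'0) (le_trans (yP k) (xM k))) _.
  rewrite mulrAC ler_pdivrMr ?ltr_wpDl// ler_wpM2l ?(ltW e20)// lerDl.
  exact: ler01.
apply: le_trans le1; apply: le_trans (ler_norm _).
rewrite /P; elim: (J) => [|f K IH]; first by rewrite !big_nil A0 hnorm0.
rewrite !big_cons AD; apply: le_trans (hnormD _ _) _; apply: lerD => //.
rewrite AZ hnormZ ler_wpM2r ?hnorm_ge0//.
rewrite -(@ler_pXn2r _ 2)// ?nnegrE ?cabs_ge0 ?addr_ge0// cabs_sqr.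
rewrite Im_dot -/(rdot _ _) -(real_normK (num_real (rdot _ f))).
rewrite -(real_normK (num_real (rdot _ ('i *: f)))).
by rewrite sqrrD -addrA lerD2l lerDr mulrn_wge0// mulr_ge0.
Qed.

End hilbert_schmidt.
Arguments ons {R H} dot E.
Arguments hs_bounded {R H} dot A c.

(** * Lebesgue and Gaussian measure *)

Section lebesgue_power.
Context {R : realType}.
Local Notation mu := (@lebesgue_measure R).
Local Notation RT := (measurableTypeR R).

(** The image of Lebesgue measure under a translation agrees with it on half-open intervals, hence
    everywhere by uniqueness. *)
Lemma ge0_integral_shift (c : R) (f : RT -> \bar R) :
  measurable_fun [set: RT] f -> (forall x, 0 <= f x)%E ->
  (\int[mu]_x f (x + c)%R = \int[mu]_x f x)%E.
Proof.
move=> mf f0.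
have ms : measurable_fun [set: RT] (fun x : RT => (x + c)%R : RT).
  by apply: measurable_funD => //; exact: measurable_cst.
pose g : {mfun RT >-> RT} := HB.pack (fun x : RT => (x + c)%R : RT)
  (isMeasurableFun.Build _ _ _ _ _ ms).
have mE A : measurable A -> mu A = pushforward mu g A.
  apply: (@lebesgue_measure_unique R (pushforward mu g)) => _ [[a b] _ <-] /=.
  rewrite /pushforward (_ : _ @^-1` _ = `](a - c)%R, (b - c)%R]%classic).
    rewrite !lebesgue_measure_itv/= !lte_fin ltrBlDr subrK.
    by case: ifPn => // _; rewrite -!EFinD; congr EFin; ring.
  by apply/seteqP; split => x /=; rewrite !in_itv/= ltrBlDr lerBrDr.
rewrite [RHS](eq_measure_integral (pushforward mu g)); last first.
  by move=> A mA _; exact: mE.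
by rewrite ge0_integral_pushforward.
Qed.

Definition tshift N (c t : N.-tuple RT) : N.-tuple RT :=
  [tuple (tnth t i + tnth c i)%R | i < N].

Lemma measurable_tshift N (c : N.-tuple RT) : measurable_fun setT (tshift c).
Proof.
apply/measurable_fun_tnthP => i.
rewrite (_ : _ \o _ = fun t => (tnth t i + tnth c i)%R).
  by apply: measurable_funD => //; exact: measurable_tnth.
by apply/funext => t /=; rewrite tnth_mktuple.
Qed.

Lemma tshift_cons N (c : N.+1.-tuple RT) x (t : N.-tuple RT) :
  tshift c [tuple of x :: t] = [tuple of (x + thead c)%R :: tshift [tuple of behead c] t].
Proof.
apply: eq_from_tnth => -[[|j] jN]; rewrite tnth_mktuple.
  by rewrite /thead !(tnth_nth 0%R).
have -> : tnth [tuple of (x + thead c)%R :: tshift [tuple of behead c] t] (Ordinal jN) =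
    tnth (tshift [tuple of behead c] t) (Ordinal (jN : (j < N)%N)).
  by rewrite !(tnth_nth 0%R).
by rewrite tnth_mktuple !(tnth_nth 0%R)/= nth_behead.
Qed.

Lemma measurable_tuple_of_pair' N : measurable_fun setT (@tuple_of_pair _ RT N).
Proof. exact: measurable_cons. Qed.

Lemma ge0_integral_measure_powerS N (f : N.+1.-tuple RT -> \bar R) :
  measurable_fun setT f -> (forall t, 0 <= f t)%E ->
  (\int[measure_power mu N.+1]_t f t =
   \int[mu]_x \int[measure_power mu N]_t f [tuple of x :: t])%E.
Proof.
move=> mf f0; rewrite /= /measure_cons ge0_integral_pushforward//=.
rewrite preimage_setT fubini_tonelli1//.
by apply: measurableT_comp => //; exact: measurable_tuple_of_pair'.
Qed.

Lemma ge0_integral_tshift N (c : N.-tuple RT) (f : N.-tuple RT -> \bar R) :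
  measurable_fun setT f -> (forall t, 0 <= f t)%E ->
  (\int[measure_power mu N]_t f (tshift c t) = \int[measure_power mu N]_t f t)%E.
Proof.
elim: N c f => [|N IH] c f mf f0.
  by apply: eq_integral => t _; congr f; rewrite [LHS]tuple0 [RHS]tuple0.
rewrite !ge0_integral_measure_powerS//; last first.
  by apply: measurableT_comp => //; exact: measurable_tshift.
have mc x : measurable_fun setT (fun t : N.-tuple RT => f [tuple of x :: t]).
  by apply: measurableT_comp => //; apply: measurable_cons.
under eq_integral do under eq_integral do rewrite tshift_cons.
under eq_integral => x _ do rewrite (IH [tuple of behead c] (fun t => f [tuple of (x + thead c)%R :: t]))//.
rewrite (@ge0_integral_shift (thead c) (fun x => \int[measure_power mu N]_t f [tuple of x :: t])%E)//.
  apply: (@measurable_fun_fubini_tonelli_F _ _ _ _ _ (measure_power mu N)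
    (f \o @tuple_of_pair _ RT N)) => //.
  by apply: measurableT_comp => //; exact: measurable_tuple_of_pair'.
  by move=> x; exact: f0.
by move=> x; apply: integral_ge0 => t _; exact: f0.
Qed.

Lemma ge0_integral_prod N (g : RT -> R) : measurable_fun [set: RT] g ->
  (forall x, 0 <= g x)%R -> forall I, (\int[mu]_x (g x)%:E)%E = I%:E ->
  (\int[measure_power mu N]_t (\prod_(i < N) g (tnth t i))%:E)%E = (I ^+ N)%:E.
Proof.
move=> mg g0 I gI; elim: N => [|N IH].
  under eq_integral do rewrite big_ord0.
  by rewrite integral_cst//= mul1e diracT.
have mp K : measurable_fun setT (fun t : K.-tuple RT => (\prod_(i < K) g (tnth t i))%:E).
  apply/measurable_EFinP; apply: measurable_prod => i _.
  by apply: measurableT_comp => //; exact: measurable_tnth.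
have p0 K (t : K.-tuple RT) : (0 <= (\prod_(i < K) g (tnth t i))%:E)%E.
  by rewrite lee_fin prodr_ge0.
have inner x : (\int[measure_power mu N]_t
    (\prod_(i < N.+1) g (tnth [tuple of x :: t] i))%:E = (I ^+ N)%:E * (g x)%:E)%E.
  transitivity (\int[measure_power mu N]_t
      ((g x)%:E * (\prod_(i < N) g (tnth t i))%:E))%E.
    apply: eq_integral => t _; rewrite -EFinM big_ord_recl tnth0.
    by congr (_ * _)%:E; apply: eq_bigr => i _; rewrite tnthS.
  rewrite ge0_integralZl ?lee_fin//; [|exact: mp].
  rewrite -[RHS]/((I ^+ N * g x)%:E) mulrC EFinM; congr (_ * _)%E; exact: IH.
rewrite ge0_integral_measure_powerS//; under eq_integral do rewrite inner.
rewrite ge0_integralZl//.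
- by rewrite gI -EFinM exprSr.
- exact/measurable_EFinP.
- by move=> x _; rewrite lee_fin.
- rewrite lee_fin exprn_ge0// -lee_fin -gI integral_ge0// => x _.
  by rewrite lee_fin.
Qed.

Lemma gauss_integrable1 (c : R) : (0 < c)%R ->
  exists I, (\int[mu]_x (expR (- (c * x ^+ 2)))%:E)%E = I%:E.
Proof.
(* With variance [s ^+ 2 = 1 / (2 c)] the integrand is the centred normal density divided by its
   peak value. *)
move=> c0; pose s := Num.sqrt (2 * c)^-1.
have s0 : s != 0%R by rewrite gt_eqF// sqrtr_gt0 invr_gt0 mulr_gt0.
have := @integrable_normal_pdf R 0 s.
rewrite normal_pdfE// => h.
have pk := normal_peak_gt0 s0.
have := integrableZl measurableT (normal_peak s)^-1 h.
move=> /integrable_fin_num h2.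
exists (fine (\int[mu]_x ((normal_peak s)^-1%:E * (normal_peak s * normal_fun 0 s x)%:E)))%E.
rewrite fineK; last exact: h2.
apply: eq_integral => x _; rewrite -EFinM mulKf ?gt_eqF//.
rewrite /normal_fun subr0; congr (expR _)%:E.
rewrite /s sqr_sqrtr ?invr_ge0 ?mulr_ge0// ?ltW//.
by rewrite -mulr_natr; field; rewrite gt_eqF.
Qed.

End lebesgue_power.

(** * Borel measurability on C^n *)

Section measurable_Cn.
Local Open Scope complex_scope.
Context {R : realType} {n : nat}.
Local Notation mu := (@lebesgue_measure R).
Local Notation RT := (measurableTypeR R).
Local Notation C := R[i].
Local Notation CT := (Cn R n).
Implicit Types (z w : 'rV[R[i]]_n).

Lemma continuous_Re : continuous (@complex.Re R : C -> R).
Proof.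
move=> x U /= /nbhs_ballP[e e0 eU]; apply/nbhs_ballP.
exists e%:C => /=; first by rewrite ltcR.
move=> y; rewrite /ball/= => xy; apply: eU; rewrite /ball/= -ltcR -raddfB.
by apply: le_lt_trans xy; exact: normc_ge_Re.
Qed.

Lemma Re_Ni (a : C) : complex.Im a = complex.Re (- 'i * a).
Proof. by case: a => a b /=; ring. Qed.

Lemma continuous_Im : continuous (@complex.Im R : C -> R).
Proof.
rewrite (_ : @complex.Im R = @complex.Re R \o ( *%R (- 'i))).
  move=> x; apply: continuous_comp; first exact: mulrl_continuous.
  exact: continuous_Re.
by apply/funext => a; exact: Re_Ni.
Qed.

Lemma continuous_measurable_Cn (f : 'rV[C]_n -> R) : continuous f ->
  measurable_fun [set: CT] (f : CT -> R).
Proof.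
move=> cf; apply: (measurability _ (RGenOpens.measurableE R)).
move=> _ [_ [a [b ->] <-]]; rewrite setTI; apply: sub_sigma_algebra.
by apply: open_comp => [? _|]; [exact: cf|exact: interval_open].
Qed.

Lemma measurable_coord_Re j : measurable_fun [set: CT] (fun z : CT => complex.Re ((z : 'rV_n) 0 j)).
Proof.
apply: continuous_measurable_Cn => z.
apply: (@continuous_comp _ _ _ (fun z : 'rV[C]_n => z 0 j)).
  exact: coord_continuous.
exact: continuous_Re.
Qed.

Lemma measurable_coord_Im j : measurable_fun [set: CT] (fun z : CT => complex.Im ((z : 'rV_n) 0 j)).
Proof.
apply: continuous_measurable_Cn => z.
apply: (@continuous_comp _ _ _ (fun z : 'rV[C]_n => z 0 j)).
  exact: coord_continuous.
exact: continuous_Im.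
Qed.

Definition cunvec (z : CT) : (n + n).-tuple RT :=
  [tuple match fintype.split i with
         | inl j => complex.Re ((z : 'rV_n) 0 j)
         | inr j => complex.Im ((z : 'rV_n) 0 j)
         end | i < n + n].

Lemma measurable_cvec' : measurable_fun setT (@cvec R n).
Proof. exact: measurable_funPT. Qed.

Lemma measurable_cunvec : measurable_fun setT cunvec.
Proof.
apply/measurable_fun_tnthP => i; case: (splitP i) => j ij.
  have -> : i = lshift n j by exact: val_inj.
  rewrite (_ : _ \o _ = fun z : CT => complex.Re ((z : 'rV_n) 0 j)).
    exact: measurable_coord_Re.
  by apply/funext => z /=; rewrite tnth_mktuple -[lshift n j]/(unsplit (inl j)) unsplitK.
have -> : i = rshift n j by exact: val_inj.
rewrite (_ : _ \o _ = fun z : CT => complex.Im ((z : 'rV_n) 0 j)).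
  exact: measurable_coord_Im.
by apply/funext => z /=; rewrite tnth_mktuple -[rshift n j]/(unsplit (inr j)) unsplitK.
Qed.

Lemma tnth_cunvecl z j : tnth (cunvec z) (lshift n j) = complex.Re (z 0 j).
Proof. by rewrite tnth_mktuple -[lshift n j]/(unsplit (inl j)) unsplitK. Qed.

Lemma tnth_cunvecr z j : tnth (cunvec z) (rshift n j) = complex.Im (z 0 j).
Proof. by rewrite tnth_mktuple -[rshift n j]/(unsplit (inr j)) unsplitK. Qed.

Lemma cunvecK : cancel cunvec (@cvec R n).
Proof.
move=> z; apply/rowP => j; rewrite mxE tnth_cunvecl tnth_cunvecr.
by case: (z 0 j).
Qed.

Lemma cvecK : cancel (@cvec R n) cunvec.
Proof.
move=> t; apply: eq_from_tnth => i; case: (splitP i) => j ij.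
  have -> : i = lshift n j by exact: val_inj.
  by rewrite tnth_cunvecl mxE.
have -> : i = rshift n j by exact: val_inj.
by rewrite tnth_cunvecr mxE.
Qed.

(** Factoring [f] through the measurable map [cvec] replaces the open sets of C^n by real
    coordinates. *)
Lemma measurable_to_Cn d (T : measurableType d) (f : T -> CT) :
  (forall j, measurable_fun setT (fun x => complex.Re ((f x : 'rV_n) 0 j))) ->
  (forall j, measurable_fun setT (fun x => complex.Im ((f x : 'rV_n) 0 j))) ->
  measurable_fun setT f.
Proof.
move=> fR fI; rewrite (_ : f = @cvec R n \o (cunvec \o f)); last first.
  by apply/funext => x /=; rewrite cunvecK.
apply: measurableT_comp; first exact: measurable_cvec'.
apply/measurable_fun_tnthP => i; case: (splitP i) => j ij.
  have -> : i = lshift n j by exact: val_inj.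
  rewrite (_ : _ \o _ = fun x => complex.Re ((f x : 'rV_n) 0 j)).
    exact: fR.
  by apply/funext => x /=; exact: tnth_cunvecl.
have -> : i = rshift n j by exact: val_inj.
rewrite (_ : _ \o _ = fun x => complex.Im ((f x : 'rV_n) 0 j)).
  exact: fI.
by apply/funext => x /=; exact: tnth_cunvecr.
Qed.

Definition cmeasurable d (T : measurableType d) (f : T -> C) : Prop :=
  measurable_fun setT (fun x => complex.Re (f x)) /\
  measurable_fun setT (fun x => complex.Im (f x)).

Section closure.
Context d (T : measurableType d).
Implicit Types (a b : T -> C) (f g : T -> CT).

Lemma cmeasurable_cst (c : C) : cmeasurable (fun _ : T => c).
Proof. by split; exact: measurable_cst. Qed.

Lemma cmeasurableD a b : cmeasurable a -> cmeasurable b ->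
  cmeasurable (fun x => a x + b x).
Proof.
move=> [a1 a2] [b1 b2]; split.
  by under eq_fun do rewrite raddfD; exact: measurable_funD.
by under eq_fun do rewrite raddfD; exact: measurable_funD.
Qed.

Lemma cmeasurableM a b : cmeasurable a -> cmeasurable b ->
  cmeasurable (fun x => a x * b x).
Proof.
move=> [a1 a2] [b1 b2]; split.
  rewrite (_ : (fun _ => _) = fun x => complex.Re (a x) * complex.Re (b x) -
      complex.Im (a x) * complex.Im (b x)).
    by apply: measurable_funB; exact: measurable_funM.
  by apply/funext => x; case: (a x) => ? ?; case: (b x).
rewrite (_ : (fun _ => _) = fun x => complex.Re (a x) * complex.Im (b x) +
    complex.Im (a x) * complex.Re (b x)).
  by apply: measurable_funD; exact: measurable_funM.
by apply/funext => x; case: (a x) => ? ?; case: (b x).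
Qed.

Lemma cmeasurable_conj a : cmeasurable a -> cmeasurable (fun x => (a x)^*).
Proof.
move=> [a1 a2]; split.
  by rewrite (_ : (fun _ => _) = fun x => complex.Re (a x))//; apply/funext => x; case: (a x).
rewrite (_ : (fun _ => _) = fun x => - complex.Im (a x)).
  exact: measurable_funN.
by apply/funext => x; case: (a x).
Qed.

Lemma cmeasurable_cexp a : cmeasurable a -> cmeasurable (fun x => cexp (a x)).
Proof.
move=> [a1 a2]; split.
  rewrite (_ : (fun _ => _) = fun x => expR (complex.Re (a x)) * cos (complex.Im (a x))).
    apply: measurable_funM; first exact: measurableT_comp.
    by apply: measurableT_comp a2; apply: continuous_measurable_fun; exact: continuous_cos.
  by apply/funext => x; case: (a x).
rewrite (_ : (fun _ => _) = fun x => expR (complex.Re (a x)) * sin (complex.Im (a x))).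
  apply: measurable_funM; first exact: measurableT_comp.
  by apply: measurableT_comp a2; apply: continuous_measurable_fun; exact: continuous_sin.
by apply/funext => x; case: (a x).
Qed.

Lemma cmeasurable_sum I (r : seq I) (a : I -> T -> C) : (forall i, cmeasurable (a i)) ->
  cmeasurable (fun x => \sum_(i <- r) a i x).
Proof.
move=> ma; elim: r => [|i r IH].
  by under [X in cmeasurable X]eq_fun do rewrite big_nil; exact: cmeasurable_cst.
by under [X in cmeasurable X]eq_fun do rewrite big_cons; exact: cmeasurableD.
Qed.

Lemma cmeasurable_coord f j : measurable_fun setT f -> cmeasurable (fun x => (f x : 'rV_n) 0 j).
Proof.
move=> mf; split.
  by apply: (measurableT_comp (measurable_coord_Re j)).
by apply: (measurableT_comp (measurable_coord_Im j)).
Qed.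

Lemma measurable_to_CnP f : (forall j, cmeasurable (fun x => (f x : 'rV_n) 0 j)) ->
  measurable_fun setT f.
Proof. by move=> mf; apply: measurable_to_Cn => j; case: (mf j). Qed.

Lemma measurable_CnD f g : measurable_fun setT f -> measurable_fun setT g ->
  measurable_fun setT (fun x => (f x : 'rV_n) + g x : CT).
Proof.
move=> mf mg; apply: measurable_to_CnP => j.
by under [X in cmeasurable X]eq_fun do rewrite mxE; apply: cmeasurableD; exact: cmeasurable_coord.
Qed.

Lemma measurable_CnZ a f : cmeasurable a -> measurable_fun setT f ->
  measurable_fun setT (fun x => a x *: (f x : 'rV_n) : CT).
Proof.
move=> ma mf; apply: measurable_to_CnP => j.
by under [X in cmeasurable X]eq_fun do rewrite mxE; apply: cmeasurableM => //; exact: cmeasurable_coord.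
Qed.

Lemma cmeasurable_cdot f g : measurable_fun setT f -> measurable_fun setT g ->
  cmeasurable (fun x => cdot (f x) (g x)).
Proof.
move=> mf mg; apply: cmeasurable_sum => j; apply: cmeasurableM; first exact: cmeasurable_coord.
by apply: cmeasurable_conj; exact: cmeasurable_coord.
Qed.

Lemma cmeasurable_kernel f g : measurable_fun setT f -> measurable_fun setT g ->
  cmeasurable (fun x => bargmann_kernel (f x) (g x)).
Proof. by move=> mf mg; apply: cmeasurable_cexp; exact: cmeasurable_cdot. Qed.

Lemma measurable_cnorm f : measurable_fun setT f ->
  measurable_fun setT (fun x => cnorm (f x)).
Proof.
move=> mf; have [mr _] := cmeasurable_cdot mf mf.
exact: (measurableT_comp (continuous_measurable_fun (@sqrt_continuous R)) mr).
Qed.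

End closure.
End measurable_Cn.

Section lebesgue_Cn.
Local Open Scope complex_scope.
Context {R : realType} {n : nat}.
Local Notation mu := (@lebesgue_measure R).
Local Notation RT := (measurableTypeR R).
Local Notation CT := (Cn R n).
Implicit Types (z w : 'rV[R[i]]_n).
Local Notation V := (@lebesgueC R n).

Lemma lebesgueC_sigma_finite : sigma_finite setT V.
Proof.
have [F FT Ffin] := sigma_finiteT (measure_power mu (n + n)).
exists (fun k => cunvec @^-1` F k).
  apply/esym; rewrite -subTset => z _.
  by have : setT (cunvec z) by []; rewrite FT.
move=> k; have [mF Fk] := Ffin k; split.
  by rewrite -[X in measurable X]setTI; exact: measurable_cunvec.
rewrite /lebesgueC /pushforward -comp_preimage (_ : _ \o _ = id)//.
by apply/funext => t /=; rewrite cvecK.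
Qed.

HB.instance Definition _ := Measure_isSigmaFinite.Build _ _ _ V lebesgueC_sigma_finite.

Lemma ge0_integral_lebesgueC (f : CT -> \bar R) : measurable_fun setT f ->
  (forall z, 0 <= f z)%E ->
  (\int[V]_z f z = \int[measure_power mu (n + n)]_t f (cvec t))%E.
Proof. by move=> mf f0; rewrite ge0_integral_pushforward. Qed.

Lemma ge0_integral_Cshift w (f : CT -> \bar R) : measurable_fun setT f ->
  (forall z, 0 <= f z)%E ->
  (\int[V]_z f ((z : 'rV[R[i]]_n) + w)%R = \int[V]_z f z)%E.
Proof.
move=> mf f0; rewrite !ge0_integral_lebesgueC//; last first.
  apply: (measurableT_comp mf); apply: measurable_CnD; first exact: measurable_id.
  exact: measurable_cst.
rewrite -[RHS](@ge0_integral_tshift _ _ (cunvec w) (f \o @cvec R n))//.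
- apply: eq_integral => t _ /=; congr f; apply/rowP => j; rewrite !mxE !tnth_mktuple.
  rewrite -[lshift n j]/(unsplit (inl j)) -[rshift n j]/(unsplit (inr j)) !unsplitK.
  by case: (w 0 j).
- exact: (measurableT_comp mf measurable_cvec').
- by move=> t; exact: f0.
Qed.

Lemma cnorm_sqr z :
  cnorm z ^+ 2 = \sum_(j < n) (complex.Re (z 0 j) ^+ 2 + complex.Im (z 0 j) ^+ 2).
Proof.
have E : complex.Re (cdot z z) =
    \sum_(j < n) (complex.Re (z 0 j) ^+ 2 + complex.Im (z 0 j) ^+ 2).
  rewrite /cdot raddf_sum; apply: eq_bigr => j _.
  by case: (z 0 j) => a b /=; rewrite mulrN opprK.
rewrite /cnorm sqr_sqrtr E//.
by apply: sumr_ge0 => j _; rewrite addr_ge0// sqr_ge0.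
Qed.

Lemma cnorm_sqr_cvec (t : (n + n).-tuple RT) :
  cnorm (cvec t) ^+ 2 = \sum_(i < n + n) tnth t i ^+ 2.
Proof.
rewrite cnorm_sqr big_split_ord big_split/=; congr (_ + _); apply: eq_bigr => j _.
  by rewrite mxE.
by rewrite mxE.
Qed.

Lemma integral_gaussC (c I : R) : (\int[mu]_x (expR (- (c * x ^+ 2)))%:E)%E = I%:E ->
  (\int[V]_z (expR (- (c * cnorm z ^+ 2)))%:E = (I ^+ (n + n))%:E)%E.
Proof.
move=> cI; rewrite ge0_integral_lebesgueC; last first.
- by move=> z; rewrite lee_fin expR_ge0.
- apply/measurable_EFinP; apply: measurableT_comp => //; apply: measurable_funN.
  apply: measurable_funM => //; apply: measurable_funX; apply: measurable_cnorm.
  exact: measurable_id.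
have mg : measurable_fun [set: RT] (fun x : RT => expR (- (c * x ^+ 2))).
  apply: measurableT_comp => //; apply: measurable_funN.
  by apply: measurable_funM; [exact: measurable_cst|exact: measurable_funX].
rewrite -(ge0_integral_prod (n + n) mg _ cI); last by move=> x; exact: expR_ge0.
apply: eq_integral => t _; rewrite cnorm_sqr_cvec mulr_sumr -sumrN expR_sum.
by [].
Qed.

Lemma gaussC_integrable (c : R) : 0 < c ->
  exists I, (\int[V]_z (expR (- (c * cnorm z ^+ 2)))%:E = I%:E)%E.
Proof. by move=> /gauss_integrable1[I cI]; exists (I ^+ (n + n)); exact: integral_gaussC. Qed.

Lemma gauss_density_ge0 z : 0 <= gauss_density z.
Proof. by rewrite mulr_ge0 ?expR_ge0// invr_ge0 exprn_ge0// pi_ge0. Qed.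

Lemma measurable_gauss_density : measurable_fun setT (@gauss_density R n : CT -> R).
Proof.
apply: measurable_funM => //; apply: measurableT_comp => //; apply: measurable_funN.
by apply: measurable_funX; apply: measurable_cnorm; exact: measurable_id.
Qed.

Lemma integral_gauss_density : (\int[V]_z (gauss_density z)%:E = 1)%E.
Proof.
under eq_integral do rewrite EFinM.
rewrite ge0_integralZl//; last first.
- by rewrite lee_fin invr_ge0 exprn_ge0// pi_ge0.
- apply/measurable_EFinP; apply: measurableT_comp => //; apply: measurable_funN.
  by apply: measurable_funX; apply: measurable_cnorm; exact: measurable_id.
have h : (\int[V]_z (expR (- cnorm z ^+ 2))%:E = (Num.sqrt pi ^+ (n + n))%:E)%E.
  rewrite -(@integral_gaussC 1 (Num.sqrt pi)); last first.
    by under eq_integral do rewrite mul1r; exact: integralT_gauss.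
  by apply: eq_integral => z _; rewrite mul1r.
rewrite h -EFinM addnn -mul2n exprM sqr_sqrtr ?pi_ge0// mulVf//.
by rewrite gt_eqF// exprn_gt0// pi_gt0.
Qed.

End lebesgue_Cn.

(** * Comparison of integrals and change of measure *)

Section integral_transfer.
Import HBNNSimple.
Local Open Scope ereal_scope.

(** The integral of a nonnegative function is a supremum over the simple functions below it, so
    domination is enough. This allows comparison with integrands such as
    [hs_norm dot (Xi z v) ^+ 2], whose measurability is never established. *)
Lemma ge0_le_integralT d (T : measurableType d) (R : realType)
    (mu : {measure set T -> \bar R}) (f1 f2 : T -> \bar R) :
  (forall x, 0 <= f1 x) -> (forall x, f1 x <= f2 x) ->
  \int[mu]_x f1 x <= \int[mu]_x f2 x.
Proof.
move=> f10 f12; have f20 x : 0 <= f2 x by exact: le_trans (f12 x).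
rewrite !ge0_integralTE//; apply: le_ereal_sup => _ [h hf <-].
by exists h => // x; exact: le_trans (f12 x).
Qed.

(** Both sides agree on simple functions, by additivity and the formula for [nu] on measurable sets;
    monotone convergence along simple approximations of [f] does the rest. *)
Lemma ge0_integral_density d (T : measurableType d) (R : realType)
    (mu nu : {measure set T -> \bar R}) (g : T -> R) (f : T -> \bar R) :
  measurable_fun setT g -> (forall x, 0 <= g x)%R ->
  (forall A, measurable A -> nu A = \int[mu]_(x in A) (g x)%:E) ->
  measurable_fun setT f -> (forall x, 0 <= f x) ->
  \int[nu]_x f x = \int[mu]_x (f x * (g x)%:E).
Proof.
move=> mg g0 nuE mf f0; pose h := nnsfun_approx measurableT mf.
have mgE : measurable_fun setT (fun x => (g x)%:E) by exact/measurable_EFinP.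
have -> : \int[nu]_x f x = lim (\int[nu]_x (EFin \o h n) x @[n --> \oo]).
  have fE x : f x = lim ((EFin \o h n) x @[n --> \oo]).
    by apply/esym/cvg_lim => //; apply: cvg_nnsfun_approx.
  under eq_integral => x _ do rewrite fE.
  apply: monotone_convergence => //.
  - by move=> n; apply/measurable_EFinP; exact/measurable_funP.
  - by move=> n x Ex //=; rewrite lee_fin.
  - by move=> x Ex a b ab; rewrite lee_fin; exact/lefP/nd_nnsfun_approx.
have -> : \int[mu]_x (f x * (g x)%:E) =
    lim (\int[mu]_x ((EFin \o h n) x * (g x)%:E) @[n --> \oo]).
  have fg x : f x * (g x)%:E = lim ((EFin \o h n) x * (g x)%:E @[n --> \oo]).
    by apply/esym/cvg_lim => //; apply: cvgeZr => //; apply: cvg_nnsfun_approx.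
  under eq_integral => x _ do rewrite fg.
  apply: monotone_convergence => //.
  - move=> n; apply/emeasurable_funM => //.
    by apply/measurable_EFinP; exact/measurable_funP.
  - by move=> n x Ex /=; rewrite mule_ge0 ?lee_fin.
  - move=> x Ex a b ab/=; rewrite lee_wpmul2r ?lee_fin//.
    exact/lefP/nd_nnsfun_approx.
suff hn n : \int[nu]_x (EFin \o h n) x = \int[mu]_x ((EFin \o h n) x * (g x)%:E).
  by under eq_fun do rewrite hn.
transitivity (\int[mu]_x (\sum_(y \in range (h n))
    (y * \1_(h n @^-1` [set y]) x)%:E * (g x)%:E)); last first.
  apply: eq_integral => x _; rewrite /= fimfunE -fsumEFin//.
  by rewrite ge0_mule_fsuml// => y; exact: nnfun_muleindic_ge0.
rewrite ge0_integral_fsum//; last 2 first.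
  - move=> y; apply: emeasurable_funM => //.
    by apply/measurable_EFinP; exact: measurable_funM.
  - by move=> y x _; rewrite mule_ge0 ?lee_fin ?g0// -lee_fin nnfun_muleindic_ge0.
rewrite integralT_nnsfun sintegralE; apply: eq_fsbigr => r rhn.
under [RHS]eq_integral do rewrite EFinM -muleA.
have mhr : measurable (h n @^-1` [set r]) by [].
rewrite ge0_integralZl//.
- congr (_ * _); rewrite nuE// integral_mkcond; apply: eq_integral => x _.
  by rewrite epatch_indic muleC.
- by apply: emeasurable_funM => //; exact/measurable_EFinP.
- by move=> t Et; rewrite mule_ge0 ?lee_fin ?g0.
- by move: rhn; rewrite inE => -[t _ <-]; rewrite lee_fin.
Qed.

(* Identities between integrals of nonnegative functions extend to signed
   functions without an integrability hypothesis, by the convention for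
   [oo - oo]. *)
Lemma integral_transfer d1 d2 (T1 : measurableType d1) (T2 : measurableType d2)
    (R : realType) (m1 : {measure set T1 -> \bar R})
    (m2 : {measure set T2 -> \bar R}) (phi : T1 -> T2) (g : T1 -> R) :
  (forall x, 0 <= g x)%R ->
  (forall f : T2 -> \bar R, measurable_fun setT f -> (forall y, 0 <= f y) ->
    \int[m2]_y f y = \int[m1]_x (f (phi x) * (g x)%:E)) ->
  forall f : T2 -> R, measurable_fun setT f ->
    \int[m2]_y (f y)%:E = \int[m1]_x (f (phi x) * g x)%:E.
Proof.
move=> g0 tr f mf; have mfE : measurable_fun setT (EFin \o f) by exact/measurable_EFinP.
rewrite integralE [RHS]integralE; congr (_ - _).
  rewrite tr//; last exact: measurable_funepos.
  apply: eq_integral => x _; rewrite !funeposE.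
  by rewrite -!EFin_max -EFinM maxr_pMl// mul0r.
rewrite tr//; last exact: measurable_funeneg.
apply: eq_integral => x _; rewrite !funenegE.
by rewrite -!EFinN -!EFin_max -EFinM maxr_pMl// mul0r mulNr.
Qed.

End integral_transfer.

Section gauss_measure.
Local Open Scope complex_scope.
Context {R : realType} {n : nat}.
Local Notation CT := (Cn R n).
Local Notation V := (@lebesgueC R n).
Local Notation mu := (@muG R n).
Local Notation g := (@gauss_density R n).
Implicit Types (z w u v : 'rV[R[i]]_n).

Lemma ge0_integral_muG (f : CT -> \bar R) : measurable_fun setT f ->
  (forall z, 0 <= f z)%E ->
  (\int[mu]_z f z = \int[V]_z (f z * (g z)%:E))%E.
Proof.
move=> mf f0; apply: ge0_integral_density => //.
- exact: measurable_gauss_density.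
- exact: gauss_density_ge0.
Qed.

Lemma integral_muG (f : CT -> R) : measurable_fun setT f ->
  (\int[mu]_z (f z)%:E = \int[V]_z (f z * g z)%:E)%E.
Proof.
apply: (integral_transfer (phi := id)); first exact: gauss_density_ge0.
exact: ge0_integral_muG.
Qed.

Lemma muG_setT : mu setT = 1%E.
Proof. exact: integral_gauss_density. Qed.

HB.instance Definition _ := Measure_isProbability.Build _ _ _ mu muG_setT.

Lemma integral_Cshift w (f : CT -> R) : measurable_fun setT f ->
  (\int[V]_z (f ((z : 'rV[R[i]]_n) + w))%:E = \int[V]_z (f z)%:E)%E.
Proof.
move=> mf; rewrite [RHS](@integral_transfer _ _ _ _ _ V V
  (fun z : CT => (z : 'rV[R[i]]_n) + w) (fun=> 1))//.
  by apply: eq_integral => z _; rewrite mulr1.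
move=> h mh h0; rewrite -(ge0_integral_Cshift w)//.
by apply: eq_integral => z _; rewrite mule1.
Qed.

Lemma cdotDl z w u : cdot (z + w) u = cdot z u + cdot w u.
Proof. by rewrite -big_split/=; apply: eq_bigr => j _; rewrite mxE mulrDl. Qed.

Lemma cdotC z w : cdot z w = (cdot w z)^*.
Proof.
rewrite /cdot rmorph_sum; apply: eq_bigr => j _.
rewrite rmorphM mulrC; congr (_ * _); exact/esym/conjcK.
Qed.

Lemma cdotZl (a : R[i]) z w : cdot (a *: z) w = a * cdot z w.
Proof. by rewrite /cdot mulr_sumr; apply: eq_bigr => j _; rewrite mxE mulrA. Qed.

Lemma cdotNl z w : cdot (- z) w = - cdot z w.
Proof. by rewrite -scaleN1r cdotZl mulN1r. Qed.

Lemma cdotDr z w u : cdot u (z + w) = cdot u z + cdot u w.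
Proof. by rewrite cdotC cdotDl rmorphD/= -!cdotC. Qed.

Lemma cdotNr z w : cdot w (- z) = - cdot w z.
Proof. by rewrite cdotC cdotNl rmorphN/= -!cdotC. Qed.

Lemma Re_cdotC z w : complex.Re (cdot z w) = complex.Re (cdot w z).
Proof. by rewrite cdotC; case: (cdot w z). Qed.

Lemma cdotzz z : cdot z z = (cnorm z ^+ 2)%:C.
Proof.
rewrite cnorm_sqr rmorph_sum; apply: eq_bigr => j _.
by case: (z 0 j) => a b; apply/eqP; rewrite eq_complex/=; apply/andP; split;
  apply/eqP; ring.
Qed.

Lemma cnormD_sqr z w :
  cnorm (z + w) ^+ 2 = cnorm z ^+ 2 + 2 * complex.Re (cdot z w) + cnorm w ^+ 2.
Proof.
apply: complexI; rewrite -cdotzz cdotDl !cdotDr !cdotzz (cdotC w z).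
by case: (cdot z w) => a b; apply/eqP; rewrite eq_complex/=; apply/andP; split;
  apply/eqP; ring.
Qed.

Lemma cnormN z : cnorm (- z) = cnorm z.
Proof. by rewrite /cnorm cdotNl cdotNr opprK. Qed.

Lemma cnormB_sqr z w :
  cnorm (z - w) ^+ 2 = cnorm z ^+ 2 - 2 * complex.Re (cdot z w) + cnorm w ^+ 2.
Proof. by rewrite cnormD_sqr cnormN cdotNr raddfN; ring. Qed.

Lemma cnorm_ge0 z : 0 <= cnorm z.
Proof. exact: sqrtr_ge0. Qed.

Lemma cnormZ_sqr (a : R[i]) z : cnorm (a *: z) ^+ 2 = cabs a ^+ 2 * cnorm z ^+ 2.
Proof.
rewrite cabs_sqr !cnorm_sqr mulr_sumr; apply: eq_bigr => j _; rewrite mxE.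
by case: a => a b; case: (z 0 j) => c d /=; ring.
Qed.

Lemma gauss_densityN z : g (- z) = g z.
Proof. by rewrite /gauss_density cnormN. Qed.

(* Uniqueness of Haar measure: both sides are compared by integrating
   [g x * f (y + a x)] over x and y. *)
Lemma ge0_integral_rotation (a : R[i]) (f : CT -> \bar R) : cabs a = 1 ->
  measurable_fun setT f -> (forall z, 0 <= f z)%E ->
  (\int[V]_z f (a *: (z : 'rV_n)) = \int[V]_z f z)%E.
Proof.
move=> a1 mf f0.
have a0 : a != 0.
  by apply/eqP => a0; move: a1; rewrite a0 /cabs normr0 => /eqP; rewrite eq_sym oner_eq0.
(* As a function of [y] the factor [g (x - a^-1 y)] has total mass 1, because [|a| = 1]; so [k]
   integrates to [f (a x)]. Replacing [x] by [x + a^-1 y] turns [k] into [l], whose [f] factor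
   integrates over [y] to the integral of [f] by translation. *)
pose k (p : CT * CT) : \bar R :=
  (f (a *: (p.1 : 'rV_n))%R * (g ((p.1 : 'rV_n) - a^-1 *: (p.2 : 'rV_n))%R)%:E)%E.
pose l (p : CT * CT) : \bar R :=
  (f ((p.2 : 'rV_n) + a *: (p.1 : 'rV_n))%R * (g p.1)%:E)%E.
have m1 : measurable_fun [set: CT * CT] fst by exact: measurable_fst.
have m2 : measurable_fun [set: CT * CT] snd by exact: measurable_snd.
have mC (c : R[i]) d (T : measurableType d) (h : T -> CT) : measurable_fun setT h ->
    measurable_fun setT (fun x => c *: (h x : 'rV_n) : CT).
  by move=> mh; apply: measurable_CnZ => //; exact: cmeasurable_cst.
have mg d (T : measurableType d) (h : T -> CT) : measurable_fun setT h ->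
    measurable_fun setT (fun x => (g (h x))%:E).
  by move=> mh; apply/measurable_EFinP; apply: measurableT_comp mh; exact: measurable_gauss_density.
have mk : measurable_fun setT k.
  apply: emeasurable_funM; first exact: (measurableT_comp mf (mC a _ _ _ m1)).
  apply: mg; under eq_fun do rewrite -scaleNr.
  by apply: measurable_CnD => //; exact: mC.
have ml : measurable_fun setT l.
  apply: emeasurable_funM; last exact: mg.
  by apply: (measurableT_comp mf); apply: measurable_CnD => //; exact: mC.
have g0 z : (0 <= (g z)%:E)%E by rewrite lee_fin gauss_density_ge0.
have k0 p : (0 <= k p)%E by exact: mule_ge0.
have l0 p : (0 <= l p)%E by exact: mule_ge0.
have ga z : g (a *: z) = g z by rewrite /gauss_density cnormZ_sqr a1 expr1n mul1r.
have gC w : (\int[V]_z (g ((z : 'rV_n) + w)%R)%:E = 1)%E.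
  rewrite (ge0_integral_Cshift w (f := fun z => (g z)%:E))//; last by apply: mg; exact: measurable_id.
  exact: integral_gauss_density.
transitivity (\int[V]_x \int[V]_y k (x, y))%E.
  apply: eq_integral => x _; rewrite /k/= ge0_integralZl//; last first.
    - apply: mg; under eq_fun do rewrite addrC -scaleNr.
      apply: measurable_CnD; last exact: measurable_cst.
      by apply: mC; exact: measurable_id.
  have gE (x' y : 'rV[R[i]]_n) : g (x' - a^-1 *: y) = g (y + - (a *: x')).
    have e : a *: (x' - a^-1 *: y) = - (y + - (a *: x')).
      by rewrite scalerBr scalerA mulfV// scale1r opprB.
    by rewrite -(ga (x' - a^-1 *: y)) e gauss_densityN.
  rewrite -[LHS]mule1; congr (_ * _)%E; rewrite -(gC (- (a *: (x : 'rV_n)))).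
  by apply: eq_integral => y _; rewrite gE.
transitivity (\int[V]_y \int[V]_x k (x, y))%E; first exact: fubini_tonelli mk k0.
have kl (x y : 'rV_n) : k (x + a^-1 *: y, y) = l (x, y).
  by rewrite /k /l/= addrK scalerDr scalerA mulfV// scale1r addrC.
transitivity (\int[V]_y \int[V]_x l (x, y))%E.
  apply: eq_integral => y _.
  have mky : measurable_fun setT (fun x : CT => k (x, y)).
    exact: (measurableT_comp mk (pair2_measurable y)).
  have := @ge0_integral_Cshift R n (a^-1 *: (y : 'rV_n)) (fun x => k (x, y)) mky (fun x => k0 (x, y)).
  by move=> <-; apply: eq_integral => x _; rewrite kl.
transitivity (\int[V]_x \int[V]_y l (x, y))%E.
  by symmetry; exact: fubini_tonelli ml l0.
transitivity (\int[V]_x (\int[V]_y f y * (g x)%:E))%E.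
  apply: eq_integral => x _; rewrite /l/= ge0_integralZr//.
    congr (_ * _)%E; exact: ge0_integral_Cshift.
  apply: (measurableT_comp mf); apply: measurable_CnD; last exact: measurable_cst.
  exact: measurable_id.
rewrite ge0_integralZl//.
- by rewrite integral_gauss_density mule1.
- by apply: mg; exact: measurable_id.
- exact: integral_ge0.
Qed.

Lemma integral_rotation (a : R[i]) (f : CT -> R) : cabs a = 1 ->
  measurable_fun setT f ->
  (\int[V]_z (f (a *: (z : 'rV_n)))%:E = \int[V]_z (f z)%:E)%E.
Proof.
move=> a1 mf; rewrite [RHS](@integral_transfer _ _ _ _ _ V V
  (fun z : CT => a *: (z : 'rV[R[i]]_n)) (fun=> 1))//.
  by apply: eq_integral => z _; rewrite mulr1.
move=> h mh h0; rewrite -(ge0_integral_rotation a1)//.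
by apply: eq_integral => z _; rewrite mule1.
Qed.

End gauss_measure.

(** * Mean values of entire functions *)

Section complex_exponential.
Local Open Scope complex_scope.
Context {R : realType}.
Implicit Types (a b : R[i]) (x y t : R).

Lemma cexpD a b : cexp (a + b) = cexp a * cexp b.
Proof.
case: a b => a1 a2 [b1 b2]; apply/eqP; rewrite eq_complex/= expRD sinD cosD.
by apply/andP; split; apply/eqP; ring.
Qed.

Lemma cexp0 : cexp 0 = 1 :> R[i].
Proof. by apply/eqP; rewrite eq_complex/= expR0 cos0 sin0 mulr1 mulr0 !eqxx. Qed.

Lemma cexp_conj a : cexp a^* = (cexp a)^*.
Proof. by case: a => x y; rewrite /cexp/= cosN sinN mulrN. Qed.

Lemma cabs_cexp a : cabs (cexp a) = expR (complex.Re a).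
Proof.
apply/eqP; rewrite -(@eqrXn2 _ 2) ?cabs_ge0 ?expR_ge0// cabs_sqr; apply/eqP.
by case: a => x y /=; rewrite !exprMn -mulrDr cos2Dsin2 mulr1.
Qed.

Lemma cabsD a b : cabs (a + b) <= cabs a + cabs b.
Proof. by rewrite -lecR rmorphD/= -!cabsE ler_normD. Qed.

Lemma cabsN a : cabs (- a) = cabs a.
Proof. by rewrite /cabs normrN. Qed.

Lemma cabs0 : cabs 0 = 0 :> R.
Proof. by rewrite /cabs normr0. Qed.

Lemma cabs1 : cabs 1 = 1 :> R.
Proof. by rewrite /cabs normr1. Qed.

Lemma cabs_conj a : cabs a^* = cabs a.
Proof.
apply/eqP; rewrite -(@eqrXn2 _ 2) ?cabs_ge0// !cabs_sqr.
by case: a => x y /=; rewrite sqrrN.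
Qed.

Lemma Re_le_cabs a : `|complex.Re a| <= cabs a.
Proof.
rewrite -(@ler_pXn2r _ 2)// ?nnegrE ?cabs_ge0// cabs_sqr.
by rewrite real_normK ?num_real// lerDl sqr_ge0.
Qed.

Lemma cabs_le a : cabs a <= `|complex.Re a| + `|complex.Im a|.
Proof.
rewrite -(@ler_pXn2r _ 2)// ?nnegrE ?cabs_ge0 ?addr_ge0// cabs_sqr.
rewrite -(real_normK (num_real (complex.Re a))) -(real_normK (num_real (complex.Im a))).
by rewrite sqrrD -addrA lerD2l lerDr mulrn_wge0// mulr_ge0.
Qed.

(** The mean value theorem twice: the remainder is [f'' d * c] with [0 < d < c < 1]. The factor 1/2
    of Taylor's formula is given up. *)
Lemma taylor2_bound (f f' f'' : R -> R) (K : R) :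
  (forall t, is_derive t 1 f (f' t)) -> (forall t, is_derive t 1 f' (f'' t)) ->
  (forall t, 0 <= t <= 1 -> `|f'' t| <= K) -> `|f 1 - f 0 - f' 0| <= K.
Proof.
move=> df df' f''K.
have cont (h h' : R -> R) : (forall t, is_derive t 1 h (h' t)) -> continuous h.
  by move=> dh t; apply: differentiable_continuous; apply/derivable1_diffP; exact: ex_derive.
have [c] := @MVT R f f' 0 1 ltr01 (fun t _ => df t) (continuous_subspaceT (cont _ _ df)).
rewrite in_itv/= => /andP[c0 c1]; rewrite subr0 mulr1 => ->.
have [d] := @MVT R f' f'' 0 c c0 (fun t _ => df' t) (continuous_subspaceT (cont _ _ df')).
rewrite in_itv/= => /andP[d0 d1].
rewrite subr0 => ->; rewrite normrM.
apply: le_trans (_ : _ <= `|f'' d| * 1) _.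
  by rewrite ler_wpM2l// ger0_norm ltW.
by rewrite mulr1 f''K// (ltW d0)/= ltW// (lt_trans d1).
Qed.

(** The span of the real and imaginary parts of [exp (t (x + i y))]. It is closed under
    differentiation in [t]: the coefficients [(p, q)] become [(x p + y q, x q - y p)]. *)
Let osc x y p q t := expR (t * x) * (p * cos (t * y) + q * sin (t * y)).

Let is_derive_osc x y p q t :
  is_derive t 1 (osc x y p q) (osc x y (x * p + y * q) (x * q - y * p) t).
Proof.
have dl c : is_derive t 1 ( *%R^~ c : R -> R) c.
  have -> : ( *%R^~ c : R -> R) = c \*: (@id R).
    by apply/funext => s /=; rewrite mulrC.
  by apply: is_derive_eq; rewrite scaler1.
have de : is_derive t 1 (expR \o ( *%R^~ x)) (expR (t * x) * x).
  by apply: is_derive_eq; rewrite /= mulrC.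
have dc : is_derive t 1 (cos \o ( *%R^~ y)) (- sin (t * y) * y).
  by apply: is_derive_eq; rewrite /= mulrC.
have ds : is_derive t 1 (sin \o ( *%R^~ y)) (cos (t * y) * y).
  by apply: is_derive_eq; rewrite /= mulrC.
have -> : osc x y p q = (expR \o ( *%R^~ x)) *
    (p \*: (cos \o ( *%R^~ y)) + q \*: (sin \o ( *%R^~ y))).
  by [].
apply: is_derive_eq; rewrite /osc /GRing.scale/=.
rewrite -[(p \*: _ + q \*: _) t]/(p * cos (t * y) + q * sin (t * y)); ring.
Qed.

Let osc_le x y p q t : 0 <= t <= 1 -> `|osc x y p q t| <= expR `|x| * (`|p| + `|q|).
Proof.
move=> /andP[t0 t1]; rewrite normrM ger0_norm ?expR_ge0// ler_pM ?expR_ge0//.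
  rewrite ler_expR; apply: le_trans (ler_norm _) _.
  by rewrite normrM ler_piMl// ger0_norm.
apply: le_trans (ler_normD _ _) _; rewrite !normrM lerD// ler_piMr//.
  by rewrite ler_norml cos_geN1 cos_le1.
by rewrite ler_norml sin_geN1 sin_le1.
Qed.

(** Real and imaginary part are values of [osc] at [t = 1]. The second derivative of each has two
    coefficients of size at most [cabs a ^+ 2], which gives 2 for each part and 4 in all. *)
Lemma cexp_taylor2 a : cabs (cexp a - 1 - a) <= 4 * cabs a ^+ 2 * expR (cabs a).
Proof.
case: a => x y; set a := x +i* y; set N := cabs a.
have xN : `|x| <= N := Re_le_cabs a.
have N2 : N ^+ 2 = x ^+ 2 + y ^+ 2 by rewrite /N cabs_sqr.
have eN : expR `|x| <= expR N by rewrite ler_expR.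
have e0 : 0 <= expR `|x| by rewrite expR_ge0.
have b1 : `|x ^+ 2 - y ^+ 2| <= N ^+ 2.
  rewrite N2 ler_norml; have := sqr_ge0 x; have := sqr_ge0 y.
  by move=> *; apply/andP; split; lra.
have b2 : `|2 * x * y| <= N ^+ 2.
  rewrite N2 ler_norml.
  have h1 : 0 <= x ^+ 2 + 2 * x * y + y ^+ 2 by rewrite (_ : _ + _ = (x + y) ^+ 2) ?sqr_ge0//; ring.
  have h2 : 0 <= x ^+ 2 - 2 * x * y + y ^+ 2 by rewrite (_ : _ + _ = (x - y) ^+ 2) ?sqr_ge0//; ring.
  by apply/andP; split; lra.
have bd p q : `|p| <= N ^+ 2 -> `|q| <= N ^+ 2 ->
    expR `|x| * (`|p| + `|q|) <= 2 * N ^+ 2 * expR N.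
  move=> pN qN; rewrite [leRHS]mulrC; apply: ler_pM => //; first exact: addr_ge0.
  by rewrite mulrDl mul1r lerD.
have hR : `|expR x * cos y - 1 - x| <= 2 * N ^+ 2 * expR N.
  have := @taylor2_bound (osc x y 1 0) (osc x y x (- y))
    (osc x y (x ^+ 2 - y ^+ 2) (- (2 * x * y))) (2 * N ^+ 2 * expR N).
  rewrite /osc !mul1r !mul0r cos0 sin0 expR0 !mul1r !mulr1 !mulr0 !addr0; apply.
  - move=> t; have := is_derive_osc x y 1 0 t; rewrite /osc.
    by move=> h; apply: is_derive_eq; ring.
  - move=> t; have := is_derive_osc x y x (- y) t; rewrite /osc.
    by move=> h; apply: is_derive_eq; ring.
  - move=> t t01; apply: le_trans (osc_le _ _ _ _ t01) _.
    by apply: bd => //; rewrite normrN.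
have hI : `|expR x * sin y - y| <= 2 * N ^+ 2 * expR N.
  have := @taylor2_bound (osc x y 0 1) (osc x y y x)
    (osc x y (2 * x * y) (x ^+ 2 - y ^+ 2)) (2 * N ^+ 2 * expR N).
  rewrite /osc !mul1r !mul0r cos0 sin0 expR0 !mul1r !mulr1 !mulr0 !addr0 !add0r subr0; apply.
  - move=> t; have := is_derive_osc x y 0 1 t; rewrite /osc.
    by move=> h; apply: is_derive_eq; ring.
  - move=> t; have := is_derive_osc x y y x t; rewrite /osc.
    by move=> h; apply: is_derive_eq; ring.
  - by move=> t t01; apply: le_trans (osc_le _ _ _ _ t01) _; exact: bd.
apply: le_trans (cabs_le _) _ => /=; rewrite oppr0 addr0.
apply: le_trans (lerD hR hI) _; lra.
Qed.

End complex_exponential.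

(** * Integrals over intervals and Goursat's theorem *)

Section interval_integral.
Context {R : realType}.
Local Notation mu := (@lebesgue_measure R).
Implicit Types (f : R -> R) (a b c k e : R).

Definition itvint f a b : R := \int[mu]_(x in `[a, b]) f x.

Lemma fct_continuousB f g : continuous f -> continuous g ->
  continuous (fun x => f x - g x).
Proof. by move=> cf cg x; exact: cvgB (cf x) (cg x). Qed.

Lemma itvint_integrable f a b : continuous f -> mu.-integrable `[a, b] (EFin \o f).
Proof.
move=> cf; apply: continuous_compact_integrable; first exact: segment_compact.
exact: continuous_subspaceT.
Qed.

Lemma itvint_split f a b c : continuous f -> a <= c -> c <= b ->
  itvint f a b = itvint f a c + itvint f c b.
Proof.
move=> cf ac cb; have := @Rintegral_itvB R f (BLeft a) (BRight b) c.
rewrite !bnd_simp => /(_ (itvint_integrable _ _ cf) ac cb) h.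
rewrite /itvint [X in _ + X](_ : _ = \int[mu]_(x in `]c, b]) f x).
  by rewrite -h addrC subrK.
rewrite [RHS]Rintegral_itv_obnd_cbnd//.
apply: (integrableS _ _ _ (itvint_integrable c b cf)) => //.
by apply: subset_itvr; rewrite bnd_simp.
Qed.

Lemma itvintB f g a b : continuous f -> continuous g ->
  itvint (fun x => f x - g x) a b = itvint f a b - itvint g a b.
Proof. by move=> cf cg; rewrite /itvint RintegralB//; exact: itvint_integrable. Qed.

Lemma itvint_cst k a b : a <= b -> itvint (fun=> k) a b = k * (b - a).
Proof.
move=> ab; rewrite /itvint Rintegral_cst//=; congr (_ * _).
rewrite lebesgue_measure_itv/= lte_fin; have [//|ba] := ltP a b.
by rewrite (@le_anti _ _ a b) ?subrr// ab ba.
Qed.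

Lemma itvint_le f k e a b : continuous f -> a <= b ->
  (forall x, a <= x <= b -> `|f x - k| <= e) ->
  `|itvint f a b - k * (b - a)| <= e * (b - a).
Proof.
move=> cf ab fk; have cc (c : R) : continuous (fun _ : R => c) by move=> x; exact: cvg_cst.
rewrite -!itvint_cst// -itvintB//.
apply: le_trans (le_normr_Rintegral _ _) _ => //.
  exact: itvint_integrable (fct_continuousB cf (cc k)).
apply: le_Rintegral => //.
- apply: itvint_integrable => x; apply: cvg_norm.
  exact: fct_continuousB cf (cc k) x.
- exact: itvint_integrable.
Qed.

End interval_integral.

Section goursat.
Context {R : realType}.
Variables U V : R -> R -> R.

(* [U] and [V] play the real and imaginary parts of a holomorphic function of
   [s + i t]; only the equation [U_s = V_t] is needed. *)
Hypothesis UV : forall s0 t0, exists al be ga : R, forall e, 0 < e ->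
  exists2 d, 0 < d & forall s t, `|s - s0| <= d -> `|t - t0| <= d ->
    `|U s t - U s0 t0 - al * (s - s0) - be * (t - t0)| <= e * (`|s - s0| + `|t - t0|) /\
    `|V s t - V s0 t0 - ga * (s - s0) - al * (t - t0)| <= e * (`|s - s0| + `|t - t0|).

Let cont_of (F : R -> R -> R) : (forall s0 t0, exists a b : R, exists2 d, 0 < d &
    forall s t, `|s - s0| <= d -> `|t - t0| <= d ->
    `|F s t - F s0 t0 - a * (s - s0) - b * (t - t0)| <= `|s - s0| + `|t - t0|) ->
  (forall t, continuous (F^~ t)) /\ (forall s, continuous (F s)).
Proof.
move=> h; split=> [t s0|s t0].
  have [a [b [d d0 hd]]] := h s0 t; apply/cvgrPdist_le => e e0.
  have d'0 : 0 < Num.min d (e / (`|a| + 1)) by rewrite lt_min d0 divr_gt0// ltr_wpDl.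
  near=> s.
  have : `|s0 - s| <= Num.min d (e / (`|a| + 1)).
    by near: s; apply: cvgr_dist_le => //; exact: cvg_id.
  rewrite distrC le_min => /andP[sd se].
  have := hd s t sd; rewrite subrr normr0 mulr0 subr0 addr0 => /(_ (ltW d0)) h1.
  rewrite distrC; apply: le_trans (_ : _ <= (`|a| + 1) * `|s - s0|) _.
    rewrite (_ : F s t - F s0 t = (F s t - F s0 t - a * (s - s0)) + a * (s - s0)); last by ring.
    by apply: le_trans (ler_normD _ _) _; rewrite normrM mulrDl mul1r addrC lerD2l.
  by rewrite mulrC -ler_pdivlMr// ltr_wpDl.
have [a [b [d d0 hd]]] := h s t0; apply/cvgrPdist_le => e e0.
have d'0 : 0 < Num.min d (e / (`|b| + 1)) by rewrite lt_min d0 divr_gt0// ltr_wpDl.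
near=> t.
have : `|t0 - t| <= Num.min d (e / (`|b| + 1)).
  by near: t; apply: cvgr_dist_le => //; exact: cvg_id.
rewrite distrC le_min => /andP[sd se].
have := hd s t; rewrite subrr normr0 mulr0 subr0 add0r => /(_ (ltW d0) sd) h1.
rewrite distrC; apply: le_trans (_ : _ <= (`|b| + 1) * `|t - t0|) _.
  rewrite (_ : F s t - F s t0 = (F s t - F s t0 - b * (t - t0)) + b * (t - t0)); last by ring.
  by apply: le_trans (ler_normD _ _) _; rewrite normrM mulrDl mul1r addrC lerD2l.
by rewrite mulrC -ler_pdivlMr// ltr_wpDl.
Unshelve. all: by end_near. Qed.

Let UC : (forall t, continuous (U^~ t)) /\ (forall s, continuous (U s)).
Proof.
apply: cont_of => s0 t0; have [al [be [ga /(_ 1 ltr01)[d d0 h]]]] := UV s0 t0.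
by exists al, be, d => // s t sd td; have [h1 _] := h s t sd td; rewrite mul1r in h1.
Qed.

Let VC : (forall t, continuous (V^~ t)) /\ (forall s, continuous (V s)).
Proof.
apply: cont_of => s0 t0; have [al [be [ga /(_ 1 ltr01)[d d0 h]]]] := UV s0 t0.
by exists ga, al, d => // s t sd td; have [_ h1] := h s t sd td; rewrite mul1r in h1.
Qed.

(** The imaginary part of the contour integral of [U + i V] over the boundary of the rectangle with
    sides [[a, b]] and [[c, d]]. *)
Let D a b c d := itvint (U b) c d - itvint (U a) c d -
  (itvint (V^~ d) a b - itvint (V^~ c) a b).

Let DsplitL a m b c d : a <= m -> m <= b -> D a b c d = D a m c d + D m b c d.
Proof.
move=> am mb; rewrite /D (itvint_split (VC.1 d) am mb) (itvint_split (VC.1 c) am mb).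
ring.
Qed.

Let DsplitR a b c m d : c <= m -> m <= d -> D a b c d = D a b c m + D a b m d.
Proof.
move=> cm md; rewrite /D (itvint_split (UC.2 a) cm md) (itvint_split (UC.2 b) cm md).
ring.
Qed.

(** The affine part of [U] contributes [al (b - a) (c' - c)] through the vertical sides, and that of
    [V] the same through the horizontal ones. They cancel because the coefficient [al] is shared,
    which is the equation [U_s = V_t]; only the errors remain. *)
Let Dsmall s0 t0 e : 0 < e -> exists2 d, 0 < d & forall a b c c', a <= s0 <= b ->
  c <= t0 <= c' -> b - a <= d -> c' - c <= d ->
  `|D a b c c'| <= 4 * e * ((b - a) + (c' - c)) ^+ 2.
Proof.
move=> e0; have [al [be [ga /(_ e e0)[d d0 h]]]] := UV s0 t0.
exists d => // a b c c' /andP[as0 sb] /andP[ct tc] bd cd.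
have ab := le_trans as0 sb; have cc := le_trans ct tc.
set L := b - a + (c' - c).
have Us t : c <= t <= c' -> `|U b t - U a t - al * (b - a)| <= 2 * e * L.
  move=> /andP[t1 t2].
  have td : `|t - t0| <= d by rewrite ler_norml; apply/andP; split; lra.
  have bd' : `|b - s0| <= d by rewrite ger0_norm; lra.
  have ad' : `|a - s0| <= d by rewrite ler0_norm; lra.
  have [h1 _] := h b t bd' td; have [h2 _] := h a t ad' td.
  rewrite (_ : _ - _ = (U b t - U s0 t0 - al * (b - s0) - be * (t - t0)) -
    (U a t - U s0 t0 - al * (a - s0) - be * (t - t0))); last by ring.
  apply: le_trans (ler_normB _ _) _; apply: le_trans (lerD h1 h2) _.
  rewrite -mulrDr (_ : 2 * e * L = e * (2 * L)); last by ring.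
  rewrite ler_wpM2l ?(ltW e0)//.
  have : `|t - t0| <= c' - c by rewrite ler_norml; apply/andP; split; lra.
  have : `|b - s0| = b - s0 by rewrite ger0_norm; lra.
  have : `|a - s0| = s0 - a by rewrite ler0_norm; lra.
  rewrite /L; lra.
have Vs s : a <= s <= b -> `|V s c' - V s c - al * (c' - c)| <= 2 * e * L.
  move=> /andP[s1 s2].
  have sd : `|s - s0| <= d by rewrite ler_norml; apply/andP; split; lra.
  have bd' : `|c' - t0| <= d by rewrite ger0_norm; lra.
  have ad' : `|c - t0| <= d by rewrite ler0_norm; lra.
  have [_ h1] := h s c' sd bd'; have [_ h2] := h s c sd ad'.
  rewrite (_ : _ - _ = (V s c' - V s0 t0 - ga * (s - s0) - al * (c' - t0)) -
    (V s c - V s0 t0 - ga * (s - s0) - al * (c - t0))); last by ring.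
  apply: le_trans (ler_normB _ _) _; apply: le_trans (lerD h1 h2) _.
  rewrite -mulrDr (_ : 2 * e * L = e * (2 * L)); last by ring.
  rewrite ler_wpM2l ?(ltW e0)//.
  have : `|s - s0| <= b - a by rewrite ler_norml; apply/andP; split; lra.
  have : `|c' - t0| = c' - t0 by rewrite ger0_norm; lra.
  have : `|c - t0| = t0 - c by rewrite ler0_norm; lra.
  rewrite /L; lra.
have cB := @fct_continuousB R.
have h1 := itvint_le (cB _ _ (UC.2 b) (UC.2 a)) cc Us.
have h2 := itvint_le (cB _ _ (VC.1 c') (VC.1 c)) ab Vs.
rewrite (itvintB c c' (UC.2 b) (UC.2 a)) in h1.
rewrite (itvintB a b (VC.1 c') (VC.1 c)) in h2.
pose X := itvint (U b) c c' - itvint (U a) c c'.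
pose Y := itvint (V^~ c') a b - itvint (V^~ c) a b.
rewrite -/X in h1; rewrite -/Y in h2; rewrite /D -/X -/Y.
rewrite (_ : X - Y = (X - al * (b - a) * (c' - c)) - (Y - al * (c' - c) * (b - a))); last by ring.
apply: le_trans (ler_normB _ _) _; apply: le_trans (lerD h1 h2) _.
rewrite -mulrDr [(c' - c) + _]addrC -/L expr2 mulrA ler_wpM2r//.
  by rewrite /L; lra.
by rewrite ler_wpM2r//; [rewrite /L|]; lra.
Qed.

Let bisect a c l m : 0 < l -> 0 < m -> exists p : R * R,
  [/\ a <= p.1, p.1 + l / 2 <= a + l, c <= p.2, p.2 + m / 2 <= c + m &
   `|D a (a + l) c (c + m)| <= 4 * `|D p.1 (p.1 + l / 2) p.2 (p.2 + m / 2)|].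
Proof.
move=> l0 m0; set Q := D _ _ _ _.
have E : Q = D a (a + l / 2) c (c + m / 2) + D a (a + l / 2) (c + m / 2) (c + m / 2 + m / 2) +
    (D (a + l / 2) (a + l / 2 + l / 2) c (c + m / 2) +
     D (a + l / 2) (a + l / 2 + l / 2) (c + m / 2) (c + m / 2 + m / 2)).
  have al : a + l = a + l / 2 + l / 2 by lra.
  have cm : c + m = c + m / 2 + m / 2 by lra.
  have a1 : a <= a + l / 2 by lra.
  have a2 : a + l / 2 <= a + l / 2 + l / 2 by lra.
  have c1 : c <= c + m / 2 by lra.
  have c2 : c + m / 2 <= c + m / 2 + m / 2 by lra.
  by rewrite /Q al cm (DsplitL _ _ a1 a2) (DsplitR _ _ c1 c2) [X in _ + X](DsplitR _ _ c1 c2).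
apply: contrapT => H.
have HN p1 p2 : a <= p1 -> p1 + l / 2 <= a + l -> c <= p2 -> p2 + m / 2 <= c + m ->
    4 * `|D p1 (p1 + l / 2) p2 (p2 + m / 2)| < `|Q|.
  by move=> ? ? ? ?; rewrite ltNge; apply/negP => ?; apply: H; exists (p1, p2); split.
have h1 : 4 * `|D a (a + l / 2) c (c + m / 2)| < `|Q| by apply: HN; lra.
have h2 : 4 * `|D a (a + l / 2) (c + m / 2) (c + m / 2 + m / 2)| < `|Q| by apply: HN; lra.
have h3 : 4 * `|D (a + l / 2) (a + l / 2 + l / 2) c (c + m / 2)| < `|Q| by apply: HN; lra.
have h4 : 4 * `|D (a + l / 2) (a + l / 2 + l / 2) (c + m / 2) (c + m / 2 + m / 2)| < `|Q|.
  by apply: HN; lra.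
have : `|Q| < `|Q|; last by rewrite ltxx.
rewrite {1}E; apply: le_lt_trans (ler_normD _ _) _.
apply: le_lt_trans (lerD (ler_normD _ _) (ler_normD _ _)) _; lra.
Qed.

Lemma goursat a c l m : 0 < l -> 0 < m -> D a (a + l) c (c + m) = 0.
Proof.
move=> l0 m0; apply/eqP; rewrite -normr_le0 leNgt; apply/negP => Q0.
set Q := `|_| in Q0.
pose lk k := l / 2 ^+ k; pose mk k := m / 2 ^+ k.
have lk0 k : 0 < lk k by rewrite divr_gt0// exprn_gt0.
have mk0 k : 0 < mk k by rewrite divr_gt0// exprn_gt0.
pose stp k (p : R * R) := sval (cid (bisect p.1 p.2 (lk0 k) (mk0 k))).
have stpP k p : [/\ p.1 <= (stp k p).1, (stp k p).1 + lk k / 2 <= p.1 + lk k,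
   p.2 <= (stp k p).2, (stp k p).2 + mk k / 2 <= p.2 + mk k &
   `|D p.1 (p.1 + lk k) p.2 (p.2 + mk k)| <=
     4 * `|D (stp k p).1 ((stp k p).1 + lk k / 2) (stp k p).2 ((stp k p).2 + mk k / 2)|].
  exact: svalP (cid (bisect p.1 p.2 (lk0 k) (mk0 k))).
pose P := fix P k := if k is k'.+1 then stp k' (P k') else (a, c).
have lkS k : lk k / 2 = lk k.+1 by rewrite /lk exprS invfM; ring.
have mkS k : mk k / 2 = mk k.+1 by rewrite /mk exprS invfM; ring.
have DP k : Q <= 4 ^+ k * `|D (P k).1 ((P k).1 + lk k) (P k).2 ((P k).2 + mk k)|.
  elim: k => [|k IH]; first by rewrite mul1r /lk /mk expr0 !divr1.
  apply: le_trans IH _; rewrite exprSr -mulrA ler_wpM2l ?exprn_ge0//=.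
  by have [_ _ _ _] := stpP k (P k); rewrite lkS mkS.
have nested (proj : R * R -> R) (w : nat -> R) :
    (forall k, proj (P k) <= proj (P k.+1)) ->
    (forall k, proj (P k.+1) + w k.+1 <= proj (P k) + w k) ->
    (forall k, 0 < w k) ->
    exists x, forall k, proj (P k) <= x <= proj (P k) + w k.
  move=> up dn w0.
  have mono j k : (j <= k)%N -> proj (P j) <= proj (P k).
    by move=> /subnKC <-; elim: (k - j)%N => [|i IH]; rewrite ?addn0// addnS; exact: le_trans IH (up _).
  have anti j k : (j <= k)%N -> proj (P k) + w k <= proj (P j) + w j.
    by move=> /subnKC <-; elim: (k - j)%N => [|i IH]; rewrite ?addn0// addnS; exact: le_trans (dn _) IH.
  have ub k : ubound (range (fun j => proj (P j))) (proj (P k) + w k).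
    move=> _ [j _ <-]; apply: le_trans (mono _ _ (leq_maxl j k)) _.
    apply: le_trans (anti _ _ (leq_maxr j k)).
    by rewrite lerDl ltW.
  exists (sup (range (fun j => proj (P j)))) => k; apply/andP; split.
    apply: sup_upper_bound; last by exists k.
    by split; [exists (proj (P 0)), 0%N|exists (proj (P 0) + w 0%N); exact: ub].
  by apply: sup_le_ub; [exists (proj (P 0)), 0%N|exact: ub].
have [s0 s0P] : exists x, forall k, (P k).1 <= x <= (P k).1 + lk k.
  by apply: (nested fst) => // k /=; have [? ? _ _ _] := stpP k (P k); rewrite -?lkS.
have [t0 t0P] : exists x, forall k, (P k).2 <= x <= (P k).2 + mk k.
  by apply: (nested snd) => // k /=; have [_ _ ? ? _] := stpP k (P k); rewrite -?mkS.
(* After [k] bisections [Dsmall] gives at most [4 e ((l + m) / 2^k)^2]; multiplied by [4^k] this is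
   [4 e (l + m)^2 = Q / 2], contradicting [DP]. *)
pose e := Q / (8 * (l + m) ^+ 2).
have lm0 : 0 < (l + m) ^+ 2 by rewrite exprn_gt0// addr_gt0.
have e0 : 0 < e by rewrite divr_gt0// mulr_gt0.
have [d d0 hd] := Dsmall s0 t0 e0.
have [k kd] : exists k, (l + m) / 2 ^+ k <= d.
  have dd : 0 < d / (l + m) by rewrite divr_gt0// addr_gt0.
  have [N _ hN] := near_infty_natSinv_lt (PosNum dd).
  exists N.+1; rewrite ler_pdivrMr ?exprn_gt0//.
  have /= := hN N (leqnn _); rewrite ltr_pdivlMr ?addr_gt0// mulrC ltr_pdivrMr// => h.
  apply: le_trans (ltW h) _; rewrite ler_wpM2l ?(ltW d0)//.
  by rewrite -natrX ler_nat ltnW// ltn_expl.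
have lkd : lk k <= d by apply: le_trans kd; rewrite ler_pM2r ?invr_gt0 ?exprn_gt0// lerDl ltW.
have mkd : mk k <= d by apply: le_trans kd; rewrite ler_pM2r ?invr_gt0 ?exprn_gt0// lerDr ltW.
have := hd (P k).1 ((P k).1 + lk k) (P k).2 ((P k).2 + mk k) (s0P k) (t0P k).
rewrite [_ + lk k - _]addrC addKr [_ + mk k - _]addrC addKr => /(_ lkd mkd) h.
have := DP k; rewrite leNgt => /negP; apply.
apply: le_lt_trans (ler_wpM2l _ h) _; first exact: exprn_ge0.
rewrite [ltLHS](_ : _ = Q / 2); first by rewrite ltr_pdivrMr// ltr_pMr// ltr1n.
rewrite /lk /mk -mulrDl exprMn exprVn -exprM mulnC exprM (_ : 2 ^+ 2 = 4 :> R); last by ring.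
by rewrite /e; field; rewrite expf_neq0//= gt_eqF// addr_gt0.
Qed.

(** By periodicity the sides [t = 0] and [t = 2 pi] of the rectangle cancel in [D], which leaves the
    two vertical means. *)
Lemma periodic_mean_cst a b : a < b ->
  (forall s t, V s (t + 2 * pi) = V s t) ->
  itvint (U b) 0 (2 * pi) = itvint (U a) 0 (2 * pi).
Proof.
move=> ab Vp; have p0 : 0 < 2 * pi :> R by rewrite mulr_gt0// pi_gt0.
have := @goursat a 0 (b - a) (2 * pi).
rewrite subr_gt0 => /(_ ab p0); rewrite addrC subrK add0r /D.
rewrite (_ : V^~ (2 * pi) = V^~ 0); last by apply/funext => s; rewrite -(Vp s 0) add0r.
by rewrite subrr subr0 => /eqP; rewrite subr_eq0 => /eqP.
Qed.

(** Since the mean over a vertical segment does not depend on its abscissa, it can be computed at an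
    abscissa [a] so far to the left that [U] is within [e / (2 pi)] of [u0]. *)
Lemma periodic_mean (u0 : R) b : (forall s t, V s (t + 2 * pi) = V s t) ->
  (forall e, 0 < e -> exists A, forall s t, s <= A -> `|U s t - u0| <= e) ->
  itvint (U b) 0 (2 * pi) = u0 * (2 * pi).
Proof.
move=> Vp Ulim; have p0 : 0 < 2 * pi :> R by rewrite mulr_gt0// pi_gt0.
apply/eqP; rewrite -subr_eq0 -normr_le0; apply/ler_addgt0Pr => e e0.
have e'0 : 0 < e / (2 * pi) by rewrite divr_gt0.
have [A hA] := Ulim _ e'0; pose a := Num.min A (b - 1).
have ab : a < b by rewrite /a gt_min; apply/orP; right; lra.
rewrite (periodic_mean_cst ab Vp) add0r.
have := @itvint_le R (U a) u0 (e / (2 * pi)) 0 (2 * pi) (UC.2 a) (ltW p0).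
rewrite subr0 divfK ?gt_eqF//; apply => t _; apply: hA.
by rewrite /a ge_min lexx.
Qed.

End goursat.

Section complex_differentiable.
Local Open Scope complex_scope.
Context {R : realType}.
Local Notation C := R[i].

Lemma scale_bilinear (W : normedModType C) :
  bilinear_for
    (GRing.Scale.Law.clone _ _ *:%R _) (GRing.Scale.Law.clone _ _ *:%R _)
    (@GRing.scale C W : C^o -> W -> W).
Proof.
split=> [u'|u] a x y /=; first by rewrite scalerDl scalerA.
by rewrite scalerDr !scalerA [u * a]mulrC.
Qed.

Lemma differentiable_scale (V W : normedModType C) (a : V -> C) (f : V -> W) z :
  differentiable a z -> differentiable f z -> differentiable (fun x => a x *: f x) z.
Proof.
move=> da df.
pose B : {bilinear C^o -> W -> W} := HB.pack (@GRing.scale C W : C^o -> W -> W)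
  (bilinear_isBilinear.Build C C^o W W _ _ (@GRing.scale C W : C^o -> W -> W) (@scale_bilinear W)).
have dB : differentiable (fun p : C^o * W => B p.1 p.2) (a z, f z).
  by apply: differentiable_bilin => p; exact: scale_continuous.
exact: (differentiable_comp (differentiable_pair da df) dB).
Qed.

Lemma hnorm_norm (W : completeNormedModType C) (x : W) : `|x| = (hnorm x)%:C.
Proof. exact: ge0_complexE. Qed.

Lemma cabsV (a : C) : cabs a^-1 = (cabs a)^-1.
Proof.
have [->|a0] := eqVneq a 0; first by rewrite invr0 /cabs normr0 invr0.
have ca : cabs a != 0 by apply: contra a0 => /eqP h; rewrite -normr_eq0 cabsE h.
by apply: (mulfI ca); rewrite -cabsM !mulfV// /cabs normr1.
Qed.

Lemma derivable_cexp (a : C) : derivable (@cexp R : C -> C) a 1.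
Proof.
apply/cvg_ex; exists (cexp a); apply/cvgrPdist_le => e e0.
have ee := ge0_complexE (ltW e0); set r := complex.Re e in ee.
have r0 : 0 < r by rewrite -ltcR -ee.
pose K := 4 * expR (complex.Re a) * expR 1.
have K0 : 0 < K by rewrite !mulr_gt0 ?expR_gt0.
have d0 : 0 < Num.min 1 (r / K) by rewrite lt_min ltr01 divr_gt0.
have d0C : 0 < (Num.min 1 (r / K))%:C by rewrite ltcR.
near=> h.
have h0 : h != 0 by near: h; exact: nbhs_dnbhs_neq.
have : `|h| <= (Num.min 1 (r / K))%:C by near: h; exact: dnbhs0_le.
rewrite cabsE lecR le_min => /andP[h1 hr].
rewrite /GRing.scale/= mulr1 cexpD.
rewrite (_ : _ - _ = - (h^-1 * cexp a * (cexp h - 1 - h))); last by field.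
have hp : 0 < cabs h by rewrite -ltcR -cabsE normr_gt0.
rewrite normrN cabsE ee lecR !cabsM cabsV.
rewrite cabs_cexp -mulrA ler_pdivrMl//.
apply: le_trans (ler_wpM2l (expR_ge0 _) (cexp_taylor2 h)) _.
apply: le_trans (_ : _ <= expR (complex.Re a) * (4 * cabs h ^+ 2 * expR 1)) _.
  apply: ler_wpM2l; first exact: expR_ge0.
  apply: ler_wpM2l; first by apply: mulr_ge0 => //; exact: sqr_ge0.
  by rewrite ler_expR.
rewrite ler_pdivlMr// in hr.
rewrite (_ : _ * _ = cabs h * (cabs h * K)); last by rewrite /K; ring.
by rewrite ler_pM2l.
Unshelve. all: by end_near. Qed.

Lemma differentiable_cexp (a : C) : differentiable (@cexp R : C -> C) a.
Proof. by apply/derivable1_diffP; exact: derivable_cexp. Qed.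

Lemma differentiable_eps (W : completeNormedModType C) (f : C -> W) (z : C) :
  differentiable f z -> exists X : W, forall e : R, 0 < e -> exists2 d : R, 0 < d &
    forall h, cabs h <= d -> hnorm (f (z + h) - f z - h *: X) <= e * cabs h.
Proof.
move=> df; exists ('d f z 1) => e e0.
have := diff_locally df; move/eqaddoP => /(_ e%:C); rewrite ltcR => /(_ e0).
move=> /nbhs_normP[d/= d0 hd].
have dd := ge0_complexE (ltW d0).
have r0 : 0 < complex.Re d by rewrite -ltcR -dd.
exists (complex.Re d / 2); first by rewrite divr_gt0.
move=> h hd2; have /hd /= : ball_ Num.norm (0 : C) d h.
  rewrite /ball_/= sub0r normrN cabsE dd ltcR; apply: le_lt_trans hd2 _.
  by rewrite ltr_pdivrMr// ltr_pMr// ltr1n.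
rewrite hnorm_norm cabsE -rmorphM lecR; congr (_ <= _); congr hnorm.
rewrite -[(f \o shift z - (cst (f z) + 'd f z)) h]/(f (h + z) - (f z + 'd f z h)).
rewrite [h + z]addrC opprD addrA; congr (_ - _).
by rewrite -[in LHS](mulr1 h) -[h * 1]/(h *: (1 : C)) linearZ.
Qed.

End complex_differentiable.

Section mean_value.
Local Open Scope complex_scope.
Context {R : realType} {H : completeNormedModType R[i]}.
Context {dot : {dot H for @conjc R}}.
Hypothesis dot_norm : forall x : H, dot x x = `|x| ^+ 2.
Context {n : nat}.
Local Notation C := R[i].
Local Notation rdot := (rdot dot).

Lemma circle_mean (K : 'rV[C]_n -> H) (v : 'rV[C]_n) (h : H) :
  (forall z, differentiable K z) ->
  itvint (fun t => rdot (K (cexp (0 +i* t) *: v)) h) 0 (2 * pi) =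
  rdot (K 0) h * (2 * pi).
Proof.
move=> dK; pose f (z : C) : H := K (cexp z *: v).
have df z : differentiable f z.
  apply: (@differentiable_comp _ _ _ _ (fun z : C => cexp z *: v) K).
    by apply: differentiableZl; exact: differentiable_cexp.
  exact: dK.
pose U s t := rdot (f (s +i* t)) h.
pose V s t := rdot (f (s +i* t)) ('i *: h).
have iih : 'i *: ('i *: h) = - h.
  by rewrite scalerA -expr2 sqr_i scaleN1r.
have nih : hnorm ('i *: h) = hnorm h.
  rewrite hnormZ (_ : cabs 'i = 1) ?mul1r//.
  by rewrite /cabs normc_def/= expr0n expr1n add0r sqrtr1.
apply: (@periodic_mean R U V) => [s0 t0|s t|e e0].
- have [X hX] := differentiable_eps (df (s0 +i* t0)).
  (* Cauchy-Riemann equations: [X] is the complex derivative of [f], the derivative in [t] is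
     ['i *: X], and [rdot X h] serves both as [U_s] and as [V_t]. *)
  exists (rdot X h), (- rdot X ('i *: h)), (rdot X ('i *: h)) => e e0.
  have e'0 : 0 < e / (hnorm h + 1) by rewrite divr_gt0// ltr_wpDl// hnorm_ge0.
  have [d d0 hd] := hX _ e'0.
  exists (d / 2); first by rewrite divr_gt0.
  move=> s t sd td; pose dl : C := (s - s0) +i* (t - t0).
  have dlE : (s0 +i* t0) + dl = s +i* t.
    by rewrite /dl; apply/eqP; rewrite eq_complex/=; apply/andP; split; apply/eqP; ring.
  have dl1 : cabs dl <= `|s - s0| + `|t - t0| by exact: cabs_le.
  have dld : cabs dl <= d by lra.
  have := hd _ dld; rewrite dlE; set Y := f (s +i* t) - _ - _ => hY.
  have Yh g : hnorm g = hnorm h -> `|rdot Y g| <= e * (`|s - s0| + `|t - t0|).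
    move=> gh; apply: le_trans (cauchy_schwarz dot_norm _ _) _; rewrite gh.
    apply: le_trans (ler_wpM2r (hnorm_ge0 _) hY) _.
    rewrite mulrAC; apply: ler_pM; [|exact: cabs_ge0| |exact: dl1].
      by rewrite !mulr_ge0 ?hnorm_ge0 ?invr_ge0 ?addr_ge0 ?hnorm_ge0 ?ltW.
    rewrite mulrAC ler_pdivrMr ?ltr_wpDl ?hnorm_ge0// ler_wpM2l ?ltW//.
    by rewrite ltrDl.
  have Yg g : rdot Y g = rdot (f (s +i* t)) g - rdot (f (s0 +i* t0)) g
      - ((s - s0) * rdot X g - (t - t0) * rdot X ('i *: g)).
    by rewrite /Y !rdotBl rdotZcl.
  split.
    have := Yh h erefl; rewrite Yg; apply: le_trans.
    by rewrite le_eqVlt; apply/orP; left; apply/eqP; congr `|_|; rewrite /U; ring.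
  have := Yh _ nih; rewrite Yg iih rdotNr; apply: le_trans.
  by rewrite le_eqVlt; apply/orP; left; apply/eqP; congr `|_|; rewrite /V; ring.
- rewrite /V /f (_ : cexp _ = cexp (s +i* t))// /cexp.
  by rewrite [2 * pi]mulr_natl sinD2pi cosD2pi.
- have h1 : 0 < hnorm h + 1 by rewrite ltr_wpDl// hnorm_ge0.
  have e'0 : 0 < (e / (hnorm h + 1))%:C by rewrite ltcR divr_gt0.
  have cK : {for 0, continuous K} by exact: differentiable_continuous.
  move/cvgrPdist_le : cK => /(_ _ e'0) /nbhs_normP[d/= d0 hd].
  have dd := ge0_complexE (ltW d0).
  have r0 : 0 < complex.Re d by rewrite -ltcR -dd.
  have vv := ge0_complexE (normr_ge0 v); set m := complex.Re `|v| in vv.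
  have m0 : 0 <= m by rewrite -lecR -vv normr_ge0.
  have m1 : 0 < m + 1 by rewrite ltr_wpDl.
  (* For [s] below this value [expR s * |v|] is less than the radius [d] within which [K] is close
     to [K 0]; [m + 1] in place of [m = |v|] covers [v = 0]. *)
  exists (ln (complex.Re d / (m + 1) / 2)) => s t sA.
  have es : expR s <= complex.Re d / (m + 1) / 2.
    by rewrite -[leRHS]lnK ?ler_expR// posrE !divr_gt0.
  rewrite -rdotBl; apply: le_trans (cauchy_schwarz dot_norm _ _) _.
  have hb : hnorm (f (s +i* t) - K 0) <= e / (hnorm h + 1).
    have /hd : `|0 - cexp (s +i* t) *: v| < d.
      rewrite sub0r normrN normrZ (cabsE (cexp _)) cabs_cexp vv dd -rmorphM ltcR/=.
      apply: le_lt_trans (ler_wpM2r m0 es) _.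
      rewrite [ltLHS](_ : _ = complex.Re d * (m / (m + 1) / 2)); last by ring.
      rewrite gtr_pMr// ltr_pdivrMr// mul1r ltr_pdivrMr//; lra.
    by rewrite distrC hnorm_norm lecR.
  apply: le_trans (ler_wpM2r (hnorm_ge0 _) hb) _.
  by rewrite mulrAC ler_pdivrMr// ler_wpM2l ?(ltW e0)// lerDl.
Qed.

End mean_value.

(** * Weak measurability *)

Section weak_measurability.
Local Open Scope complex_scope.
Context {R : realType} {H : completeNormedModType R[i]}.
Context {dot : {dot H for @conjc R}}.
Hypothesis dot_norm : forall x : H, dot x x = `|x| ^+ 2.
Hypothesis sepH : separable H.
Local Notation rdot := (rdot dot).

Lemma dense_sequence : exists d : nat -> H, forall x (e : R), 0 < e ->
  exists k, hnorm (x - d k) < e.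
Proof.
have [D cD dD] := sepH.
have [f finj] := countable_injP _ cD.
(* Indices outside the range of [f] yield the default 0, a harmless extra term, since only the
   existence of a close term is claimed. *)
exists (fun k => xget 0 [set y | D y /\ f y = k]) => x e e0.
have e0C : 0 < e%:C by rewrite ltcR.
have [] := dD (ball x e%:C).
- by exists x; exact: ballxx.
- exact: ball_open.
move=> y [xy Dy]; exists (f y); case: xgetP => [z _ [Dz fz]|/(_ y)]; last first.
  by move=> h; exfalso; apply: h.
have <- : y = z by apply: finj; rewrite ?inE.
by move: xy; rewrite -ball_normE/= hnormE ltcR.
Qed.

(** Testing against a fixed vector makes measurability pass through operators, limits and parameter
    integrals. On a separable space the notion coincides with Borel measurability ([wmeas_borel],
    [borel_wmeas]), which is what [L2] asks for. *)
Definition wmeas d (T : measurableType d) (F : T -> H) : Prop :=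
  forall h, measurable_fun setT (fun x => rdot (F x) h).

Section wmeas_closure.
Context d (T : measurableType d).
Implicit Types F G : T -> H.

Lemma wmeas_cst (x : H) : wmeas (fun _ : T => x).
Proof. by move=> h; exact: measurable_cst. Qed.

Lemma wmeasD F G : wmeas F -> wmeas G -> wmeas (fun x => F x + G x).
Proof. by move=> mF mG h; under eq_fun do rewrite rdotDl; exact: measurable_funD. Qed.

Lemma wmeasB F G : wmeas F -> wmeas G -> wmeas (fun x => F x - G x).
Proof. by move=> mF mG h; under eq_fun do rewrite rdotBl; exact: measurable_funB. Qed.

Lemma wmeasZ (a : T -> R[i]) F : cmeasurable a -> wmeas F -> wmeas (fun x => a x *: F x).
Proof.
move=> [ma mb] mF h; under eq_fun do rewrite rdotZcl.
by apply: measurable_funB; exact: measurable_funM.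
Qed.

Lemma wmeas_comp d' (T' : measurableType d') (p : T' -> T) F :
  measurable_fun setT p -> wmeas F -> wmeas (fun x => F (p x)).
Proof. by move=> mp mF h; exact: (measurableT_comp (mF h) mp). Qed.

(* [|x|^2] is the supremum of [2 <x, y> - |y|^2] over a dense sequence of
   vectors [y]. *)
Lemma measurable_hnorm_sqr F : wmeas F -> measurable_fun setT (fun x => hnorm (F x) ^+ 2).
Proof.
move=> mF; have [y dy] := dense_sequence.
apply: (measurability _ (RGenOInfty.measurableE R)) => _ [_ [a ->] <-]; rewrite setTI.
rewrite (_ : _ @^-1` _ = \bigcup_k [set x | a < 2 * rdot (F x) (y k) - hnorm (y k) ^+ 2]).
  apply: bigcupT_measurable => k; rewrite -[X in measurable X]setTI.
  rewrite (_ : [set x | _] = (fun x => 2 * rdot (F x) (y k) - hnorm (y k) ^+ 2) @^-1` `]a, +oo[); last first.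
    by apply/seteqP; split => x /=; rewrite in_itv/= andbT.
  have : measurable_fun setT (fun x => 2 * rdot (F x) (y k) - hnorm (y k) ^+ 2).
    apply: measurable_funB; last exact: measurable_cst.
    by apply: measurable_funM; [exact: measurable_cst|exact: mF].
  by apply => //; exact: measurable_itv.
have E x k : 2 * rdot (F x) (y k) - hnorm (y k) ^+ 2 =
    hnorm (F x) ^+ 2 - hnorm (F x - y k) ^+ 2 by rewrite (hnormB_sqr dot_norm); ring.
apply/seteqP; split => x /=; rewrite in_itv/= andbT.
  move=> aF; pose e := hnorm (F x) ^+ 2 - a; have e0 : 0 < e by rewrite subr_gt0.
  have se : 0 < Num.sqrt e by rewrite sqrtr_gt0.
  have [k hk] := dy (F x) _ se; exists k => //=; rewrite E ltrBrDl -ltrBrDr -/e.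
  by rewrite -(sqr_sqrtr (ltW e0)) ltrXn2r ?nnegrE ?hnorm_ge0// ?ltW.
move=> [k _] /=; rewrite E => h; apply: lt_le_trans h _.
by rewrite gerBl sqr_ge0.
Qed.

Lemma measurable_hnorm F : wmeas F -> measurable_fun setT (fun x => hnorm (F x)).
Proof.
move=> /measurable_hnorm_sqr mF.
rewrite (_ : (fun _ => _) = fun x => Num.sqrt (hnorm (F x) ^+ 2)).
  exact: (measurableT_comp (continuous_measurable_fun (@sqrt_continuous R)) mF).
by apply/funext => x; rewrite sqrtr_sqr ger0_norm ?hnorm_ge0.
Qed.

Lemma measurable_rdot F G : wmeas F -> wmeas G ->
  measurable_fun setT (fun x => rdot (F x) (G x)).
Proof.
move=> mF mG; rewrite (_ : (fun _ => _) = fun x =>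
    4^-1 * (hnorm (F x + G x) ^+ 2 - hnorm (F x - G x) ^+ 2)).
  apply: measurable_funM => //; apply: measurable_funB; apply: measurable_hnorm_sqr.
    exact: wmeasD.
  exact: wmeasB.
by apply/funext => x; rewrite (hnormD_sqr dot_norm) (hnormB_sqr dot_norm); field.
Qed.

(** Pettis's argument: by separability an open set is a countable union of balls with centre [y k]
    and radius [1 / (m + 1)], and the distance of [F x] to a fixed vector is measurable. *)
Lemma wmeas_borel F : wmeas F -> measurable_fun setT (F : T -> borel H).
Proof.
move=> mF; have [y dy] := dense_sequence.
apply: (@measurability _ _ _ (borel H) _ _ (@open H)) => //.
move=> _ [U oU <-]; rewrite setTI.
pose P (p : nat * nat) := forall z, hnorm (z - y p.1) < p.2.+1%:R^-1 -> U z.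
rewrite (_ : _ @^-1` _ = \bigcup_(p in P) [set x | hnorm (F x - y p.1) < p.2.+1%:R^-1]).
  rewrite bigcup_mkcond; apply: countable_bigcupT_measurable => // p.
  case: ifPn => // _; rewrite -[X in measurable X]setTI.
  rewrite (_ : [set x | _] = (fun x => hnorm (F x - y p.1)) @^-1` `]-oo, p.2.+1%:R^-1[); last first.
    by apply/seteqP; split => x /=; rewrite in_itv.
  have : measurable_fun setT (fun x => hnorm (F x - y p.1)).
    by apply: measurable_hnorm; apply: wmeasB => //; exact: wmeas_cst.
  by apply => //; exact: measurable_itv.
apply/seteqP; split => [x|x [p Pp]]; last exact: Pp.
move=> /= UF; move: oU; rewrite openE => /(_ _ UF) /nbhs_ballP[e/= e0 eU].
have ee := ge0_complexE (ltW e0); set r := complex.Re e in ee.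
have r20 : 0 < r / 2 by rewrite divr_gt0// -ltcR -ee.
have [m _ /(_ m (leqnn _)) hm] := near_infty_natSinv_lt (PosNum r20).
have m0 : 0 < m.+1%:R^-1 :> R by rewrite invr_gt0.
have [k hk] := dy (F x) _ m0.
exists (k, m) => //= z hz; apply: eU; rewrite -ball_normE/= ee hnormE ltcR.
rewrite (_ : F x - z = (F x - y k) - (z - y k)); last by rewrite opprB addrA subrK.
apply: le_lt_trans (hnormB _ _) _; rewrite (splitr r).
by apply: ltrD; [exact: lt_trans hk hm|exact: lt_trans hz hm].
Qed.

Lemma borel_wmeas F : measurable_fun setT (F : T -> borel H) -> wmeas F.
Proof.
move=> mF h; have mr : measurable_fun [set: borel H] (fun x : borel H => rdot x h : R).
  apply: (measurability _ (RGenOpens.measurableE R)).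
  move=> _ [_ [a [b ->] <-]]; rewrite setTI; apply: sub_sigma_algebra.
  apply: open_comp => [x _|]; last exact: interval_open.
  apply/cvgrPdist_le => e e0.
  have h1 : 0 < hnorm h + 1 by rewrite ltr_wpDl// hnorm_ge0.
  have e'0 : 0 < (e / (hnorm h + 1))%:C by rewrite ltcR divr_gt0.
  near=> y; rewrite -rdotBl; apply: le_trans (cauchy_schwarz dot_norm _ _) _.
  have : `|x - y| <= (e / (hnorm h + 1))%:C.
    by near: y; apply: cvgr_dist_le => //; exact: cvg_id.
  rewrite hnormE lecR => hb; apply: le_trans (ler_wpM2r (hnorm_ge0 _) hb) _.
  by rewrite mulrAC ler_pdivrMr// ler_wpM2l ?(ltW e0)// lerDl.
exact: (measurableT_comp mr mF).
Unshelve. all: by end_near. Qed.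

End wmeas_closure.

Section operators.
Implicit Type A : H -> H.

(** The adjoint for the real form [rdot]. For a bounded operator Riesz's theorem provides the
    vector, so the default 0 is not taken for lack of one. *)
Definition adj A (h : H) : H := xget 0 [set y | forall x, rdot (A x) h = rdot x y].

Lemma adjP A : bounded_op A -> forall x h, rdot (A x) h = rdot x (adj A h).
Proof.
move=> [lA [M AM]] x h; rewrite /adj; case: xgetP => [y _ -> //|/(_ _)].
have [y hy] : exists y, forall x, rdot y x = rdot (A x) h.
  apply: (@riesz _ _ _ dot_norm _ (`|M| * hnorm h)).
  - by rewrite mulr_ge0 ?hnorm_ge0.
  - by move=> u v; rewrite (linear_opD lA) rdotDl.
  - by move=> a u; rewrite (linear_opZ lA) rdotZl.
  - move=> u; apply: le_trans (cauchy_schwarz dot_norm _ _) _.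
    rewrite mulrAC ler_wpM2r ?hnorm_ge0//; apply: le_trans (AM u) _.
    by rewrite ler_wpM2r ?hnorm_ge0// ler_norm.
move=> /(_ y) hN; exfalso; apply: hN => u /=; rewrite -hy; exact: rdotC.
Qed.

(** Operator and vector vary together. The adjoint separates them: the pairing becomes
    [rdot (F x) (adj (Phi x) h)], to which [measurable_rdot] applies. *)
Lemma wmeas_app d (T : measurableType d) (Phi : T -> H -> H) (F : T -> H) :
  (forall x, bounded_op (Phi x)) -> (forall g, wmeas (fun x => Phi x g)) ->
  wmeas F -> wmeas (fun x => Phi x (F x)).
Proof.
move=> bPhi mPhi mF h; under eq_fun do rewrite adjP//.
apply: measurable_rdot => // k.
by under eq_fun do rewrite rdotC -adjP//; exact: mPhi.
Qed.

(** The map [A |-> rdot (A g) h] is continuous for the Hilbert-Schmidt norm, because that norm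
    dominates the operator norm; preimages of open intervals are thus [hs_open]. *)
Lemma hs_measurable_wmeas d (T : measurableType d) (Phi : T -> H -> H) :
  (forall x, hilbert_schmidt dot (Phi x)) ->
  (forall U, hs_open dot U -> measurable (Phi @^-1` U)) ->
  forall g, wmeas (fun x => Phi x g).
Proof.
move=> hsPhi mPhi g h; apply: (measurability _ (RGenOpens.measurableE R)).
move=> _ [_ [a [b ->] <-]]; rewrite setTI.
pose U := [set A | hilbert_schmidt dot A /\ (`]a, b[%classic : set R) (rdot (A g) h)].
rewrite (_ : _ @^-1` _ = Phi @^-1` U); last first.
  by apply/seteqP; split => x /=; [split|case].
apply: mPhi; split=> [A []//|A [hA]].
have oI : open (`]a, b[%classic : set R) by exact: interval_open.
move: oI; rewrite openE => oI /oI /nbhs_ballP[e/= e0 eI].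
pose c := hnorm g * hnorm h + 1.
have c0 : 0 < c by rewrite ltr_wpDl// mulr_ge0// hnorm_ge0.
exists (e / c); first by rewrite divr_gt0.
move=> B hB hBA; split => //; apply: eI; rewrite /ball/= distrC -rdotBl.
apply: le_lt_trans (cauchy_schwarz dot_norm _ _) _.
have lin : linear (B \- A).
  move=> s x y /=; have [[lA _] _] := hA; have [[lB _] _] := hB.
  by rewrite lA lB scalerBr addrACA opprD.
have ec : 0 <= e / c by rewrite divr_ge0// ltW.
have := @hnorm_le_hs_bound _ _ _ dot_norm _ _ g lin ec (ltW hBA) => /= hb.
apply: le_lt_trans (ler_wpM2r (hnorm_ge0 h) hb) _.
by rewrite -mulrA mulrAC ltr_pdivrMr// ltr_pM2l// ltrDl.
Qed.

End operators.
End weak_measurability.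
Arguments wmeas {R H} dot {d T} F.
Arguments adj {R H} dot A h.

Section gauss_mean_value.
Local Open Scope complex_scope.
Context {R : realType} {n : nat}.
Local Notation C := R[i].
Local Notation CT := (Cn R n).
Local Notation V := (@lebesgueC R n).
Local Notation mu := (@muG R n).
Local Notation leb := (@lebesgue_measure R).

Lemma muG_rotation (a : C) (f : CT -> R) : cabs a = 1 -> measurable_fun setT f ->
  (\int[mu]_z (f (a *: (z : 'rV_n)))%:E = \int[mu]_z (f z)%:E)%E.
Proof.
move=> a1 mf.
have ma : measurable_fun setT (fun z : CT => a *: (z : 'rV_n) : CT).
  by apply: measurable_CnZ; [exact: cmeasurable_cst|exact: measurable_id].
have mg : measurable_fun setT (fun z : CT => f z * gauss_density z).
  by apply: measurable_funM => //; exact: measurable_gauss_density.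
transitivity (\int[V]_z (f (a *: (z : 'rV_n)) * gauss_density z)%:E)%E.
  exact: (integral_muG (measurableT_comp mf ma)).
rewrite [RHS]integral_muG// -(integral_rotation a1 mg).
apply: eq_integral => z _; congr (_ * _)%:E.
by rewrite /gauss_density cnormZ_sqr a1 expr1n mul1r.
Qed.

(** Fubini for [f (exp (it) v)] on [[0, 2 pi]] times C^n: rotation invariance evaluates the integral
    over [v] for fixed [t], the circle means evaluate the one over [t] for fixed [v]. The indicator
    of [[0, 2 pi]] lets [t] range over the whole line. *)
Lemma gauss_mean (f : CT -> R) : measurable_fun setT f ->
  mu.-integrable setT (EFin \o f) ->
  (forall v : 'rV_n, itvint (fun t => f (cexp (0 +i* t) *: v)) 0 (2 * pi) = f 0 * (2 * pi)) ->
  (forall v : 'rV_n, continuous (fun t : R => f (cexp (0 +i* t) *: v))) ->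
  (\int[mu]_z (f z)%:E = (f 0)%:E)%E.
Proof.
move=> mf intf fmean fcont; have p0 : 0 < 2 * pi :> R by rewrite mulr_gt0// pi_gt0.
pose I := `[0, 2 * pi]%classic : set R.
have mI : measurable I by exact: measurable_itv.
pose k (p : measurableTypeR R * CT) : \bar R :=
  ((\1_I p.1 : R) * f (cexp (0 +i* p.1) *: (p.2 : 'rV_n)))%:E.
have m1 : measurable_fun [set: measurableTypeR R * CT] fst by exact: measurable_fst.
have m2 : measurable_fun [set: measurableTypeR R * CT] snd by exact: measurable_snd.
have me : cmeasurable (fun p : measurableTypeR R * CT => cexp (0 +i* p.1)).
  by apply: cmeasurable_cexp; split => //=; exact: measurable_cst.
have mk : measurable_fun setT k.
  apply/measurable_EFinP; apply: measurable_funM.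
    by apply: measurableT_comp m1; exact: measurable_indic.
  by apply: (measurableT_comp mf); exact: measurable_CnZ.
have rot t : cabs (cexp (0 +i* t)) = 1 :> R by rewrite cabs_cexp expR0.
have mrot (t : R) : measurable_fun setT (fun v : CT => cexp (0 +i* t) *: (v : 'rV_n) : CT).
  by apply: measurable_CnZ; [exact: cmeasurable_cst|exact: measurable_id].
have lI : leb I = (2 * pi)%:E.
  by rewrite lebesgue_measure_itv/= lte_fin p0 oppr0 adde0.
pose c := fine (\int[mu]_z (f z)%:E).
have cE : (\int[mu]_z (f z)%:E = c%:E)%E.
  by rewrite fineK//; apply: integrable_fin_num.
have [M ME] : exists M : R, (\int[mu]_z `|(f z)%:E| = M%:E)%E.
  have /integrableP[_ h] := intf; exists (fine (\int[mu]_z `|(f z)%:E|)).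
  by rewrite fineK// ge0_fin_numE//; exact: integral_ge0.
have mfr (t : R) : measurable_fun setT (fun v : CT => f (cexp (0 +i* t) *: (v : 'rV_n))).
  exact: (measurableT_comp mf (mrot t)).
have mnf : measurable_fun setT (fun v : CT => `|f v|) by exact: measurableT_comp.
have absr (t : R) : (\int[mu]_v (`|f (cexp (0 +i* t) *: (v : 'rV_n))|)%:E = M%:E)%E.
  by rewrite (muG_rotation (rot t) mnf).
have ir (t : R) : mu.-integrable setT (fun v => (f (cexp (0 +i* t) *: (v : 'rV_n)))%:E).
  apply/integrableP; split; first by apply/measurable_EFinP; exact: mfr.
  by have := absr t => /= ->; rewrite ltry.
have h1 (t : R) : (\int[mu]_v k (t, v) = (\1_I t : R)%:E * c%:E)%E.
  transitivity (\int[mu]_v ((\1_I t : R)%:E * (f (cexp (0 +i* t) *: (v : 'rV_n)))%:E))%E.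
    by apply: eq_integral => v _; rewrite -EFinM.
  by rewrite (integralZl measurableT (ir t)) (muG_rotation (rot t) mf) cE.
have h2 (v : CT) : (\int[leb]_t k (t, v) = (f 0 * (2 * pi))%:E)%E.
  rewrite -(fmean v) /itvint /Rintegral fineK.
    rewrite [RHS]integral_mkcond; apply: eq_integral => t _.
    by rewrite /k/= patchE indicE; case: (t \in _); rewrite ?mul1r ?mul0r.
  by apply: integrable_fin_num => //; exact: itvint_integrable.
have M0 : 0 <= M by rewrite -lee_fin -ME; exact: integral_ge0.
have mI1 : measurable_fun [set: measurableTypeR R] (fun t : R => (\1_I t : R)%:E).
  by apply/measurable_EFinP; exact: measurable_indic.
have iI : (\int[leb]_t (\1_I t : R)%:E = (2 * pi)%:E)%E.
  by rewrite integral_indic// setIT; exact: lI.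
have fin : (\int[leb]_t \int[mu]_v `|k (t, v)| < +oo)%E.
  have h3 (t : R) : (\int[mu]_v `|k (t, v)| = (\1_I t : R)%:E * M%:E)%E.
    transitivity (\int[mu]_v ((\1_I t : R)%:E * (`|f (cexp (0 +i* t) *: (v : 'rV_n))|)%:E))%E.
      by apply: eq_integral => v _; rewrite -EFinM /k/= normrM ger0_norm.
    rewrite ge0_integralZl//; first by rewrite absr.
    by apply/measurable_EFinP; apply: measurableT_comp => //; exact: mfr.
  under eq_integral do rewrite h3.
  have -> : (\int[leb]_t ((\1_I t : R)%:E * M%:E))%E = ((2 * pi)%:E * M%:E)%E.
    rewrite (ge0_integralZr leb measurableT mI1) ?lee_fin//.
    by congr (_ * _)%E; exact: iI.
  by rewrite -EFinM ltry.
have := Fubini ((@integrable12ltyP _ _ _ _ _ leb mu k mk).2 fin).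
under eq_integral do rewrite h1.
under [X in _ = X -> _]eq_integral do rewrite h2.
have -> : (\int[leb]_t ((\1_I t : R)%:E * c%:E) = (2 * pi)%:E * c%:E)%E.
  rewrite -iI -integralZr//; apply/integrableP; split => //.
  under eq_integral => t _ do rewrite /= ger0_norm//.
  by rewrite iI ltry.
have -> : (\int[mu]_v (f 0 * (2 * pi))%:E = (f 0 * (2 * pi))%:E)%E.
  by rewrite integral_cst// -[RHS]mule1; congr (_ * _)%E; exact: muG_setT.
rewrite -EFinM => -[h].
rewrite cE; congr EFin; apply: (mulfI (lt0r_neq0 p0)); rewrite h; ring.
Qed.

End gauss_mean_value.

(** * Weak integrals *)

Section weak_integrals.
Local Open Scope complex_scope.
Context {R : realType} {H : completeNormedModType R[i]}.
Context {dot : {dot H for @conjc R}}.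
Hypothesis dot_norm : forall x : H, dot x x = `|x| ^+ 2.
Hypothesis sepH : separable H.
Local Notation rdot := (rdot dot).
Context d (T : measurableType d) (mu : {measure set T -> \bar R}).
Implicit Types (F G : T -> H) (x y h : H).

(* [x] is the weak integral of [F]; testing against the real parts of inner
   products with all [h] is enough, the imaginary parts being the real parts for
   [i h]. *)
Definition wint F x : Prop := forall h,
  mu.-integrable setT (fun t => (rdot (F t) h)%:E) /\
  (\int[mu]_t (rdot (F t) h)%:E = (rdot x h)%:E)%E.

Lemma wint_inj F x y : wint F x -> wint F y -> x = y.
Proof.
move=> Fx Fy; apply: (rdot_inj dot_norm) => h.
by have [_] := Fx h; have [_ ->] := Fy h; case.
Qed.

Lemma eq_wint F G x : F =1 G -> wint F x -> wint G x.
Proof. by move=> /funext ->. Qed.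

Lemma wintB F G x y : wint F x -> wint G y -> wint (fun t => F t - G t) (x - y).
Proof.
move=> Fx Gy h; have [iF EF] := Fx h; have [iG EG] := Gy h; split.
  under eq_fun do rewrite rdotBl EFinB; exact: integrableB.
by under eq_integral do rewrite rdotBl EFinB; rewrite (integralB_EFin measurableT iF iG) EF EG -EFinB rdotBl.
Qed.

Lemma wintD F G x y : wint F x -> wint G y -> wint (fun t => F t + G t) (x + y).
Proof.
move=> Fx Gy h; have [iF EF] := Fx h; have [iG EG] := Gy h; split.
  under eq_fun do rewrite rdotDl EFinD; exact: integrableD.
by under eq_integral do rewrite rdotDl EFinD; rewrite (integralD_EFin measurableT iF iG) EF EG -EFinD rdotDl.
Qed.

Lemma wintZ (a : R[i]) F x : wint F x -> wint (fun t => a *: F t) (a *: x).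
Proof.
move=> Fx h; have [iF EF] := Fx (a^* *: h); split.
  by under eq_fun do rewrite rdotZ_adj; exact: iF.
by under eq_integral do rewrite rdotZ_adj; rewrite EF -rdotZ_adj.
Qed.

(** Tested against [x] itself, the weak integral gives [|x|^2] at most [|x|] times the integral of
    [|F|]. *)
Lemma wint_norm F x : wmeas dot F -> wint F x ->
  ((hnorm x)%:E <= \int[mu]_t (hnorm (F t))%:E)%E.
Proof.
move=> mF Fx; have mh := measurable_hnorm dot_norm sepH mF.
have [->|x0] := eqVneq (hnorm x) 0.
  by apply: integral_ge0 => t _; rewrite lee_fin hnorm_ge0.
have xp : 0 < hnorm x by rewrite lt_neqAle eq_sym x0 hnorm_ge0.
have [iF EF] := Fx x.
have : ((hnorm x ^+ 2)%:E <= (hnorm x)%:E * \int[mu]_t (hnorm (F t))%:E)%E.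
  rewrite -(rdotxx dot_norm) -EF -ge0_integralZl//; last 3 first.
  - exact/measurable_EFinP.
  - by move=> t _; rewrite lee_fin hnorm_ge0.
  - by rewrite lee_fin hnorm_ge0.
  apply: le_trans (lee_abs _) _; apply: le_trans (le_abse_integral _ _ _) _ => //.
    by have /integrableP[] := iF.
  apply: ge0_le_integral => //.
  - by apply: measurableT_comp => //; have /integrableP[] := iF.
  - by apply/measurable_EFinP; exact: measurable_funM.
  - by move=> t _; rewrite lee_fin mulrC; exact: cauchy_schwarz.
by rewrite expr2 EFinM lee_pmul2l.
Qed.

(** The functional sending [h] to the integral of [rdot (F t) h] is bounded by the integral of
    [|F|]; its Riesz vector is the weak integral. *)
Lemma wint_exists F : wmeas dot F -> (\int[mu]_t (hnorm (F t))%:E < +oo)%E ->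
  exists x, wint F x.
Proof.
move=> mF fF; have mh := measurable_hnorm dot_norm sepH mF.
have i0 : (0 <= \int[mu]_t (hnorm (F t))%:E)%E.
  by apply: integral_ge0 => t _; rewrite lee_fin hnorm_ge0.
pose B := fine (\int[mu]_t (hnorm (F t))%:E).
have BE : (\int[mu]_t (hnorm (F t))%:E = B%:E)%E by rewrite fineK// ge0_fin_numE.
have bnd h : (\int[mu]_t `|(rdot (F t) h)%:E| <= (B * hnorm h)%:E)%E.
  rewrite EFinM -BE -ge0_integralZr//; last 3 first.
  - exact/measurable_EFinP.
  - by move=> t _; rewrite lee_fin hnorm_ge0.
  - by rewrite lee_fin hnorm_ge0.
  apply: ge0_le_integral => //.
  - by apply: measurableT_comp => //; exact/measurable_EFinP.
  - by apply/measurable_EFinP; exact: measurable_funM.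
  - by move=> t _; rewrite lee_fin; exact: cauchy_schwarz.
have iF h : mu.-integrable setT (fun t => (rdot (F t) h)%:E).
  apply/integrableP; split; first exact/measurable_EFinP.
  exact: le_lt_trans (bnd h) (ltry _).
have fin h : (\int[mu]_t (rdot (F t) h)%:E)%E \is a fin_num by exact: integrable_fin_num.
pose l h := fine (\int[mu]_t (rdot (F t) h)%:E).
have B0 : 0 <= B by rewrite -lee_fin -BE.
have lD : forall u v, l (u + v) = l u + l v.
  move=> u v.
  rewrite /l -fineD//; congr fine; rewrite -(integralD_EFin measurableT (iF u) (iF v)).
  by apply: eq_integral => t _; rewrite rdotDr.
have lZ : forall (a : R) u, l (a%:C *: u) = a * l u.
  move=> a u.
  rewrite /l -[RHS]/(fine (a%:E) * _) -fineM//; congr fine; rewrite -(integralZl measurableT (iF u)).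
  by apply: eq_integral => t _; rewrite rdotZr.
have lB : forall u, `|l u| <= B * hnorm u.
  move=> u.
  rewrite -lee_fin -abse_EFin fineK//; apply: le_trans (bnd u).
  by apply: le_abse_integral => //; exact/measurable_EFinP.
have [x xP] := riesz dot_norm B0 lD lZ lB.
by exists x => h; rewrite xP fineK.
Qed.

(** Rules out the default value of [weak_integral]: the vector from [wint_exists] satisfies the
    complex condition, whose imaginary part is the real one tested with ['i *: h]. *)
Lemma wint_weak_integral F : wmeas dot F -> (\int[mu]_t (hnorm (F t))%:E < +oo)%E ->
  wint F (weak_integral mu dot F).
Proof.
move=> mF fF; have [x xP] := wint_exists mF fF.
have Im k h : complex.Im (dot k h) = rdot k ('i *: h) by exact: Im_dot.
rewrite /weak_integral; case: xgetP => [y _ yP h|/(_ x) hN].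
  have [[i1 _]] := yP h; rewrite /cintegral => /(congr1 (@complex.Re R)) /= E.
  by split=> //; rewrite -[rdot y h]/(complex.Re (dot y h)) E /Rintegral fineK//; exact: integrable_fin_num.
exfalso; apply: hN => h; have [i1 E1] := xP h; have [i2 E2] := xP ('i *: h).
split.
  by split => //; under eq_fun do rewrite Im.
apply/eqP; rewrite eq_complex/=; apply/andP; split; apply/eqP.
  by rewrite /Rintegral E1.
by rewrite Im /Rintegral; under eq_integral do rewrite Im; rewrite E2.
Qed.

End weak_integrals.
Arguments wint {R H} dot {d T} mu F x.

Section cauchy_schwarz_integral.
Context d (T : measurableType d) {R : realType}.
Variable mu : {measure set T -> \bar R}.
Local Open Scope ereal_scope.

Lemma cauchy_schwarz_integral (f g : T -> R) :
  measurable_fun setT f -> measurable_fun setT g ->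
  (forall x, 0 <= f x)%R -> (forall x, 0 <= g x)%R ->
  (\int[mu]_x (f x * g x)%:E) ^+ 2 <=
  (\int[mu]_x (f x ^+ 2)%:E) * (\int[mu]_x (g x ^+ 2)%:E).
Proof.
move=> mf mg f0 g0.
have N2 (h : T -> R) : (forall x, 0 <= h x)%R ->
    'N[mu]_2%:E[EFin \o h] = sqrte (\int[mu]_x (h x ^+ 2)%:E).
  move=> h0; rewrite unlock -poweR12_sqrt; last first.
    by apply: integral_ge0 => x _; rewrite lee_fin sqr_ge0.
  congr (_ `^ _); apply: eq_integral => x _ /=.
  by rewrite ger0_norm// -powR_mulrn.
have N1 : 'N[mu]_1[EFin \o (f \* g)%R] = \int[mu]_x (f x * g x)%:E.
  rewrite Lnorm1; apply: eq_integral => x _ /=.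
  by rewrite ger0_norm// mulr_ge0.
have two0 : (0 < 2 :> R)%R by rewrite ltr0n.
have half : (2^-1 + 2^-1 = 1 :> R)%R by field.
have := hoelder mu mf mg two0 two0 half; rewrite N1 !N2// => h.
have i0 (u : T -> R) : (forall x, 0 <= u x)%R -> 0 <= \int[mu]_x (u x)%:E.
  by move=> u0; apply: integral_ge0 => x _; rewrite lee_fin.
have fg0 : 0 <= \int[mu]_x (f x * g x)%:E by apply: i0 => x; exact: mulr_ge0.
have s0 : 0 <= sqrte (\int[mu]_x (f x ^+ 2)%:E) * sqrte (\int[mu]_x (g x ^+ 2)%:E).
  by rewrite mule_ge0 ?sqrte_ge0.
apply: (@le_trans _ _ ((sqrte (\int[mu]_x (f x ^+ 2)%:E) * sqrte (\int[mu]_x (g x ^+ 2)%:E)) ^+ 2)).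
  by rewrite lee_sqr.
rewrite expe2 muleACA -!expe2 !sqr_sqrte//; apply: i0 => x; exact: sqr_ge0.
Qed.

Lemma cauchy_schwarz_integral_le (f g : T -> R) (A B : R) :
  measurable_fun setT f -> measurable_fun setT g ->
  (forall x, 0 <= f x)%R -> (forall x, 0 <= g x)%R -> (0 <= A)%R -> (0 <= B)%R ->
  \int[mu]_x (f x ^+ 2)%:E <= (A ^+ 2)%:E -> \int[mu]_x (g x ^+ 2)%:E <= (B ^+ 2)%:E ->
  \int[mu]_x (f x * g x)%:E <= (A * B)%:E.
Proof.
move=> mf mg f0 g0 A0 B0 fA gB.
have i0 (u : T -> R) : (forall x, 0 <= u x)%R -> 0 <= \int[mu]_x (u x)%:E.
  by move=> u0; apply: integral_ge0 => x _; rewrite lee_fin.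
apply: lee_sqrE; first by rewrite lee_fin mulr_ge0.
apply: le_trans (cauchy_schwarz_integral mf mg f0 g0) _.
rewrite -EFin_expe exprMn EFinM; apply: lee_pmul => //; apply: i0 => x; exact: sqr_ge0.
Qed.

End cauchy_schwarz_integral.

(** * The Segal-Bargmann projection *)

Lemma ge0_integral_cstM d (T : measurableType d) (R : realType)
    (mu : {measure set T -> \bar R}) (f : T -> R) (k : R) :
  measurable_fun setT f -> (forall x, 0 <= f x) -> 0 <= k ->
  (\int[mu]_x (k * f x)%:E = k%:E * \int[mu]_x (f x)%:E)%E.
Proof.
move=> mf f0 k0; under eq_integral do rewrite EFinM.
by rewrite ge0_integralZl//; [exact/measurable_EFinP|move=> x _; rewrite lee_fin].
Qed.

(** * Schur test and Gaussian integrals *)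

Section schur.
Local Open Scope complex_scope.
Context {R : realType} {n : nat}.
Local Notation C := R[i].
Local Notation CT := (Cn R n).
Local Notation V := (@lebesgueC R n).
Local Notation mu := (@muG R n).
Local Notation gd := (@gauss_density R n).
Implicit Types (z w u v : 'rV[C]_n).

Lemma measurable_CnB d (T : measurableType d) (f g : T -> CT) :
  measurable_fun setT f -> measurable_fun setT g ->
  measurable_fun setT (fun x => (f x : 'rV_n) - g x : CT).
Proof.
move=> mf mg; under eq_fun do rewrite -scaleN1r.
by apply: measurable_CnD => //; apply: measurable_CnZ => //; exact: cmeasurable_cst.
Qed.

Lemma measurable_Re_cdot d (T : measurableType d) (f g : T -> CT) :
  measurable_fun setT f -> measurable_fun setT g ->
  measurable_fun setT (fun x => complex.Re (cdot (f x) (g x))).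
Proof. by move=> mf mg; have [] := cmeasurable_cdot mf mg. Qed.

Lemma measurable_gauss (c : R) d (T : measurableType d) (f : T -> CT) :
  measurable_fun setT f -> measurable_fun setT (fun x => expR (- (c * cnorm (f x) ^+ 2))).
Proof.
move=> mf; apply: measurableT_comp => //; apply: measurable_funN.
apply: measurable_funM; first exact: measurable_cst.
by apply: measurable_funX; exact: measurable_cnorm.
Qed.

Lemma measurable_gd d (T : measurableType d) (f : T -> CT) :
  measurable_fun setT f -> measurable_fun setT (fun x => gd (f x)).
Proof. by move=> mf; exact: (measurableT_comp measurable_gauss_density mf). Qed.

Lemma ge0_integral_mu (f : CT -> R) : measurable_fun setT f -> (forall z, 0 <= f z) ->
  (\int[mu]_z (f z)%:E = \int[V]_z (f z * gd z)%:E)%E.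
Proof. by move=> mf f0; exact: integral_muG. Qed.

Lemma integral_V_reflect (f : CT -> R) w : measurable_fun setT f -> (forall z, 0 <= f z) ->
  (forall z, f (- z) = f z) ->
  (\int[V]_z (f (w - (z : 'rV_n)))%:E = \int[V]_z (f z)%:E)%E.
Proof.
move=> mf f0 fN; rewrite -(@integral_Cshift R n (- w) f mf).
by apply: eq_integral => z _; rewrite -fN opprB.
Qed.

Let kap : R := (pi ^+ n)^-1.
Let kap0 : 0 <= kap. Proof. by rewrite invr_ge0 exprn_ge0// pi_ge0. Qed.

(* Conjugated by the square root of the Gaussian weight, the kernel becomes
   [exp (- |w - z|^2 / 2)]; Cauchy-Schwarz splits it as
   [exp (- |v|^2 / 16) * exp (- 7 |v|^2 / 16)] with [v = w - z]. *)
Lemma schur_test : exists2 c : R, 0 <= c & forall m : CT * CT -> R,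
  measurable_fun setT m -> (forall p, 0 <= m p) ->
  (\int[mu]_w (\int[mu]_z (expR (complex.Re (cdot w z)) * m (z, (w : 'rV_n) - z))%:E) ^+ 2 <=
   c%:E * \int[mu]_z \int[V]_v (expR (- (7 / 8 * cnorm v ^+ 2)) * m (z, v) ^+ 2)%:E)%E.
Proof.
have [I8 I8E] : exists I : R, (\int[V]_z (expR (- (1 / 8 * cnorm z ^+ 2)))%:E = I%:E)%E.
  by apply: gaussC_integrable; rewrite divr_gt0.
have I80 : 0 <= I8.
  by rewrite -lee_fin -I8E; apply: integral_ge0 => z _; rewrite lee_fin expR_ge0.
exists (kap ^+ 2 * I8); first by rewrite mulr_ge0// sqr_ge0.
move=> m mm m0.
have m1 : measurable_fun [set: CT * CT] fst by exact: measurable_fst.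
have m2 : measurable_fun [set: CT * CT] snd by exact: measurable_snd.
have md : measurable_fun [set: CT * CT] (fun p => (p.1 : 'rV_n) - p.2 : CT).
  exact: measurable_CnB.
have mmd : measurable_fun [set: CT * CT] (fun p => m (p.2, (p.1 : 'rV_n) - p.2)).
  by apply: (measurableT_comp mm); apply: measurable_fun_pair.
pose q z : R := expR (- (1 / 2 * cnorm z ^+ 2)).
have qq z : kap * q z ^+ 2 = gd z.
  by rewrite /q /gauss_density -expRM_natl; congr (_ * expR _); rewrite -mulr_natl; field.
have q0 z : 0 <= q z by exact: expR_ge0.
have key w z : q w * expR (complex.Re (cdot w z)) * q z = expR (- (1 / 2 * cnorm (w - z) ^+ 2)).
  by rewrite /q -!expRD cnormB_sqr; congr expR; field.
pose s := Num.sqrt kap; have ss : s ^+ 2 = kap by rewrite sqr_sqrtr.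
have s0 : 0 <= s by exact: sqrtr_ge0.
pose k1 (p : CT * CT) : R := expR (complex.Re (cdot p.1 p.2)) * m (p.2, (p.1 : 'rV_n) - p.2).
have mk1 : measurable_fun setT k1.
  by apply: measurable_funM => //; apply: measurableT_comp => //; exact: measurable_Re_cdot.
have k10 p : 0 <= k1 p by rewrite mulr_ge0 ?expR_ge0.
pose k2 (p : CT * CT) : R := expR (- (7 / 8 * cnorm ((p.1 : 'rV_n) - p.2) ^+ 2)) *
  m (p.2, (p.1 : 'rV_n) - p.2) ^+ 2 * gd p.2.
have mk2 : measurable_fun setT k2.
  apply: measurable_funM; last exact: measurable_gd.
  by apply: measurable_funM; [exact: measurable_gauss|exact: measurable_funX].
have k20 p : 0 <= k2 p by rewrite !mulr_ge0 ?expR_ge0 ?sqr_ge0 ?gauss_density_ge0.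
pose N (w : CT) : \bar R := (\int[mu]_z (k1 (w, z))%:E)%E.
have N0 w : (0 <= N w)%E by apply: integral_ge0 => z _; rewrite lee_fin.
have mN : measurable_fun setT N.
  apply: (measurable_fun_fubini_tonelli_F (m2 := mu) (fun p => (k1 p)%:E)).
    exact/measurable_EFinP.
  by move=> p; rewrite lee_fin.
have pw w : (N w ^+ 2 * (gd w)%:E <= (kap ^+ 2 * I8)%:E * \int[V]_z (k2 (w, z))%:E)%E.
  have mx : measurable_fun [set: CT] (fun z : CT => z) by exact: measurable_id.
  have mwz : measurable_fun [set: CT] (fun z : CT => w - (z : 'rV_n) : CT).
    by apply: measurable_CnB => //; exact: measurable_cst.
  have mmw : measurable_fun [set: CT] (fun z : CT => m (z, w - (z : 'rV_n))).
    by apply: (measurableT_comp mm); exact: measurable_fun_pair.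
  (* The factor [s = Num.sqrt kap] in [g] makes [(s * q w) ^+ 2] equal to [gd w], so that the
     squared inequality carries exactly the weight for the integration over [w]. The integral of
     [f ^+ 2] does not depend on [w]. *)
  pose f z : R := kap * expR (- (1 / 16 * cnorm (w - z) ^+ 2)).
  pose g z : R := s * expR (- (7 / 16 * cnorm (w - z) ^+ 2)) * m (z, w - z) * q z.
  have mf : measurable_fun setT (f : CT -> R).
    by apply: measurable_funM; [exact: measurable_cst|exact: measurable_gauss].
  have mg : measurable_fun setT (g : CT -> R).
    apply: measurable_funM; last exact: measurable_gauss.
    apply: measurable_funM => //.
    by apply: measurable_funM; [exact: measurable_cst|exact: measurable_gauss].
  have f0 z : 0 <= f z by rewrite mulr_ge0 ?expR_ge0.
  have g0 z : 0 <= g z by rewrite !mulr_ge0 ?expR_ge0.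
  have mk1w : measurable_fun [set: CT] (fun z : CT => k1 (w, z)).
    exact: (measurableT_comp mk1 (@pair1_measurable _ _ CT CT w)).
  have E1 : ((s * q w)%:E * N w = \int[V]_z (f z * g z)%:E)%E.
    have mkg : measurable_fun setT (fun z : CT => k1 (w, z) * gd z).
      by apply: measurable_funM => //; exact: measurable_gd.
    have kg0 z : 0 <= k1 (w, z) * gd z by rewrite mulr_ge0 ?gauss_density_ge0.
    rewrite /N (ge0_integral_mu mk1w)// -(ge0_integral_cstM V mkg kg0 (mulr_ge0 s0 (q0 w))).
    apply: eq_integral => z _; congr EFin.
    rewrite -qq /k1 /f /g /=.
    have := key w z; have := @expRD R (- (1 / 16 * cnorm (w - z) ^+ 2)) (- (7 / 16 * cnorm (w - z) ^+ 2)).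
    rewrite (_ : _ + _ = - (1 / 2 * cnorm (w - z) ^+ 2)); last by field.
    set a := expR (- (1 / 2 * _)); set b := expR (- (1 / 16 * _)); set c := expR (- (7 / 16 * _)).
    move=> ab qa.
    rewrite [LHS](_ : _ = kap * s * (q w * expR (complex.Re (cdot w z)) * q z) * m (z, w - z) * q z); last by ring.
    by rewrite qa ab; ring.
  have E2 : (\int[V]_z (f z ^+ 2)%:E = (kap ^+ 2 * I8)%:E)%E.
    rewrite EFinM -I8E -(@integral_V_reflect (fun z => expR (- (1 / 8 * cnorm z ^+ 2))) w); last 3 first.
    - exact: measurable_gauss.
    - by move=> z; exact: expR_ge0.
    - by move=> z; rewrite cnormN.
    rewrite -(ge0_integral_cstM V (measurable_gauss (1 / 8) mwz) (fun z => expR_ge0 _) (sqr_ge0 kap)).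
    apply: eq_integral => z _; rewrite /f exprMn; congr (_ * _)%:E.
    by rewrite -expRM_natl; congr expR; rewrite -mulr_natl; field.
  have E3 : (\int[V]_z (g z ^+ 2)%:E = \int[V]_z (k2 (w, z))%:E)%E.
    apply: eq_integral => z _; congr EFin; rewrite /g /k2/= -qq !exprMn ss.
    rewrite -expRM_natl (_ : 2%:R * - (7 / 16 * cnorm (w - z) ^+ 2) = - (7 / 8 * cnorm (w - z) ^+ 2)); last by field.
    ring.
  rewrite -E2 -E3; apply: le_trans (cauchy_schwarz_integral V mf mg f0 g0).
  by rewrite -E1 [leRHS]expe2 muleACA -!expe2 -EFin_expe exprMn ss qq muleC.
have mk2E : measurable_fun setT (fun p => (k2 p)%:E) by exact/measurable_EFinP.
have k2E p : (0 <= (k2 p)%:E)%E by rewrite lee_fin.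
have mF2 : measurable_fun setT (fun w : CT => \int[V]_z (k2 (w, z))%:E)%E.
  exact: (measurable_fun_fubini_tonelli_F (m2 := V) (fun p => (k2 p)%:E)).
have mN2 : measurable_fun setT (fun w : CT => N w ^+ 2)%E by apply: emeasurable_funM.
have k20i w : (0 <= \int[V]_z (k2 (w, z))%:E)%E by apply: integral_ge0 => z _; exact: k2E.
apply: (@le_trans _ _ (\int[V]_w (N w ^+ 2 * (gd w)%:E))%E).
  by rewrite -(ge0_integral_muG mN2 (fun w => mule_ge0 (N0 w) (N0 w))); exact: lexx.
apply: (@le_trans _ _ (\int[V]_w ((kap ^+ 2 * I8)%:E * \int[V]_z (k2 (w, z))%:E))%E).
  apply: ge0_le_integralT => [w|w]; last exact: pw.
  by rewrite mule_ge0 ?lee_fin ?gauss_density_ge0// expe2 mule_ge0.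
have cc0 : (0 <= (kap ^+ 2 * I8)%:E)%E by rewrite lee_fin mulr_ge0// sqr_ge0.
rewrite (ge0_integralZl V measurableT mF2 (fun w _ => k20i w) cc0).
apply: lee_wpmul2l; first by rewrite lee_fin mulr_ge0// sqr_ge0.
(* Tonelli first, then the translation [w = v + z], after which [m] is evaluated at [(z, v)]. *)
have -> : (\int[V]_w \int[V]_z (k2 (w, z))%:E = \int[V]_z \int[V]_w (k2 (w, z))%:E)%E.
  exact: fubini_tonelli mk2E k2E.
pose k3 (p : CT * CT) : \bar R := (expR (- (7 / 8 * cnorm p.2 ^+ 2)) * m p ^+ 2)%:E.
have mk3 : measurable_fun setT k3.
  by apply/measurable_EFinP; apply: measurable_funM; [exact: measurable_gauss|exact: measurable_funX].
have k30 p : (0 <= k3 p)%E by rewrite lee_fin mulr_ge0 ?expR_ge0 ?sqr_ge0.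
have mk3v (z : CT) : measurable_fun [set: CT] (fun v => k3 (z, v)).
  exact: (measurableT_comp mk3 (@pair1_measurable _ _ CT CT z)).
have mF3 : measurable_fun setT (fun z : CT => \int[V]_v k3 (z, v))%E.
  exact: (measurable_fun_fubini_tonelli_F (m2 := V) k3).
have -> : (\int[mu]_z \int[V]_v (expR (- (7 / 8 * cnorm v ^+ 2)) * m (z, v) ^+ 2)%:E =
    \int[V]_z (\int[V]_v k3 (z, v) * (gd z)%:E))%E.
  have i3 z : (0 <= \int[V]_v k3 (z, v))%E by apply: integral_ge0 => v _; exact: k30.
  by rewrite -(ge0_integral_muG mF3 i3).
rewrite le_eqVlt; apply/orP; left; apply/eqP; apply: eq_integral => z _.
have gz0 : (0 <= (gd z)%:E)%E by rewrite lee_fin gauss_density_ge0.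
rewrite -(ge0_integralZr V measurableT (mk3v z) (fun v _ => k30 (z, v)) gz0).
pose h (v : CT) : \bar R := (k3 (z, v) * (gd z)%:E)%E.
have -> : (\int[V]_w (k2 (w, z))%:E = \int[V]_w h ((w : 'rV_n) + (- (z : 'rV_n)))%R)%E.
  by apply: eq_integral => w _; rewrite /h /k2 /k3/= -EFinM.
have mh : measurable_fun setT h.
  by apply: emeasurable_funM; [exact: mk3v|exact: measurable_cst].
have h0 v : (0 <= h v)%E by rewrite mule_ge0.
exact: (ge0_integral_Cshift (- (z : 'rV_n)) mh h0).
Qed.

(** Completing the square, [2 Re <u, w> - |u|^2 = |w|^2 - |u - w|^2], leaves a translated Gaussian
    of mass 1. *)
Lemma gauss_exp_moment w :
  (\int[mu]_u (expR (2 * complex.Re (cdot u w)))%:E = (expR (cnorm w ^+ 2))%:E)%E.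
Proof.
have mid : measurable_fun [set: CT] (fun z : CT => z) by exact: measurable_id.
have mw : measurable_fun [set: CT] (fun z : CT => w : CT) by exact: measurable_cst.
rewrite ge0_integral_mu; last 2 first.
- apply: measurableT_comp => //; apply: measurable_funM; first exact: measurable_cst.
  exact: measurable_Re_cdot.
- by move=> u; exact: expR_ge0.
transitivity (\int[V]_u (expR (cnorm w ^+ 2) * gd ((u : 'rV_n) + - w))%:E)%E.
  apply: eq_integral => u _; congr EFin.
  rewrite /gauss_density mulrCA [RHS]mulrCA; congr (_ * _).
  by rewrite -!expRD cnormB_sqr; congr expR; ring.
rewrite ge0_integral_cstM; [|apply: measurable_gd; exact: measurable_CnD
  |by move=> u; exact: gauss_density_ge0|exact: expR_ge0].
by rewrite (integral_Cshift (- w) measurable_gauss_density) integral_gauss_density mule1.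
Qed.

Lemma integral_mu_exp (a : R) : a < 1 ->
  exists2 I : R, 0 < I & (\int[mu]_u (expR (a * cnorm u ^+ 2))%:E <= I%:E)%E.
Proof.
move=> a1.
have [I IE] : exists I : R, (\int[V]_z (expR (- ((1 - a) * cnorm z ^+ 2)))%:E = I%:E)%E.
  by apply: gaussC_integrable; rewrite subr_gt0.
have I0 : 0 <= I.
  by rewrite -lee_fin -IE; apply: integral_ge0 => z _; rewrite lee_fin expR_ge0.
exists (kap * I + 1); first by rewrite ltr_wpDl// mulr_ge0.
have mid : measurable_fun [set: CT] (fun z : CT => z) by exact: measurable_id.
rewrite ge0_integral_mu; last 2 first.
- apply: measurableT_comp => //; apply: measurable_funM; first exact: measurable_cst.
  by apply: measurable_funX; exact: measurable_cnorm.
- by move=> u; exact: expR_ge0.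
have -> : (\int[V]_z (expR (a * cnorm z ^+ 2) * gd z)%:E =
    \int[V]_z (kap * expR (- ((1 - a) * cnorm z ^+ 2)))%:E)%E.
  apply: eq_integral => u _; rewrite /gauss_density mulrCA -expRD.
  by congr (_ * expR _)%:E; ring.
rewrite (ge0_integral_cstM V (measurable_gauss (1 - a) mid) (fun z => expR_ge0 _) kap0).
by rewrite IE -EFinM lee_fin lerDl.
Qed.

End schur.

Section bargmann_projection.
Local Open Scope complex_scope.
Context {R : realType} {n : nat} {H : completeNormedModType R[i]}.
Context {dot : {dot H for @conjc R}}.
Hypothesis dot_norm : forall x : H, dot x x = `|x| ^+ 2.
Hypothesis sepH : separable H.
Local Notation rdot := (rdot dot).
Local Notation C := R[i].
Local Notation CT := (Cn R n).
Local Notation V := (@lebesgueC R n).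
Local Notation mu := (@muG R n).
Local Notation gd := (@gauss_density R n).
Implicit Types (z w u v : 'rV[C]_n) (F G K : 'rV[C]_n -> H) (M : R).

Lemma conj_kernelE w u : (bargmann_kernel w u)^*%R = cexp (cdot w u).
Proof. rewrite -[LHS]/(conjc (bargmann_kernel w u)). by rewrite /bargmann_kernel -cexp_conj -cdotC. Qed.

Lemma cabs_conj_kernel w u : cabs (bargmann_kernel w u)^*%R = expR (complex.Re (cdot w u)).
Proof. by rewrite conj_kernelE cabs_cexp. Qed.

Lemma hnorm_kernelZ w u (x : H) :
  hnorm ((bargmann_kernel w u)^* *: x) = expR (complex.Re (cdot w u)) * hnorm x.
Proof. by rewrite hnormZ cabs_conj_kernel. Qed.

(** Square integrability with an explicit real bound, so that estimates stay in [R], and with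
    measurability in its weak form. *)
Definition l2bd F M : Prop :=
  [/\ wmeas dot (F : CT -> H), 0 <= M & (\int[mu]_z (hnorm (F z) ^+ 2)%:E <= (M ^+ 2)%:E)%E].

Lemma l2bd_L2 F M : l2bd F M -> L2 F.
Proof.
move=> [mF M0 FM]; split; first exact: wmeas_borel.
rewrite /L2norm; have i0 : (0 <= \int[mu]_z (hnorm (F z) ^+ 2)%:E)%E.
  by apply: integral_ge0 => z _; rewrite lee_fin sqr_ge0.
have : (\int[mu]_z (hnorm (F z) ^+ 2)%:E)%E \is a fin_num.
  by rewrite ge0_fin_numE//; exact: le_lt_trans FM (ltry _).
by rewrite -(sqrte_fin_num i0) ge0_fin_numE// sqrte_ge0.
Qed.

Lemma L2norm_le F M : 0 <= M -> (\int[mu]_z (hnorm (F z) ^+ 2)%:E <= (M ^+ 2)%:E)%E ->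
  (L2norm F <= M%:E)%E.
Proof.
move=> M0 FM; rewrite /L2norm (_ : M%:E = sqrte (M ^+ 2)%:E).
  by rewrite lee_sqrt// lee_fin sqr_ge0.
by rewrite /= sqrtr_sqr ger0_norm.
Qed.

Lemma L2_l2bdM F M : L2 F -> 0 <= M -> (L2norm F <= M%:E)%E -> l2bd F M.
Proof.
move=> [mF _] M0 FM; split => //; first exact: borel_wmeas.
have i0 : (0 <= \int[mu]_z (hnorm (F z) ^+ 2)%:E)%E.
  by apply: integral_ge0 => z _; rewrite lee_fin sqr_ge0.
rewrite -(sqr_sqrte i0) EFin_expe lee_sqr ?sqrte_ge0//.
Qed.

Lemma L2_l2bd F : L2 F -> exists M, l2bd F M.
Proof.
move=> LF; exists (fine (L2norm F)); have [_ fF] := LF.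
have n0 : (0 <= L2norm F)%E by exact: sqrte_ge0.
apply: L2_l2bdM => //; first exact: fine_ge0.
by rewrite fineK// ge0_fin_numE.
Qed.

Lemma weighted_bound (a : CT -> R) (A : R) F M : measurable_fun setT a -> (forall u, 0 <= a u) ->
  0 <= A -> (\int[mu]_u (a u ^+ 2)%:E <= (A ^+ 2)%:E)%E -> l2bd F M ->
  (\int[mu]_u (a u * hnorm (F u))%:E <= (A * M)%:E)%E.
Proof.
move=> ma a0 A0 aA [mF M0 FM]; apply: cauchy_schwarz_integral_le => //.
- exact: measurable_hnorm dot_norm sepH _ _ _ mF.
- by move=> u; exact: hnorm_ge0.
Qed.

Lemma measurable_idCn : measurable_fun [set: CT] (fun z : CT => z).
Proof. exact: measurable_id. Qed.

Lemma measurable_cstCn w : measurable_fun [set: CT] (fun _ : CT => w : CT).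
Proof. exact: measurable_cst. Qed.

Lemma cmeasurable_conj_kernel w : cmeasurable (fun u : CT => (bargmann_kernel w u)^*).
Proof. by apply: cmeasurable_conj; apply: cmeasurable_kernel; [exact: measurable_cstCn|exact: measurable_idCn]. Qed.

Lemma measurable_exp_Re w : measurable_fun setT (fun u : CT => expR (complex.Re (cdot w u))).
Proof.
by apply: measurableT_comp => //; apply: measurable_Re_cdot; [exact: measurable_cstCn|exact: measurable_idCn].
Qed.

Lemma kernel_l2 w :
  (\int[mu]_u (expR (complex.Re (cdot w u)) ^+ 2)%:E <= (expR (cnorm w ^+ 2 / 2) ^+ 2)%:E)%E.
Proof.
rewrite (eq_integral (fun u : CT => (expR (2 * complex.Re (cdot u w)))%:E)); last first.
  by move=> u _; rewrite -expRM_natl Re_cdotC.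
rewrite gauss_exp_moment -expRM_natl le_eqVlt; apply/orP; left; apply/eqP.
by congr (expR _)%:E; field.
Qed.

(** Common source of the estimates for integrals of [F] against scalar kernels: it suffices to
    dominate the kernel by a square integrable [b]. The bound holds for any vector that is the weak
    integral, so it also applies to combinations assembled by [wintB]. *)
Lemma weighted_wint (a : CT -> C) (b : CT -> R) (A : R) F M :
  cmeasurable a -> measurable_fun setT b -> (forall u, cabs (a u) <= b u) -> 0 <= A ->
  (\int[mu]_u (b u ^+ 2)%:E <= (A ^+ 2)%:E)%E -> l2bd F M ->
  wint dot mu (fun u : CT => a u *: F u) (weak_integral mu dot (fun u : CT => a u *: F u)) /\
  forall x, wint dot mu (fun u : CT => a u *: F u) x -> hnorm x <= A * M.
Proof.
move=> ma mb ab A0 bA FM; have [mF M0 _] := FM.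
have maF : wmeas dot (fun u : CT => a u *: F u) by exact: wmeasZ.
have b0 u : 0 <= b u by apply: le_trans (ab u); exact: cabs_ge0.
have le1 : (\int[mu]_u (hnorm (a u *: F u))%:E <= (A * M)%:E)%E.
  apply: le_trans (weighted_bound mb b0 A0 bA FM).
  apply: ge0_le_integralT => u; first by rewrite lee_fin hnorm_ge0.
  by rewrite lee_fin hnormZ ler_wpM2r ?hnorm_ge0.
split.
  by apply: wint_weak_integral => //; exact: le_lt_trans le1 (ltry _).
by move=> x /(wint_norm dot_norm sepH maF) h; rewrite -lee_fin; exact: le_trans h le1.
Qed.

(** The integral formula is taken as the definition of the projection, because it has a value at
    every point; [gproj_bargmann_proj] and [bargmann_proj_unique] identify it with the orthogonal
    projection. *)
Definition gproj F w : H := weak_integral mu dot (fun u : CT => (bargmann_kernel w u)^* *: F u).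

Lemma gprojP F M w : l2bd F M ->
  wint dot mu (fun u : CT => (bargmann_kernel w u)^* *: F u) (gproj F w).
Proof.
move=> FM; apply: (weighted_wint (cmeasurable_conj_kernel w) (measurable_exp_Re w) _ _
  (kernel_l2 w) FM).1; last exact: expR_ge0.
by move=> u; rewrite cabs_conj_kernel.
Qed.

Lemma gproj_bound F M w : l2bd F M -> hnorm (gproj F w) <= expR (cnorm w ^+ 2 / 2) * M.
Proof.
move=> FM; have := (weighted_wint (cmeasurable_conj_kernel w) (measurable_exp_Re w) _ _
  (kernel_l2 w) FM).2; apply; last exact: gprojP FM.
  by move=> u; rewrite cabs_conj_kernel.
exact: expR_ge0.
Qed.

(** The factor 2 comes from [(p + q)^2 <= 2 p^2 + 2 q^2]; the loss is harmless, since only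
    boundedness matters. *)
Lemma l2bd_comb (a b : C) F G M M' : l2bd F M -> l2bd G M' ->
  l2bd (fun z => a *: F z + b *: G z) (2 * (cabs a * M + cabs b * M')).
Proof.
move=> [mF M0 FM] [mG M'0 GM]; split.
- apply: wmeasD; apply: wmeasZ => //; exact: cmeasurable_cst.
- by rewrite mulr_ge0// addr_ge0// mulr_ge0// cabs_ge0.
have mF2 : measurable_fun setT (fun z : CT => hnorm (F z) ^+ 2).
  exact: measurable_hnorm_sqr dot_norm sepH _ _ _ mF.
have mG2 : measurable_fun setT (fun z : CT => hnorm (G z) ^+ 2).
  exact: measurable_hnorm_sqr dot_norm sepH _ _ _ mG.
have ka : 0 <= 2 * cabs a ^+ 2 by rewrite mulr_ge0// sqr_ge0.
have kb : 0 <= 2 * cabs b ^+ 2 by rewrite mulr_ge0// sqr_ge0.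
apply: (@le_trans _ _ (\int[mu]_z ((2 * cabs a ^+ 2 * hnorm (F z) ^+ 2)%:E +
    (2 * cabs b ^+ 2 * hnorm (G z) ^+ 2)%:E))%E).
  apply: ge0_le_integralT => z; first by rewrite lee_fin sqr_ge0.
  rewrite -EFinD lee_fin.
  apply: (@le_trans _ _ ((cabs a * hnorm (F z) + cabs b * hnorm (G z)) ^+ 2)).
    rewrite ler_pXn2r// ?nnegrE ?hnorm_ge0 ?addr_ge0 ?mulr_ge0 ?cabs_ge0 ?hnorm_ge0//.
    by rewrite -!hnormZ hnormD.
  rewrite -subr_ge0 (_ : _ - _ = (cabs a * hnorm (F z) - cabs b * hnorm (G z)) ^+ 2).
    exact: sqr_ge0.
  by ring.
rewrite (ge0_integralD mu measurableT); last 4 first.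
- by move=> z _; rewrite lee_fin mulr_ge0// sqr_ge0.
- by apply/measurable_EFinP; apply: measurable_funM.
- by move=> z _; rewrite lee_fin mulr_ge0// sqr_ge0.
- by apply/measurable_EFinP; apply: measurable_funM.
rewrite (ge0_integral_cstM mu mF2 (fun z => sqr_ge0 _) ka).
rewrite (ge0_integral_cstM mu mG2 (fun z => sqr_ge0 _) kb).
apply: (@le_trans _ _ ((2 * cabs a ^+ 2)%:E * (M ^+ 2)%:E + (2 * cabs b ^+ 2)%:E * (M' ^+ 2)%:E)%E).
  by apply: leeD; apply: lee_wpmul2l => //; rewrite lee_fin.
rewrite -!EFinM -EFinD lee_fin.
have p : 0 <= cabs a * M by rewrite mulr_ge0// cabs_ge0.
have q : 0 <= cabs b * M' by rewrite mulr_ge0// cabs_ge0.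
have pq : 0 <= (cabs a * M) * (cabs b * M') by rewrite mulr_ge0.
rewrite -subr_ge0 (_ : _ - _ = 2 * (cabs a * M) ^+ 2 + 2 * (cabs b * M') ^+ 2 +
  8 * ((cabs a * M) * (cabs b * M'))); last by ring.
by rewrite !addr_ge0// mulr_ge0// sqr_ge0.
Qed.

Lemma l2bdB F G M M' : l2bd F M -> l2bd G M' -> l2bd (fun z => F z - G z) (2 * (M + M')).
Proof.
move=> FM GM; have := l2bd_comb 1 (-1) FM GM.
rewrite cabsN cabs1 !mul1r.
by under eq_fun do rewrite scale1r scaleN1r.
Qed.

Lemma gprojB F G M M' w : l2bd F M -> l2bd G M' ->
  gproj (fun z => F z - G z) w = gproj F w - gproj G w.
Proof.
move=> FM GM'; apply: (wint_inj dot_norm) (wintB (gprojP w FM) (gprojP w GM')).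
apply: eq_wint (gprojP w (l2bdB FM GM')) => u.
by rewrite scalerBr.
Qed.

End bargmann_projection.

Arguments l2bd {R n H} dot F M.
Arguments gproj {R n H} dot F w.

(** * Differentiability and boundedness of the projection *)

Section differentiable_quadratic.
Local Open Scope complex_scope.
Context {R : realType}.
Local Notation C := R[i].

(** A remainder of second order makes the bounded linear map [D] the differential, by uniqueness.
    For [gproj] such a [D] is available explicitly as an integral. *)
Lemma differentiable_quadratic (U W : normedModType C) (f D : U -> W) (w : U) (K : C) :
  0 < K -> linear D -> (forall v, `|D v| <= K * `|v|) ->
  (forall v, `|v| <= 1 -> `|f (w + v) - f w - D v| <= K * `|v| ^+ 2) ->
  differentiable f w.
Proof.
move=> K0 lD bD hf.
pose DM := GRing.isLinear.Build _ _ _ _ _ lD.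
pose DL : {linear U -> W} := HB.pack D DM.
have cD : continuous DL.
  apply: bounded_linear_continuous; apply/linear_boundedP.
  exists K; split; first exact: gtr0_real.
  move=> M KM v; apply: le_trans (bD v) _.
  by rewrite ler_wpM2r// ltW.
have E : f \o shift w = cst (f w) + DL +o_ (0 : U) id.
  apply/eqaddoP => e e0; near=> v.
  have v1 : `|v| <= 1.
    by near: v; apply: cvgr0_norm_le => //; exact: cvg_id.
  have ve : `|v| <= e / K.
    near: v; apply: cvgr0_norm_le; first exact: cvg_id.
    by rewrite divr_gt0.
  have -> : ((f \o shift w) - (cst (f w) + (DL : U -> W))) v = f (w + v) - f w - D v.
    by rewrite !fctE/= opprD addrA [v + w]addrC.
  apply: le_trans (hf v v1) _; rewrite expr2 mulrA ler_wpM2r//.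
  by rewrite mulrC -ler_pdivlMr.
by apply/diff_locallyP; rewrite (diff_unique cD E); split.
Unshelve. all: by end_near. Qed.

End differentiable_quadratic.

Section expansion.
Local Open Scope complex_scope.
Context {R : realType} {n : nat} {H : completeNormedModType R[i]}.
Context {dot : {dot H for @conjc R}}.
Hypothesis dot_norm : forall x : H, dot x x = `|x| ^+ 2.
Hypothesis sepH : separable H.
Local Notation rdot := (rdot dot).
Local Notation C := R[i].
Local Notation CT := (Cn R n).
Local Notation V := (@lebesgueC R n).
Local Notation mu := (@muG R n).
Local Notation gd := (@gauss_density R n).
Local Notation l2bd := (l2bd dot).
Local Notation gproj := (gproj dot).
(** The topology of row vectors, hence [differentiable], is that of the maximum norm, while the
    Gaussian weight uses the Euclidean [cnorm]. Crude factors [n%:R] pay for mixing the two. *)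
Local Notation mnorm v := (complex.Re `|v|).
Implicit Types (z w u v : 'rV[C]_n) (F G K : 'rV[C]_n -> H) (M : R).

Lemma mnormE v : `|v| = (mnorm v)%:C.
Proof. exact: ge0_complexE. Qed.

Lemma mnorm_ge0 v : 0 <= mnorm v.
Proof. by rewrite -lecR -mnormE; exact: normr_ge0. Qed.

Lemma cabs_coord v j : cabs (v 0 j) <= mnorm v.
Proof.
rewrite -lecR -mnormE -cabsE [leRHS]/Num.norm/= mx_normE -[leLHS]nngE num_le.
exact: (le_bigmax _ (fun i : 'I_1 * 'I_n => `|v i.1 i.2|%:nng) (0, j)).
Qed.

Lemma cabs_coord_cnorm u j : cabs (u 0 j) <= cnorm u.
Proof.
rewrite -(@ler_pXn2r _ 2)// ?nnegrE ?cabs_ge0 ?cnorm_ge0// cnorm_sqr.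
rewrite (bigD1 j)//= cabs_sqr lerDl; apply: sumr_ge0 => i _.
by rewrite addr_ge0// sqr_ge0.
Qed.

Lemma cabs_sum I (r : seq I) (f : I -> C) : cabs (\sum_(i <- r) f i) <= \sum_(i <- r) cabs (f i).
Proof.
elim/big_ind2 : _ => //; first by rewrite cabs0.
by move=> a b c d ab cd; exact: le_trans (cabsD _ _) (lerD ab cd).
Qed.

Lemma cabs_cdot v u : cabs (cdot v u) <= n%:R * mnorm v * cnorm u.
Proof.
apply: le_trans (cabs_sum _ _) _; rewrite -mulrA mulr_natl -[X in _ *+ X]card_ord -sumr_const.
by apply: ler_sum => j _; rewrite cabsM cabs_conj ler_pM ?cabs_ge0 ?cabs_coord ?cabs_coord_cnorm.
Qed.

(** Polynomial and exponential factors are absorbed into [exp (x^2 / 4)] by [x <= exp x] and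
    [(a + 2) x <= (a + 2)^2 + x^2 / 4]. The square [exp (x^2 / 2)] of this weight is still
    integrable against the Gaussian. *)
Lemma sqr_exp_gauss (a x : R) : 0 <= x ->
  x * expR (a * x) <= expR ((a + 2) ^+ 2) * expR (1 / 4 * x ^+ 2) /\
  x ^+ 2 * expR (a * x) <= expR ((a + 2) ^+ 2) * expR (1 / 4 * x ^+ 2).
Proof.
move=> x0.
have xe : x <= expR x by apply: le_trans (expR_ge1Dx x); rewrite lerDr.
have e1 : 1 <= expR x by rewrite -expR0 ler_expR.
have h : expR x ^+ 2 * expR (a * x) <= expR ((a + 2) ^+ 2) * expR (1 / 4 * x ^+ 2).
  rewrite -expRM_natl -!expRD ler_expR -subr_ge0.
  by rewrite (_ : _ - _ = (a + 2 - x / 2) ^+ 2) ?sqr_ge0//; field.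
split; apply: le_trans h; rewrite ler_wpM2r ?expR_ge0//.
  by apply: le_trans xe _; rewrite expr2 ler_peMl// expR_ge0.
by rewrite ler_pXn2r// nnegrE// expR_ge0.
Qed.

(** The derivative is the weak integral of [<v, u> exp <w, u> F u], and the second order Taylor
    bound for the exponential controls the rest. The constant [B] depends on [w] but not on [F]:
    this uniformity makes bounded sets of the space equicontinuous, as [gproj_lipschitz]
    exploits. *)
Lemma gproj_expansion w : exists2 B : R, 0 < B & forall F M, l2bd F M ->
  exists D : 'rV[C]_n -> H, [/\ linear D,
    forall v, hnorm (D v) <= B * M * mnorm v &
    forall v, mnorm v <= 1 ->
      hnorm (gproj F (w + v) - gproj F w - D v) <= B * M * mnorm v ^+ 2].
Proof.
have [I I0 hI] := @integral_mu_exp R n (1 / 2) ltac:(lra).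
(* Growth rate in [cnorm u]: [n * mnorm w] from the kernel at [w], and [n] more from the exponential
   in the Taylor remainder, where [mnorm v <= 1]. *)
pose b := n%:R * mnorm w + n%:R.
have b0 : 0 <= n%:R * mnorm w by rewrite mulr_ge0// mnorm_ge0.
pose E := expR ((b + 2) ^+ 2) * (I + 1).
have E0 : 0 < E by rewrite mulr_gt0 ?expR_gt0// addr_gt0.
pose N : R := 4 * (n%:R + 1) ^+ 2.
have n0 : 0 <= n%:R :> R by exact: ler0n.
have n1 : 0 < (n%:R + 1) ^+ 2 :> R by rewrite exprn_gt0// ltr_wpDl.
have nn : n%:R ^+ 2 <= (n%:R + 1) ^+ 2 :> R by rewrite ler_pXn2r// ?nnegrE ?addr_ge0// lerDl.
have nn1 : n%:R <= (n%:R + 1) ^+ 2 :> R.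
  rewrite expr2; apply: le_trans (_ : n%:R + 1 <= _); first by rewrite lerDl.
  by rewrite ler_peMl// ?addr_ge0// lerDr.
have N0 : 0 < N by rewrite mulr_gt0.
exists (N * E); first by rewrite mulr_gt0.
pose dom u := expR ((b + 2) ^+ 2) * expR (1 / 4 * cnorm u ^+ 2).
have mdom : measurable_fun [set: CT] (fun u : CT => dom u).
  apply: measurable_funM => //; apply: measurableT_comp => //.
  by apply: measurable_funM => //; apply: measurable_funX; apply: measurable_cnorm; exact: measurable_idCn.
have key (a : CT -> C) (k : R) F M : cmeasurable a -> 0 <= k ->
    (forall u, cabs (a u) <= k * dom u) -> l2bd F M ->
    wint dot mu (fun u : CT => a u *: F u) (weak_integral mu dot (fun u : CT => a u *: F u)) /\
    forall x, wint dot mu (fun u : CT => a u *: F u) x -> hnorm x <= k * E * M.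
  move=> ma k0 ak FM.
  apply: (weighted_wint dot_norm sepH ma _ ak _ _ FM).
  - exact: measurable_funM.
  - by rewrite mulr_ge0// ltW.
  have kk : 0 <= k ^+ 2 * expR ((b + 2) ^+ 2) ^+ 2 by rewrite mulr_ge0// sqr_ge0.
  rewrite (eq_integral (fun u : CT => (k ^+ 2 * expR ((b + 2) ^+ 2) ^+ 2 *
    expR (1 / 2 * cnorm u ^+ 2))%:E)); last first.
    move=> u _; rewrite /dom !exprMn mulrA; congr (_ * _)%:E.
    by rewrite -expRM_natl; congr expR; field.
  have mh : measurable_fun [set: CT] (fun u : CT => expR (1 / 2 * cnorm u ^+ 2)).
    apply: measurableT_comp => //.
    by apply: measurable_funM => //; apply: measurable_funX; apply: measurable_cnorm; exact: measurable_idCn.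
  rewrite (ge0_integral_cstM mu mh (fun u => expR_ge0 _) kk).
  apply: (@le_trans _ _ ((k ^+ 2 * expR ((b + 2) ^+ 2) ^+ 2)%:E * I%:E)%E).
    by apply: lee_wpmul2l => //; rewrite lee_fin.
  rewrite -EFinM lee_fin !exprMn mulrA ler_wpM2l//.
  by move: I0; nra.
pose aw u := cexp (cdot w u).
have maw : cmeasurable (aw : CT -> C).
  by apply: cmeasurable_cexp; apply: cmeasurable_cdot; [exact: measurable_cstCn|exact: measurable_idCn].
have maD v : cmeasurable (fun u : CT => cdot v u * aw u).
  by apply: cmeasurableM => //; apply: cmeasurable_cdot; [exact: measurable_cstCn|exact: measurable_idCn].
have aw_le u : cabs (aw u) <= expR (n%:R * mnorm w * cnorm u).
  rewrite cabs_cexp ler_expR; apply: le_trans (cabs_cdot w u).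
  exact: le_trans (ler_norm _) (Re_le_cabs _).
have aD v u : cabs (cdot v u * aw u) <= N * mnorm v * dom u.
  rewrite cabsM; apply: le_trans (ler_pM (cabs_ge0 _) (cabs_ge0 _) (cabs_cdot v u) (aw_le u)) _.
  have x0 := cnorm_ge0 u; have [h _] := sqr_exp_gauss b x0.
  have m0 := mnorm_ge0 v.
  rewrite (_ : n%:R * mnorm v * cnorm u * _ =
    mnorm v * (n%:R * (cnorm u * expR (n%:R * mnorm w * cnorm u)))); last by ring.
  rewrite [N * _]mulrC -[leRHS]mulrA ler_wpM2l//.
  apply: ler_pM => //.
  - by rewrite mulr_ge0// expR_ge0.
  - by apply: le_trans nn1 _; rewrite ler_peMl ?ltW// ltr1n.
  - apply: le_trans h; rewrite ler_wpM2l// ler_expR ler_wpM2r//.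
    by rewrite /b lerDl.
move=> F M FM; have [_ M0 _] := FM.
pose D v := weak_integral mu dot (fun u : CT => (cdot v u * aw u) *: F u).
have kv v : 0 <= N * mnorm v by rewrite mulr_ge0 ?mnorm_ge0// ltW.
have DP v := (key _ _ _ _ (maD v) (kv v) (aD v) FM).1.
exists D; split.
- move=> a v v'; apply: (wint_inj dot_norm (DP (a *: v + v'))).
  apply: eq_wint (wintD (wintZ a (DP v)) (DP v')) => u.
  by rewrite scalerA -scalerDl cdotDl cdotZl mulrDl mulrA.
- move=> v; apply: le_trans ((key _ _ _ _ (maD v) (kv v) (aD v) FM).2 _ (DP v)) _.
  by rewrite le_eqVlt; apply/orP; left; apply/eqP; ring.
move=> v v1; pose ar u := cexp (cdot (w + v) u) - aw u - cdot v u * aw u.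
have mar : cmeasurable (ar : CT -> C).
  have mN (p : CT -> C) : cmeasurable p -> cmeasurable (fun u : CT => - p u).
    move=> mp; under eq_fun do rewrite -mulN1r.
    by apply: cmeasurableM => //; exact: cmeasurable_cst.
  apply: cmeasurableD (mN _ (maD v)); apply: cmeasurableD (mN _ maw).
  by apply: cmeasurable_cexp; apply: cmeasurable_cdot; [exact: measurable_cstCn|exact: measurable_idCn].
have m0 := mnorm_ge0 v.
have k0 : 0 <= N * mnorm v ^+ 2 by rewrite mulr_ge0 ?sqr_ge0// ltW.
have arE u : ar u = aw u * (cexp (cdot v u) - 1 - cdot v u).
  rewrite /ar cdotDl cexpD /aw; ring.
have ar_le u : cabs (ar u) <= N * mnorm v ^+ 2 * dom u.
  rewrite arE cabsM.
  apply: le_trans (ler_pM (cabs_ge0 _) (cabs_ge0 _) (aw_le u) (cexp_taylor2 _)) _.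
  have x0 := cnorm_ge0 u; have [_ h] := sqr_exp_gauss b x0.
  have c1 := cabs_cdot v u.
  have c2 : cabs (cdot v u) <= n%:R * cnorm u.
    by apply: le_trans c1 _; rewrite ler_wpM2r// ler_piMr.
  apply: (@le_trans _ _ (expR (n%:R * mnorm w * cnorm u) *
     (4 * (n%:R * mnorm v * cnorm u) ^+ 2 * expR (n%:R * cnorm u)))).
    rewrite ler_wpM2l ?expR_ge0// ler_pM ?expR_ge0 ?ler_expR// ?mulr_ge0 ?sqr_ge0 ?cabs_ge0//.
    rewrite ler_wpM2l// ler_pXn2r// ?nnegrE ?cabs_ge0//.
    by rewrite mulr_ge0// mulr_ge0.
  rewrite [leLHS](_ : _ = mnorm v ^+ 2 * ((4 * n%:R ^+ 2) * (cnorm u ^+ 2 * expR (b * cnorm u)))); last first.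
    by rewrite /b [(_ + n%:R) * cnorm u]mulrDl expRD; ring.
  rewrite [leRHS](_ : _ = mnorm v ^+ 2 * (N * dom u)); last by ring.
  rewrite ler_wpM2l ?sqr_ge0// ler_pM// ?mulr_ge0 ?sqr_ge0 ?expR_ge0//.
  by rewrite /N ler_wpM2l.
apply: le_trans ((key _ _ _ _ mar k0 ar_le FM).2 _ _) _; last first.
  by rewrite le_eqVlt; apply/orP; left; apply/eqP; ring.
apply: eq_wint (wintB (wintB (gprojP dot_norm sepH (w + v) FM) (gprojP dot_norm sepH w FM)) (DP v)).
by move=> u /=; rewrite !conj_kernelE -!scalerBl.
Qed.

Lemma gproj_entire F M w : l2bd F M -> differentiable (gproj F) w.
Proof.
move=> FM; have [_ M0 _] := FM; have [B B0 /(_ F M FM)[D [lD bD hD]]] := gproj_expansion w.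
have BM : 0 <= B * M by rewrite mulr_ge0// ltW.
apply: (@differentiable_quadratic _ _ _ _ D w (B * M + 1)%:C) => //.
- by rewrite ltcR ltr_wpDl.
- move=> v; rewrite mnormE hnorm_norm -rmorphM/= lecR; apply: le_trans (bD v) _.
  by rewrite ler_wpM2r ?mnorm_ge0// lerDl.
- move=> v; rewrite mnormE lecR => v1; rewrite hnorm_norm -rmorphXn/= -rmorphM/= lecR.
  apply: le_trans (hD v v1) _.
  by rewrite ler_wpM2r ?sqr_ge0// lerDl.
Qed.

Lemma continuous_rdot h : continuous (fun x : H => rdot x h).
Proof.
move=> z; apply/cvgrPdist_le => e e0.
have h0 := hnorm_ge0 h.
have d0 : 0 < (e / (hnorm h + 1))%:C by rewrite ltcR divr_gt0// ltr_wpDl.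
have := @cvg_id _ (nbhs z); move=> /cvgrPdist_le/(_ _ d0); apply: filterS => y.
rewrite hnorm_norm lecR => yz; rewrite -rdotBl.
apply: le_trans (cauchy_schwarz dot_norm _ _) _.
apply: (@le_trans _ _ (e / (hnorm h + 1) * hnorm h)); first by rewrite ler_wpM2r.
rewrite mulrAC ler_pdivrMr ?ltr_wpDl// ler_wpM2l ?ltW//.
by rewrite ltrDl.
Qed.

Lemma continuous_wmeas F : continuous F -> wmeas dot (F : CT -> H).
Proof.
move=> cF h; apply: continuous_measurable_Cn => z.
by apply: (@continuous_comp _ _ _ F (fun x : H => rdot x h)); [exact: cF|exact: continuous_rdot].
Qed.

(** In the Schur test with [m (z, v) = |F z|], constant in [v], the inner integral is a pure
    Gaussian one. This is the boundedness of the integral formula on L2. *)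
Lemma kernel_sqr_bound : exists2 c : R, 0 <= c & forall F M, l2bd F M ->
  (\int[mu]_w (\int[mu]_u (expR (complex.Re (cdot w u)) * hnorm (F u))%:E) ^+ 2 <=
   ((c * M) ^+ 2)%:E)%E.
Proof.
have [c c0 hc] := @schur_test R n.
have [I hI] := @gaussC_integrable R n (7 / 8) ltac:(lra).
have I0 : 0 <= I.
  by rewrite -lee_fin -hI; apply: integral_ge0 => z _; rewrite lee_fin expR_ge0.
exists (c * I + 1); first by rewrite addr_ge0// mulr_ge0.
move=> F M FM; have [mF M0 iF] := FM.
have mN := measurable_hnorm dot_norm sepH mF.
pose m (p : CT * CT) := hnorm (F p.1).
have mm : measurable_fun setT m by exact: (measurableT_comp mN measurable_fst).
have := hc m mm (fun p => hnorm_ge0 _).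
have mN2 := measurable_hnorm_sqr dot_norm sepH mF.
have mg : measurable_fun [set: CT] (fun v : CT => expR (- (7 / 8 * cnorm v ^+ 2))).
  by apply: measurable_gauss; exact: measurable_idCn.
have -> : (\int[mu]_z \int[V]_v (expR (- (7 / 8 * cnorm v ^+ 2)) * m (z, v) ^+ 2)%:E =
    I%:E * \int[mu]_z (hnorm (F z) ^+ 2)%:E)%E.
  rewrite -(ge0_integral_cstM mu mN2 (fun z => sqr_ge0 _) I0).
  apply: eq_integral => z _.
  rewrite (eq_integral (fun v : CT => (hnorm (F z) ^+ 2 * expR (- (7 / 8 * cnorm v ^+ 2)))%:E)).
    by rewrite (ge0_integral_cstM V mg (fun v => expR_ge0 _) (sqr_ge0 _)) hI -EFinM mulrC.
  by move=> v _; rewrite mulrC.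
move=> h; apply: le_trans h _; apply: le_trans (_ : (_ <= c%:E * (I%:E * (M ^+ 2)%:E))%E) _.
  by do 2! apply: lee_wpmul2l => //; rewrite lee_fin.
rewrite -!EFinM lee_fin exprMn mulrA ler_wpM2r ?sqr_ge0//.
have cI : 0 <= c * I by rewrite mulr_ge0.
by move: cI; nra.
Qed.

Lemma measurable_kernel_int F : wmeas dot (F : CT -> H) ->
  measurable_fun [set: CT] (fun w : CT =>
    (\int[mu]_u (expR (complex.Re (cdot w u)) * hnorm (F u))%:E)%E).
Proof.
move=> mF; apply: (@measurable_fun_fubini_tonelli_F _ _ CT CT R mu
  (fun p : CT * CT => (expR (complex.Re (cdot p.1 p.2)) * hnorm (F p.2))%:E)).
  apply/measurable_EFinP; apply: measurable_funM.
    apply: measurableT_comp => //; apply: measurable_Re_cdot; first exact: measurable_fst.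
    exact: measurable_snd.
  exact: (measurableT_comp (measurable_hnorm dot_norm sepH mF) measurable_snd).
by move=> p; rewrite lee_fin mulr_ge0 ?expR_ge0 ?hnorm_ge0.
Qed.

Lemma kernel_int_bound F M w : l2bd F M ->
  (\int[mu]_u (expR (complex.Re (cdot w u)) * hnorm (F u))%:E <=
   (expR (cnorm w ^+ 2 / 2) * M)%:E)%E.
Proof.
move=> FM; apply: (weighted_bound dot_norm sepH (measurable_exp_Re w) _ _ (kernel_l2 w) FM).
  by move=> u; exact: expR_ge0.
exact: expR_ge0.
Qed.

(** Supplies the absolute integrability for Fubini with the reproducing kernel. Cauchy-Schwarz on
    the product space would not do: [exp (2 Re <w, u>)] integrates over [u] to [exp (|w|^2)], which
    exactly cancels the Gaussian in [w]. *)
Lemma kernel_pairing : exists2 c : R, 0 <= c & forall F M (a : CT -> R) A, l2bd F M ->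
  measurable_fun setT a -> (forall w, 0 <= a w) -> 0 <= A ->
  (\int[mu]_w (a w ^+ 2)%:E <= (A ^+ 2)%:E)%E ->
  (\int[mu]_w \int[mu]_u (a w * (expR (complex.Re (cdot w u)) * hnorm (F u)))%:E <=
   (A * (c * M))%:E)%E.
Proof.
have [c c0 hc] := kernel_sqr_bound; exists c => //.
move=> F M a A FM ma a0 A0 aA; have [mF M0 _] := FM.
pose S w := (\int[mu]_u (expR (complex.Re (cdot w u)) * hnorm (F u))%:E)%E.
have S0 w : (0 <= S w)%E.
  by apply: integral_ge0 => u _; rewrite lee_fin mulr_ge0 ?expR_ge0 ?hnorm_ge0.
have SE w : S w = (fine (S w))%:E.
  by rewrite fineK// ge0_fin_numE//; exact: le_lt_trans (kernel_int_bound w FM) (ltry _).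
have mS : measurable_fun [set: CT] (fun w : CT => fine (S w)).
  by apply: measurableT_comp => //; exact: measurable_kernel_int.
have mwu w : measurable_fun [set: CT]
    (fun u : CT => expR (complex.Re (cdot w u)) * hnorm (F u)).
  apply: measurable_funM; first exact: measurable_exp_Re.
  exact: measurable_hnorm dot_norm sepH _ _ _ mF.
rewrite (eq_integral (fun w : CT => (a w * fine (S w))%:E)); last first.
  move=> w _; rewrite (ge0_integral_cstM mu (mwu w) _ (a0 w)).
    by rewrite -/(S w) SE.
  by move=> u; rewrite mulr_ge0 ?expR_ge0 ?hnorm_ge0.
apply: (cauchy_schwarz_integral_le ma mS a0 _ A0 _ aA).
- by move=> w; exact: fine_ge0.
- by rewrite mulr_ge0.
apply: le_trans (hc F M FM); rewrite le_eqVlt; apply/orP; left; apply/eqP.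
by apply: eq_integral => w _; rewrite -/(S w) SE EFin_expe.
Qed.

Lemma gproj_l2bd : exists2 c : R, 0 <= c & forall F M, l2bd F M -> l2bd (gproj F) (c * M).
Proof.
have [c c0 hc] := kernel_sqr_bound; exists c => // F M FM; have [mF M0 _] := FM.
split; first by apply: continuous_wmeas => z; apply: differentiable_continuous; exact: gproj_entire FM.
  by rewrite mulr_ge0.
apply: le_trans (hc F M FM); apply: ge0_le_integralT => w; first by rewrite lee_fin sqr_ge0.
rewrite EFin_expe lee_sqr ?lee_fin ?hnorm_ge0//; last first.
  by apply: integral_ge0 => z _; rewrite lee_fin mulr_ge0 ?expR_ge0 ?hnorm_ge0.
have wm : wmeas dot (fun u : CT => (bargmann_kernel w u)^* *: F u).
  by apply: wmeasZ => //; exact: cmeasurable_conj_kernel.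
apply: le_trans (wint_norm dot_norm sepH wm (gprojP dot_norm sepH w FM)) _.
apply: ge0_le_integralT => u; first by rewrite lee_fin hnorm_ge0.
by rewrite hnorm_kernelZ.
Qed.

End expansion.

(** * The reproducing property *)

Section reproducing.
Local Open Scope complex_scope.
Context {R : realType} {n : nat} {H : completeNormedModType R[i]}.
Context {dot : {dot H for @conjc R}}.
Hypothesis dot_norm : forall x : H, dot x x = `|x| ^+ 2.
Hypothesis sepH : separable H.
Local Notation rdot := (rdot dot).
Local Notation l2bd := (l2bd dot).
Local Notation gproj := (gproj dot).
Local Notation C := R[i].
Local Notation CT := (Cn R n).
Local Notation V := (@lebesgueC R n).
Local Notation mu := (@muG R n).
Local Notation gd := (@gauss_density R n).
Implicit Types (z w u v : 'rV[C]_n) (F G K : 'rV[C]_n -> H) (M : R).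

Lemma continuous_vertical : continuous (fun t : R => 0 +i* t : C).
Proof.
move=> t; apply/cvgrPdist_le => e e0.
have ee := ge0_complexE (ltW e0).
have r0 : 0 < complex.Re e by rewrite -ltcR -ee.
have := @cvg_id _ (nbhs t); move=> /cvgrPdist_le/(_ _ r0); apply: filterS => s st.
rewrite [`|(0 +i* t) - _|]cabsE ee lecR.
by apply: le_trans (cabs_le _) _; rewrite /= subrr normr0 add0r.
Qed.

Lemma differentiable_cdotl w z : differentiable (fun v : 'rV[C]_n => cdot v w : C) z.
Proof.
have K0 : 0 < n%:R * cnorm w + 1 by rewrite ltr_wpDl// mulr_ge0// cnorm_ge0.
apply: (@differentiable_quadratic R _ _ (fun v : 'rV[C]_n => cdot v w : C)
    (fun v : 'rV[C]_n => cdot v w : C) z (n%:R * cnorm w + 1)%:C).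
- by rewrite ltcR.
- by move=> a u v; rewrite cdotDl cdotZl.
- move=> v; rewrite mnormE [`|_|]cabsE -rmorphM/= lecR.
  apply: le_trans (cabs_cdot v w) _; rewrite mulrAC ler_wpM2r ?mnorm_ge0//.
  by rewrite lerDl.
- move=> v v1 /=; rewrite cdotDl [X in X - _]addrAC subrr add0r subrr normr0.
  by rewrite mulr_ge0 ?exprn_ge0// ltW// ltcR.
Qed.

Lemma differentiable_translate w z : differentiable (fun v : 'rV[C]_n => v + w) z.
Proof.
apply: (@differentiable_quadratic R _ _ (fun v : 'rV[C]_n => v + w) id z 1%:C).
- by rewrite ltcR.
- by [].
- by move=> v; rewrite mul1r.
- move=> v v1 /=; rewrite [z + v + w]addrAC (addrAC (z + w)) subrr add0r subrr normr0.
  by rewrite mul1r exprn_ge0.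
Qed.

Section entire.
Variables (K : 'rV[C]_n -> H) (dK : forall z, differentiable K z).

Let g w v : H := cexp (- cdot v w) *: K (v + w).

Lemma differentiable_translated w z : differentiable (g w) z.
Proof.
apply: differentiable_scale.
  apply: (@differentiable_comp _ _ _ _ (fun v : 'rV[C]_n => - cdot v w : C) (@cexp R : C -> C)).
    by apply: (@differentiableN _ _ _ (fun v : 'rV[C]_n => cdot v w : C)); exact: differentiable_cdotl.
  exact: differentiable_cexp.
apply: (@differentiable_comp _ _ _ _ (fun v : 'rV[C]_n => v + w) K).
  exact: differentiable_translate.
exact: dK.
Qed.

Lemma entire_circle_continuous (G : 'rV[C]_n -> H) v h : (forall z, differentiable G z) ->
  continuous (fun t : R => rdot (G (cexp (0 +i* t) *: v)) h).
Proof.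
move=> dG t.
apply: (@continuous_comp _ _ _ (fun t : R => G (cexp (0 +i* t) *: v)) (fun x : H => rdot x h));
  last exact: continuous_rdot.
apply: (@continuous_comp _ _ _ (fun t : R => cexp (0 +i* t) *: v) G);
  last by apply: differentiable_continuous; exact: dG.
apply: (@continuous_comp _ _ _ (fun t : R => 0 +i* t : C) (fun a : C => cexp a *: v)).
  exact: continuous_vertical.
apply: differentiable_continuous; apply: differentiableZl; exact: differentiable_cexp.
Qed.

(* Completing the square turns the kernel at [w] into the kernel at [0] of a
   translated entire function. *)
Lemma kernel_translate w v : cexp (cdot w (v + w)) * (gd (v + w))%:C =
  cexp (- cdot v w) * (gd v)%:C.
Proof.
have expC (a : R) : (expR a)%:C = cexp a%:C :> C.
  by rewrite /cexp/= cos0 sin0 mulr1 mulr0.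
rewrite /gauss_density !rmorphM/= !expC mulrCA [RHS]mulrCA; congr (_ * _).
rewrite -!cexpD; congr cexp.
rewrite cnormD_sqr !cdotDr cdotzz [cdot w v]cdotC.
case: (cdot v w) => a b; apply/eqP; rewrite eq_complex/=; apply/andP.
by split; apply/eqP; ring.
Qed.

Lemma entire_gproj M : l2bd K M -> forall w, gproj K w = K w.
Proof.
move=> KM w; apply: (rdot_inj dot_norm) => h.
have [mK _ _] := KM.
have [ik /= ek] := gprojP dot_norm sepH w KM h.
pose phi v := rdot (g w v) h.
pose ps u := rdot ((bargmann_kernel w u)^*%R *: K u) h.
have mps : measurable_fun [set: CT] (fun u : CT => ps u).
  by have : wmeas dot (fun u : CT => (bargmann_kernel w u)^*%R *: K u);
    [apply: wmeasZ => //; exact: cmeasurable_conj_kernel|exact].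
have mphi : measurable_fun [set: CT] (fun u : CT => phi u).
  have /(_ h) : wmeas dot (g w : CT -> H).
    apply: (continuous_wmeas dot_norm) => z; apply: differentiable_continuous.
    exact: differentiable_translated.
  exact.
have mgd := @measurable_gauss_density R n.
have mpsg : measurable_fun [set: CT] (fun u : CT => ps u * gd u) by exact: measurable_funM.
have E v : phi v * gd v = ps (v + w) * gd (v + w).
  have sc (a : C) (x : H) (r : R) : rdot (a *: x) h * r = rdot ((a * r%:C) *: x) h.
    by rewrite [a * _]mulrC -scalerA rdotZl mulrC.
  by rewrite /phi /ps /g !sc conj_kernelE kernel_translate.
have n0 v : (0 <= `|(ps v * gd v)%:E|)%E by [].
(* Integrability of [phi] is that of the reproducing integrand, transported by the translation in
   [E]. *)
have iphi : mu.-integrable setT (fun v : CT => (phi v)%:E).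
  apply/integrableP; split; first exact/measurable_EFinP.
  have /integrableP[_] := ik.
  have mnp : measurable_fun [set: CT] (fun v : CT => `|phi v|) by exact: measurableT_comp.
  have mns : measurable_fun [set: CT] (fun v : CT => `|ps v|) by exact: measurableT_comp.
  have -> : (\int[mu]_v `|(phi v)%:E| = \int[V]_v (`|phi v| * gd v)%:E)%E.
    exact: (integral_muG mnp).
  have -> : (\int[mu]_v `|(ps v)%:E| = \int[V]_v (`|ps v| * gd v)%:E)%E.
    exact: (integral_muG mns).
  have mns2 : measurable_fun [set: CT] (fun v : CT => `|ps v| * gd v) by exact: measurable_funM.
  rewrite -(integral_Cshift w mns2).
  rewrite (eq_integral (fun v : CT => (`|phi v| * gd v)%:E))// => v _; congr EFin.
  have g0 u : 0 <= gd u by exact: gauss_density_ge0.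
  by rewrite -[gd _]ger0_norm// -normrM -E normrM [`|gd _|]ger0_norm.
have := gauss_mean mphi iphi.
have -> : phi 0 = rdot (K w) h by rewrite /phi /g add0r /cdot big1 ?oppr0 ?cexp0 ?scale1r// => j _; rewrite mxE mul0r.
rewrite (integral_muG mphi).
have -> : (\int[V]_v (phi v * gd v)%:E = (rdot (gproj K w) h)%:E)%E.
  rewrite -ek (integral_muG mps) -(integral_Cshift w mpsg).
  by apply: eq_integral => v _; rewrite E.
move=> H1; apply: EFin_inj; apply: H1 => v.
  rewrite /phi (circle_mean dot_norm v h (differentiable_translated w)).
  by rewrite /g add0r /cdot big1 ?oppr0 ?cexp0 ?scale1r// => j _; rewrite mxE mul0r.
exact: entire_circle_continuous (differentiable_translated w).
Qed.

End entire.

End reproducing.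

Section orthogonal_projection.
Local Open Scope complex_scope.
Context {R : realType} {n : nat} {H : completeNormedModType R[i]}.
Context {dot : {dot H for @conjc R}}.
Hypothesis dot_norm : forall x : H, dot x x = `|x| ^+ 2.
Hypothesis sepH : separable H.
Local Notation rdot := (rdot dot).
Local Notation l2bd := (l2bd dot).
Local Notation gproj := (gproj dot).
Local Notation C := R[i].
Local Notation CT := (Cn R n).
Local Notation V := (@lebesgueC R n).
Local Notation mu := (@muG R n).
Implicit Types (z w u v : 'rV[C]_n) (F G K : 'rV[C]_n -> H) (M : R).

Lemma l2_rdot_integrable F G M M' : l2bd F M -> l2bd G M' ->
  mu.-integrable setT (fun z => (rdot (F z) (G z))%:E).
Proof.
move=> [mF M0 FM] [mG M'0 GM]; apply/integrableP; split.
  by apply/measurable_EFinP; exact: measurable_rdot dot_norm sepH _ _ _ _ mF mG.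
apply: (@le_lt_trans _ _ (M * M')%:E); last exact: ltry.
apply: (@le_trans _ _ (\int[mu]_z (hnorm (F z) * hnorm (G z))%:E)%E).
  by apply: ge0_le_integralT => z //; rewrite lee_fin; exact: cauchy_schwarz.
apply: cauchy_schwarz_integral_le => //.
- exact: measurable_hnorm dot_norm sepH _ _ _ mF.
- exact: measurable_hnorm dot_norm sepH _ _ _ mG.
- by move=> z; exact: hnorm_ge0.
- by move=> z; exact: hnorm_ge0.
Qed.

(** Fubini moves the Hermitian kernel from [F] to [K], where the reproducing property absorbs it.
    Orthogonality of [F - gproj F] to the space follows. *)
Lemma gproj_pairing F K M M' : l2bd F M -> l2bd K M' -> (forall w, gproj K w = K w) ->
  (\int[mu]_z (rdot (gproj F z) (K z))%:E = \int[mu]_z (rdot (F z) (K z))%:E)%E.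
Proof.
move=> FM KM PK; have [mF M0 _] := FM; have [mK M'0 iK] := KM.
pose f (p : CT * CT) : \bar R := (rdot (cexp (cdot p.1 p.2) *: F p.2) (K p.1))%:E.
have mf : measurable_fun setT f.
  apply/measurable_EFinP; apply: (measurable_rdot dot_norm sepH).
    apply: wmeasZ; last exact: wmeas_comp measurable_snd mF.
    apply: cmeasurable_cexp; apply: cmeasurable_cdot; first exact: measurable_fst.
    exact: measurable_snd.
  exact: wmeas_comp measurable_fst mK.
have [c c0 hc] := @kernel_pairing R n H dot dot_norm sepH.
have intf : (mu \x mu)%E.-integrable setT f.
  apply: (@integrable12ltyP _ _ _ _ _ mu mu f mf).2.
  apply: le_lt_trans (_ : _ <= (M' * (c * M))%:E)%E (ltry _).
  have := hc F M (fun z : CT => hnorm (K z)) M' FM (measurable_hnorm dot_norm sepH mK)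
    (fun z => hnorm_ge0 _) M'0 iK.
  apply: le_trans; apply: ge0_le_integralT => w.
    by apply: integral_ge0.
  apply: ge0_le_integralT => u //; rewrite lee_fin.
  apply: le_trans (cauchy_schwarz dot_norm _ _) _.
  by rewrite hnormZ cabs_cexp mulrC.
have := @Fubini _ _ _ _ R mu mu f intf.
have -> : (\int[mu]_w \int[mu]_u f (w, u) = \int[mu]_w (rdot (gproj F w) (K w))%:E)%E.
  apply: eq_integral => w _; have [_ <-] := gprojP dot_norm sepH w FM (K w).
  by apply: eq_integral => u _; rewrite conj_kernelE.
move=> ->; apply: eq_integral => u _.
rewrite -(PK u) rdotC; have [_ <-] := gprojP dot_norm sepH u KM (F u).
apply: eq_integral => w _; congr EFin.
rewrite conj_kernelE /= rdotZ_adj rdotC; congr (rdot (_ *: _) _).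
by rewrite [cdot u w]cdotC; exact/esym/cexp_conj.
Qed.

Lemma bargmann_l2bd K : bargmann K -> exists M, l2bd K M.
Proof. by move=> [_ LK]; exact: L2_l2bd dot_norm _ LK. Qed.

Lemma bargmann_gproj K w : bargmann K -> gproj K w = K w.
Proof.
move=> BK; have [M KM] := bargmann_l2bd BK.
exact: (entire_gproj dot_norm sepH BK.1 KM).
Qed.

Lemma gproj_bargmann F M : l2bd F M -> bargmann (gproj F).
Proof.
move=> FM; split; first by move=> z; exact: gproj_entire FM.
have [c c0 hc] := @gproj_l2bd R n H dot dot_norm sepH.
exact: l2bd_L2 dot_norm sepH _ _ (hc F M FM).
Qed.

Lemma gproj_orthogonal F K M : l2bd F M -> bargmann K ->
  (\int[mu]_z (rdot (F z - gproj F z) (K z))%:E = 0)%E.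
Proof.
move=> FM BK; have [M' KM] := bargmann_l2bd BK.
have [M2 PM] := bargmann_l2bd (gproj_bargmann FM).
under eq_integral do rewrite rdotBl EFinB.
rewrite (integralB measurableT (l2_rdot_integrable FM KM) (l2_rdot_integrable PM KM)).
rewrite (gproj_pairing FM KM) ?subee//; last by move=> w; exact: bargmann_gproj.
by apply: integrable_fin_num => //; exact: l2_rdot_integrable FM KM.
Qed.

Lemma bargmannZ (a : C) K : bargmann K -> bargmann (fun z => a *: K z).
Proof.
move=> BK; have [M KM] := bargmann_l2bd BK; split.
  by move=> z; apply: differentiableZ; exact: BK.1.
have := l2bd_comb dot_norm sepH a 0 KM KM.
by under eq_fun do rewrite scale0r addr0; exact: l2bd_L2.
Qed.

Lemma bargmannB F G : bargmann F -> bargmann G -> bargmann (fun z => F z - G z).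
Proof.
move=> BF BG; have [M FM] := bargmann_l2bd BF; have [M' GM] := bargmann_l2bd BG; split.
  by move=> z; apply: differentiableB; [exact: BF.1|exact: BG.1].
exact: l2bd_L2 dot_norm sepH _ _ (l2bdB dot_norm sepH FM GM).
Qed.

Lemma gproj_bargmann_proj F M : l2bd F M -> bargmann_proj dot F (gproj F).
Proof.
move=> FM; split; [exact: l2bd_L2 dot_norm sepH _ _ FM|exact: gproj_bargmann FM|move=> K BK].
rewrite /L2dot /cintegral /Rintegral.
have -> : (\int[mu]_z (complex.Re (dot ((F \- gproj F) z) (K z)))%:E = 0)%E.
  exact: gproj_orthogonal FM BK.
(* The imaginary part is the real part for ['i *: K], again an element of the space. *)
have -> : (\int[mu]_z (complex.Im (dot ((F \- gproj F) z) (K z)))%:E = 0)%E.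
  rewrite -(gproj_orthogonal FM (bargmannZ 'i BK)).
  by apply: eq_integral => z _; rewrite Im_dot.
by [].
Qed.

(** The difference of the two candidates lies in the space and is orthogonal to itself. A vanishing
    norm alone gives equality almost everywhere; the pointwise bound for reproduced functions turns
    it into equality at every point. *)
Lemma bargmann_proj_unique F G M : l2bd F M -> bargmann_proj dot F G -> forall w, G w = gproj F w.
Proof.
move=> FM [_ BG oG] w.
have BP := gproj_bargmann FM.
pose K z := G z - gproj F z.
have BK : bargmann K by exact: bargmannB.
have [M' KM] := bargmann_l2bd BK; have [MG GM] := bargmann_l2bd BG.
have FG := l2bdB dot_norm sepH FM GM.
have [MP PM] := bargmann_l2bd BP; have FP := l2bdB dot_norm sepH FM PM.
have o1 : (\int[mu]_z (rdot (F z - G z) (K z))%:E = 0)%E.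
  have := congr1 (@complex.Re R) (oG K BK); rewrite /L2dot /cintegral /Rintegral/= => h.
  have /integrable_fin_num : mu.-integrable setT (fun z => (rdot (F z - G z) (K z))%:E).
    exact: l2_rdot_integrable FG KM.
  by move=> /(_ measurableT)/fineK <-; congr EFin.
have o2 := gproj_orthogonal FM BK.
have k0 : (\int[mu]_z (hnorm (K z) ^+ 2)%:E = 0)%E.
  have := integralB measurableT (l2_rdot_integrable FP KM) (l2_rdot_integrable FG KM).
  rewrite o1 o2 sube0 => <-; apply: eq_integral => z _.
  rewrite -EFinB -rdotBl -(rdotxx dot_norm); congr (rdot _ _)%:E.
  by rewrite /K opprB [RHS]addrC addrA subrK.
have K0 : l2bd K 0.
  by have [mK _ _] := KM; split => //; rewrite k0 expr0n.
have := gproj_bound dot_norm sepH w K0.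
rewrite (bargmann_gproj w BK) mulr0 => h.
apply/eqP; rewrite -subr_eq0; apply/eqP; apply: hnorm0_eq0.
by apply/eqP; rewrite eq_le h hnorm_ge0.
Qed.

End orthogonal_projection.

(** * The operator kernel of a Toeplitz operator *)

Section toeplitz_kernel.
Local Open Scope complex_scope.
Context {R : realType} {n : nat} {H : completeNormedModType R[i]}.
Context {dot : {dot H for @conjc R}}.
Hypothesis dot_norm : forall x : H, dot x x = `|x| ^+ 2.
Hypothesis sepH : separable H.
Local Notation rdot := (rdot dot).
Local Notation l2bd := (l2bd dot).
Local Notation gproj := (gproj dot).
Local Notation C := R[i].
Local Notation CT := (Cn R n).
Local Notation V := (@lebesgueC R n).
Local Notation mu := (@muG R n).
Local Notation gd := (@gauss_density R n).
Implicit Types (z w u v : 'rV[C]_n) (F G K D : 'rV[C]_n -> H) (M : R).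

Lemma kernel_l1 v :
  (\int[mu]_u (expR (complex.Re (cdot v u)))%:E = (expR (1 / 4 * cnorm v ^+ 2))%:E)%E.
Proof.
have := @gauss_exp_moment R n ((1 / 2)%:C *: v).
have -> : cnorm ((1 / 2)%:C *: v) ^+ 2 = 1 / 4 * cnorm v ^+ 2.
  rewrite cnormZ_sqr; congr (_ * _).
  by rewrite cabs_sqr /= expr0n/= addr0; field.
move=> <-; apply: eq_integral => u _; congr (expR _)%:E.
by rewrite [in RHS]Re_cdotC cdotZl; case: (cdot v u) => a b /=; field.
Qed.

(** The bounds are required at every point; [compact_toeplitz] arranges this by changing the symbol
    on a null set. *)
Variables (Phi : 'rV[C]_n -> H -> H) (B : R).
Hypothesis B0 : 0 <= B.
Hypothesis lPhi : forall z, linear (Phi z).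
Hypothesis mPhi : forall g, wmeas dot (fun z : CT => Phi z g).
Hypothesis bPhi : forall z x, hnorm (Phi z x) <= B * hnorm x.
Hypothesis hPhi : forall z, hs_bounded dot (Phi z) (B ^+ 2).
Local Notation Xi := (Xi dot Phi).

Lemma Phi_bounded z : bounded_op (Phi z).
Proof. by split; [exact: lPhi|exists B; exact: bPhi]. Qed.

Lemma Phi_l2bd F M : l2bd F M -> l2bd (fun z => Phi z (F z)) (B * M).
Proof.
move=> [mF M0 FM]; split.
- by apply: (@wmeas_app _ _ _ dot_norm sepH _ CT Phi F) => //; exact: Phi_bounded.
- exact: mulr_ge0.
have mF2 := measurable_hnorm_sqr dot_norm sepH mF.
apply: (@le_trans _ _ (\int[mu]_z (B ^+ 2 * hnorm (F z) ^+ 2)%:E)%E).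
  apply: ge0_le_integralT => z; first by rewrite lee_fin sqr_ge0.
  by rewrite lee_fin -exprMn ler_pXn2r ?nnegrE ?mulr_ge0 ?hnorm_ge0.
rewrite (ge0_integral_cstM mu mF2 (fun z => sqr_ge0 _) (sqr_ge0 B)).
by rewrite exprMn [leRHS]EFinM; apply: lee_wpmul2l => //; rewrite lee_fin sqr_ge0.
Qed.

Lemma wmeas_Phi_shift d (T : measurableType d) (p q : T -> CT) (F : T -> H) :
  measurable_fun setT p -> measurable_fun setT q -> wmeas dot F ->
  wmeas dot (fun x => Phi ((p x : 'rV_n) + q x) (F x)).
Proof.
move=> mp mq mF; apply: (@wmeas_app _ _ _ dot_norm sepH d T (fun x => Phi ((p x : 'rV_n) + q x)) F) => //.
  by move=> x; exact: Phi_bounded.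
move=> g; apply: (@wmeas_comp _ _ _ _ _ _ _ (fun x => (p x : 'rV_n) + q x : CT) (fun z => Phi z g)).
  exact: measurable_CnD.
exact: mPhi.
Qed.

Lemma Xi_wint z v g : wint dot mu
  (fun u : CT => (bargmann_kernel v u)^* *: Phi ((u : 'rV_n) + z) g) (Xi z v g).
Proof.
apply: (wint_weak_integral dot_norm sepH).
  apply: wmeasZ; first exact: cmeasurable_conj_kernel.
  by apply: wmeas_Phi_shift; [exact: measurable_idCn|exact: measurable_cstCn|exact: wmeas_cst].
have k0 : 0 <= B * hnorm g by rewrite mulr_ge0 ?hnorm_ge0.
apply: (@le_lt_trans _ _ (\int[mu]_u (B * hnorm g * expR (complex.Re (cdot v u)))%:E)%E).
  apply: ge0_le_integralT => u; first by rewrite lee_fin hnorm_ge0.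
  by rewrite lee_fin hnorm_kernelZ mulrC ler_wpM2r ?expR_ge0.
rewrite (ge0_integral_cstM mu (measurable_exp_Re v) (fun u => expR_ge0 _) k0).
by rewrite kernel_l1 -EFinM ltry.
Qed.

Lemma Xi_norm z v g :
  ((hnorm (Xi z v g))%:E <=
   \int[mu]_u (expR (complex.Re (cdot v u)) * hnorm (Phi (u + z) g))%:E)%E.
Proof.
apply: le_trans (wint_norm dot_norm sepH _ (Xi_wint z v g)) _.
  apply: wmeasZ; first exact: cmeasurable_conj_kernel.
  by apply: wmeas_Phi_shift; [exact: measurable_idCn|exact: measurable_cstCn|exact: wmeas_cst].
by apply: ge0_le_integralT => u; rewrite lee_fin ?hnorm_ge0// hnorm_kernelZ.
Qed.

(** The rate 1/4 is that of the exponential moment [kernel_l1]. Its double, 1/2, stays below the 7/8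
    of the Schur test, and the difference 3/8 gives the integrable majorant in [dj]. *)
Lemma Xi_bound z v g : hnorm (Xi z v g) <= B * expR (1 / 4 * cnorm v ^+ 2) * hnorm g.
Proof.
have k0 : 0 <= B * hnorm g by rewrite mulr_ge0 ?hnorm_ge0.
rewrite -lee_fin; apply: le_trans (Xi_norm z v g) _.
apply: (@le_trans _ _ (\int[mu]_u (B * hnorm g * expR (complex.Re (cdot v u)))%:E)%E).
  apply: ge0_le_integralT => u; first by rewrite lee_fin mulr_ge0 ?expR_ge0 ?hnorm_ge0.
  by rewrite lee_fin mulrC ler_wpM2r ?expR_ge0.
rewrite (ge0_integral_cstM mu (measurable_exp_Re v) (fun u => expR_ge0 _) k0).
by rewrite kernel_l1 -EFinM lee_fin mulrAC.
Qed.

Lemma Xi_linear z v : linear (Xi z v).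
Proof.
move=> a x y; apply: (wint_inj dot_norm (Xi_wint z v (a *: x + y))).
apply: eq_wint (wintD (wintZ a (Xi_wint z v x)) (Xi_wint z v y)) => u /=.
by rewrite lPhi scalerDr !scalerA [a * _]mulrC.
Qed.

(** Cauchy-Schwarz, with [exp (Re <v, u>)] shared evenly between the two factors, bounds each
    [|Xi z v e|^2] by a weighted integral of [|Phi (u + z) e|^2]. The sum over [J] then enters the
    integral, where the bound for [Phi] at each point applies. *)
Lemma Xi_hs_bounded z v : hs_bounded dot (Xi z v) (B ^+ 2 * expR (1 / 2 * cnorm v ^+ 2)).
Proof.
move=> J uJ oJ; set E := expR (1 / 4 * cnorm v ^+ 2).
have E0 : 0 <= E by exact: expR_ge0.
have EE : expR (1 / 2 * cnorm v ^+ 2) = E * E by rewrite /E -expRD; congr expR; field.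
pose a u := expR (1 / 2 * complex.Re (cdot v u)).
have aa u : a u * a u = expR (complex.Re (cdot v u)) by rewrite /a -expRD; congr expR; field.
have ma : measurable_fun [set: CT] (fun u : CT => a u).
  have mr : measurable_fun [set: CT] (fun u : CT => complex.Re (cdot v u)).
    by apply: measurable_Re_cdot; [exact: measurable_cstCn|exact: measurable_idCn].
  have ml : measurable_fun [set: CT] (fun u : CT => 1 / 2 * complex.Re (cdot v u)).
    by apply: measurable_funM mr; exact: measurable_cst.
  exact: measurableT_comp ml.
have a0 u : 0 <= a u by exact: expR_ge0.
pose b e u := a u * hnorm (Phi (u + z) e).
have mb e : measurable_fun [set: CT] (fun u : CT => b e u).
  apply: measurable_funM => //; apply: (measurable_hnorm dot_norm sepH).
  by apply: wmeas_Phi_shift; [exact: measurable_idCn|exact: measurable_cstCn|exact: wmeas_cst].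
have b0 e u : 0 <= b e u by rewrite mulr_ge0 ?hnorm_ge0.
have h e : ((hnorm (Xi z v e) ^+ 2)%:E <= E%:E * \int[mu]_u (b e u ^+ 2)%:E)%E.
  have <- : (\int[mu]_u (a u ^+ 2)%:E = E%:E)%E.
    by rewrite -kernel_l1; apply: eq_integral => u _; rewrite expr2 aa.
  apply: le_trans (cauchy_schwarz_integral mu ma (mb e) a0 (b0 e)).
  rewrite EFin_expe lee_sqr ?lee_fin ?hnorm_ge0//.
    apply: le_trans (Xi_norm z v e) _; rewrite le_eqVlt; apply/orP; left; apply/eqP.
    by apply: eq_integral => u _; rewrite /b mulrA aa.
  by apply: integral_ge0 => u _; rewrite lee_fin mulr_ge0.
rewrite -lee_fin -sumEFin.
apply: (@le_trans _ _ (\sum_(e <- J) (E%:E * \int[mu]_u (b e u ^+ 2)%:E))%E).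
  by apply: lee_sum => e _; exact: h.
rewrite -ge0_sume_distrr; last first.
  by move=> e _; apply: integral_ge0 => u _; rewrite lee_fin sqr_ge0.
rewrite -(ge0_integral_sum mu measurableT); last 2 first.
- by move=> e; apply/measurable_EFinP; exact: measurable_funX.
- by move=> e u _; rewrite lee_fin sqr_ge0.
rewrite EE mulrA [B ^+ 2 * E]mulrC -mulrA [leRHS]EFinM; apply: lee_wpmul2l; rewrite ?lee_fin//.
apply: (@le_trans _ _ (\int[mu]_u (B ^+ 2 * expR (complex.Re (cdot v u)))%:E)%E).
  apply: ge0_le_integralT => u.
    by apply: sume_ge0 => e _; rewrite lee_fin sqr_ge0.
  rewrite sumEFin lee_fin; under eq_bigr do rewrite exprMn.
  rewrite -mulr_sumr expr2 aa mulrC ler_wpM2r ?expR_ge0//.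
  exact: hPhi.
rewrite (ge0_integral_cstM mu (measurable_exp_Re v) (fun u => expR_ge0 _) (sqr_ge0 B)).
by rewrite kernel_l1 -EFinM.
Qed.

(** The Schur test asks for measurability jointly in both arguments of [Xi]. Tonelli provides it for
    nonnegative integrands, so positive and negative parts are treated separately. *)
Lemma Xi_wmeas d (T : measurableType d) (p q : T -> CT) (F : T -> H) :
  measurable_fun setT p -> measurable_fun setT q -> wmeas dot F ->
  wmeas dot (fun x => Xi (p x) (q x) (F x)).
Proof.
move=> mp mq mF h.
pose f (y : T * CT) : R :=
  rdot ((bargmann_kernel (q y.1) y.2)^*%R *: Phi ((y.2 : 'rV_n) + p y.1) (F y.1)) h.
have m1 := @measurable_fst _ _ T CT; have m2 := @measurable_snd _ _ T CT.
have mf : measurable_fun setT f.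
  have /(_ h) : wmeas dot (fun y : T * CT =>
      (bargmann_kernel (q y.1) y.2)^*%R *: Phi ((y.2 : 'rV_n) + p y.1) (F y.1)).
    apply: wmeasZ.
      apply: cmeasurable_conj; apply: cmeasurable_kernel => //.
      exact: (measurableT_comp mq m1).
    apply: wmeas_Phi_shift => //; first exact: (measurableT_comp mp m1).
    exact: wmeas_comp m1 mF.
  exact.
have fE x : ((rdot (Xi (p x) (q x) (F x)) h)%:E =
    \int[mu]_u (EFin \o f)^\+ (x, u) - \int[mu]_u (EFin \o f)^\- (x, u))%E.
  have [_ <-] := Xi_wint (p x) (q x) (F x) h; rewrite integralE.
  by congr (_ - _)%E; apply: eq_integral => u _; rewrite ?funeposE ?funenegE.
have mEf : measurable_fun setT (EFin \o f) by exact/measurable_EFinP.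
apply/measurable_EFinP; rewrite (_ : _ \o _ = fun x =>
  (\int[mu]_u (EFin \o f)^\+ (x, u) - \int[mu]_u (EFin \o f)^\- (x, u))%E); last first.
  by apply/funext => x /=; exact: fE.
apply: emeasurable_funB.
  by apply: (@measurable_fun_fubini_tonelli_F _ _ T CT R mu (EFin \o f)^\+%E) => //;
    exact: measurable_funepos.
by apply: (@measurable_fun_fubini_tonelli_F _ _ T CT R mu (EFin \o f)^\-%E) => //;
  exact: measurable_funeneg.
Qed.

(* Completing the square turns the reproducing kernel at [z], translated by [z],
   into the kernel at [w - z]. *)
Lemma kernel_translate_reproducing w u z :
  cexp (cdot w (u + z)) * cexp (cdot (u + z) z) * (gd (u + z))%:C =
  cexp (cdot w z) * cexp (cdot (w - z) u) * (gd u)%:C.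
Proof.
have expC (a : R) : (expR a)%:C = cexp a%:C :> C.
  by rewrite /cexp/= cos0 sin0 mulr1 mulr0.
rewrite /gauss_density !rmorphM/= !expC mulrCA [RHS]mulrCA; congr (_ * _).
rewrite -!cexpD; congr cexp.
rewrite cnormD_sqr !cdotDr !cdotDl cdotzz cdotNl [cdot z u]cdotC.
case: (cdot u z) => a b; case: (cdot w z) => c d; case: (cdot w u) => e f.
by apply/eqP; rewrite eq_complex/=; apply/andP; split; apply/eqP; ring.
Qed.

Lemma toeplitz_kernel_bound D M w : l2bd D M -> (forall z, gproj D z = D z) ->
  ((hnorm (gproj (fun z => Phi z (D z)) w))%:E <=
   \int[mu]_z (expR (complex.Re (cdot w z)) * hnorm (Xi z (w - z) (D z)))%:E)%E.
Proof.
move=> DM PD; have [mD M0 _] := DM.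
pose E z : H := cexp (cdot w z) *: Xi z (w - z) (D z).
have mE : wmeas dot (E : CT -> H).
  apply: wmeasZ.
    by apply: cmeasurable_cexp; apply: cmeasurable_cdot; [exact: measurable_cstCn|exact: measurable_idCn].
  by apply: Xi_wmeas => //; apply: measurable_CnB; [exact: measurable_cstCn|exact: measurable_idCn].
suff Ew : wint dot mu (E : CT -> H) (gproj (fun z => Phi z (D z)) w).
  apply: le_trans (wint_norm dot_norm sepH mE Ew) _.
  apply: ge0_le_integralT => z; first by rewrite lee_fin hnorm_ge0.
  by rewrite lee_fin hnormZ cabs_cexp.
move=> h.
pose f (p : CT * CT) : \bar R :=
  (rdot ((cexp (cdot w p.1) * cexp (cdot p.1 p.2)) *: Phi p.1 (D p.2)) h)%:E.
have m1 := @measurable_fst _ _ CT CT; have m2 := @measurable_snd _ _ CT CT.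
have mf : measurable_fun setT f.
  apply/measurable_EFinP.
  have /(_ h) : wmeas dot (fun p : CT * CT =>
      (cexp (cdot w p.1) * cexp (cdot p.1 p.2)) *: Phi p.1 (D p.2)).
    apply: wmeasZ.
      have mw : measurable_fun [set: CT * CT] (fun _ => w : CT) by exact: measurable_cst.
      by apply: cmeasurableM; apply: cmeasurable_cexp; apply: cmeasurable_cdot.
    apply: (@wmeas_app _ _ _ dot_norm sepH _ _ (fun p : CT * CT => Phi p.1) (fun p : CT * CT => D p.2)).
    - by move=> p; exact: Phi_bounded.
    - by move=> g; exact: wmeas_comp m1 (mPhi g).
    - exact: wmeas_comp m2 mD.
  exact.
have [c c0 hc] := @kernel_pairing R n H dot dot_norm sepH.
have k0 : 0 <= B * hnorm h by rewrite mulr_ge0 ?hnorm_ge0.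
pose a u := B * hnorm h * expR (complex.Re (cdot w u)).
have ma : measurable_fun [set: CT] (fun u : CT => a u).
  by apply: measurable_funM; [exact: measurable_cst|exact: measurable_exp_Re].
have a0 u : 0 <= a u by rewrite mulr_ge0 ?expR_ge0.
have a2 : (\int[mu]_u (a u ^+ 2)%:E <= ((B * hnorm h * expR (cnorm w ^+ 2 / 2)) ^+ 2)%:E)%E.
  under eq_integral do rewrite /a exprMn.
  have me : measurable_fun [set: CT] (fun u : CT => expR (complex.Re (cdot w u)) ^+ 2).
    by apply: measurable_funX; exact: measurable_exp_Re.
  rewrite (ge0_integral_cstM mu me (fun u => sqr_ge0 _) (sqr_ge0 _)).
  rewrite [in leRHS]exprMn [leRHS]EFinM; apply: lee_wpmul2l; first by rewrite lee_fin sqr_ge0.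
  exact: kernel_l2.
have intf : (mu \x mu)%E.-integrable setT f.
  apply: (@integrable12ltyP _ _ _ _ _ mu mu f mf).2.
  apply: le_lt_trans (_ : _ <= (B * hnorm h * expR (cnorm w ^+ 2 / 2) * (c * M))%:E)%E (ltry _).
  have := hc D M (fun u : CT => a u) _ DM ma a0 (mulr_ge0 k0 (expR_ge0 _)) a2.
  apply: le_trans; apply: ge0_le_integralT => u.
    by apply: integral_ge0.
  apply: ge0_le_integralT => z //; rewrite lee_fin.
  apply: le_trans (cauchy_schwarz dot_norm _ _) _.
  rewrite hnormZ cabsM !cabs_cexp /a.
  rewrite [leRHS](_ : _ = expR (complex.Re (cdot w u)) * expR (complex.Re (cdot u z)) *
    (B * hnorm (D z)) * hnorm h); last by ring.
  rewrite ler_wpM2r ?hnorm_ge0// ler_wpM2l ?mulr_ge0 ?expR_ge0//; exact: bPhi.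
(* Integration over [z] first: the adjoint of [Phi u] isolates the reproducing integral of [D],
   which collapses to [D u]. *)
have inner1 u : (\int[mu]_z f (u, z) = (rdot ((bargmann_kernel w u)^*%R *: Phi u (D u)) h)%:E)%E.
  pose k : H := adj dot (Phi u) ((cexp (cdot w u))^*%R *: h).
  have kE (b : C) x : rdot ((cexp (cdot w u) * b) *: Phi u x) h = rdot (b *: x) k.
    rewrite -scalerA rdotZ_adj -(linear_opZ (lPhi u)) (adjP dot_norm (Phi_bounded u)).
    by [].
  have [_ e] := gprojP dot_norm sepH u DM k.
  rewrite conj_kernelE -[cexp _]mulr1 kE scale1r -[in RHS](PD u) -e.
  by apply: eq_integral => z _; rewrite /f/= kE conj_kernelE.
(* Integration over [u] first: after the translation by [z] the integrand is that of
   [Xi z (w - z)]. *)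
have inner2 z : (\int[mu]_u f (u, z) = (rdot (E z) h)%:E)%E.
  pose g u := rdot ((cexp (cdot w u) * cexp (cdot u z)) *: Phi u (D z)) h.
  pose g2 u := rdot (cexp (cdot w z) *: ((bargmann_kernel (w - z) u)^*%R *: Phi (u + z) (D z))) h.
  have mg : measurable_fun [set: CT] (fun u : CT => g u).
    have := measurableT_comp mf (@measurable_pair2 _ _ CT CT z).
    by move/measurable_EFinP.
  have mg2 : measurable_fun [set: CT] (fun u : CT => g2 u).
    have /(_ h) : wmeas dot (fun u : CT =>
        cexp (cdot w z) *: ((bargmann_kernel (w - z) u)^*%R *: Phi ((u : 'rV_n) + z) (D z))).
      apply: wmeasZ; first exact: cmeasurable_cst.
      apply: wmeasZ; first exact: cmeasurable_conj_kernel.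
      by apply: wmeas_Phi_shift; [exact: measurable_idCn|exact: measurable_cstCn|exact: wmeas_cst].
    exact.
  have [_ <-] := wintZ (cexp (cdot w z)) (Xi_wint z (w - z) (D z)) h.
  have mgd := @measurable_gauss_density R n.
  have mgg : measurable_fun [set: CT] (fun u : CT => g u * gd u) by exact: measurable_funM.
  transitivity (\int[V]_u (g u * gd u)%:E)%E; first exact: (integral_muG mg).
  transitivity (\int[V]_u (g2 u * gd u)%:E)%E; last exact/esym/(integral_muG mg2).
  rewrite -(integral_Cshift z mgg); apply: eq_integral => u _; congr EFin.
  have sc (b : C) (x : H) (r : R) : rdot (b *: x) h * r = rdot ((b * r%:C) *: x) h.
    by rewrite [b * _]mulrC -scalerA rdotZl mulrC.
  by rewrite /g /g2 scalerA !sc conj_kernelE kernel_translate_reproducing.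
split.
  apply/integrableP; split; first by apply/measurable_EFinP; exact: mE.
  apply: le_lt_trans ((@integrable21ltyP _ _ _ _ _ mu mu f mf).1 intf).
  apply: ge0_le_integralT => z //; rewrite -inner2.
  apply: le_abse_integral => //.
  exact: (measurableT_comp mf (@measurable_pair2 _ _ CT CT z)).
transitivity (\int[mu]_z \int[mu]_u f (u, z))%E.
  by apply: eq_integral => z _; rewrite inner2.
rewrite -(@Fubini _ _ _ _ R mu mu f intf).
have [_ <-] := gprojP dot_norm sepH w (Phi_l2bd DM) h.
by apply: eq_integral => u _; rewrite inner1.
Qed.

End toeplitz_kernel.

Section real_dominated_convergence.
Local Open Scope ereal_scope.
Context d (T : measurableType d) (R : realType) (mu : {measure set T -> \bar R}).

Lemma real_dominated_convergence (f : nat -> T -> R) (f0 g : T -> R) :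
  (forall k, measurable_fun setT (f k)) -> measurable_fun setT f0 ->
  (forall x, f k x @[k --> \oo] --> f0 x) ->
  measurable_fun setT g -> (\int[mu]_x (g x)%:E < +oo) ->
  (forall k x, (`|f k x| <= g x)%R) ->
  \int[mu]_x (f k x)%:E @[k --> \oo] --> \int[mu]_x (f0 x)%:E.
Proof.
move=> mf mf0 ff0 mg ig fg.
have g0 x : (0 <= g x)%R by apply: le_trans (fg 0%N x).
have [] := @dominated_convergence _ T R mu setT measurableT (fun k x => (f k x)%:E)
  (fun x => (f0 x)%:E) (fun x => (g x)%:E).
- by move=> k; exact/measurable_EFinP.
- exact/measurable_EFinP.
- by apply: aeW => x _; apply: cvg_EFin; [exact: nearW|exact: ff0].
- apply/integrableP; split; first exact/measurable_EFinP.
  by under eq_integral do rewrite gee0_abs ?lee_fin//.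
- by apply: aeW => x k _; rewrite lee_fin.
by [].
Qed.

End real_dominated_convergence.

(** * Toeplitz images of pointwise weakly null sequences *)

Section compactness_core.
Local Open Scope complex_scope.
Context {R : realType} {n : nat} {H : completeNormedModType R[i]}.
Context {dot : {dot H for @conjc R}}.
Hypothesis dot_norm : forall x : H, dot x x = `|x| ^+ 2.
Hypothesis sepH : separable H.
Local Notation rdot := (rdot dot).
Local Notation l2bd := (l2bd dot).
Local Notation gproj := (gproj dot).
Local Notation C := R[i].
Local Notation CT := (Cn R n).
Local Notation V := (@lebesgueC R n).
Local Notation mu := (@muG R n).
Local Notation gd := (@gauss_density R n).
Implicit Types (z w u v : 'rV[C]_n) (F G K D : 'rV[C]_n -> H) (M : R).

Lemma hs_norm_sqr_ge (A : H -> H) (x : H) : linear A -> hnorm x != 0 ->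
  ((hnorm (A x) ^+ 2 / hnorm x ^+ 2)%:E <= hs_norm dot A ^+ 2)%E.
Proof.
move=> lA x0; have hs0 : (0 <= hs_norm dot A)%E by exact: sqrte_ge0.
have x1 : 0 < hnorm x by rewrite lt_neqAle eq_sym x0 hnorm_ge0.
case E : (hs_norm dot A) => [r| |].
- rewrite -EFin_expe lee_fin ler_pdivrMr ?exprn_gt0// -exprMn.
  have r0 : 0 <= r by rewrite E in hs0.
  rewrite ler_pXn2r ?nnegrE ?mulr_ge0 ?hnorm_ge0//.
  by apply: (hnorm_le_hs_bound dot_norm x lA r0); rewrite E.
- by rewrite expe2 mulyy leey.
- by rewrite E in hs0.
Qed.

Variables (Phi : 'rV[C]_n -> H -> H) (B : R).
Hypothesis B0 : 0 <= B.
Hypothesis lPhi : forall z, linear (Phi z).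
Hypothesis mPhi : forall g, wmeas dot (fun z : CT => Phi z g).
Hypothesis bPhi : forall z x, hnorm (Phi z x) <= B * hnorm x.
Hypothesis hPhi : forall z, hs_bounded dot (Phi z) (B ^+ 2).
Local Notation Xi := (Xi dot Phi).

Let lXi z v : linear (Xi z v).
Proof. exact: (Xi_linear dot_norm sepH B0 lPhi mPhi bPhi). Qed.

Let mXi d (T : measurableType d) (p q : T -> CT) (F : T -> H) :
  measurable_fun setT p -> measurable_fun setT q -> wmeas dot F ->
  measurable_fun setT (fun x => hnorm (Xi (p x) (q x) (F x))).
Proof.
move=> mp mq mF; apply: (measurable_hnorm dot_norm sepH).
exact: (Xi_wmeas dot_norm sepH B0 lPhi mPhi bPhi).
Qed.

Let mX z x : measurable_fun [set: CT] (fun v : CT => hnorm (Xi z v x)).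
Proof. by apply: mXi; [exact: measurable_cstCn|exact: measurable_idCn|exact: wmeas_cst]. Qed.

Lemma Xi_sqr_int z x (e : R) : 0 <= e ->
  (\int[mu]_v (hs_norm dot (Xi z v) ^+ 2) <= e%:E)%E ->
  (\int[mu]_v (hnorm (Xi z v x) ^+ 2)%:E <= (e * hnorm x ^+ 2)%:E)%E.
Proof.
move=> e0 he; have [x0|x0] := eqVneq (hnorm x) 0.
  rewrite (eq_integral (fun _ : CT => 0%:E)).
    by rewrite integral0_eq// x0 expr0n mulr0.
  move=> v _; congr EFin; apply/eqP; rewrite expf_eq0/=.
  by rewrite (hnorm0_eq0 x0) (linear_op0 (lXi z v)) hnorm0.
have mXx : measurable_fun [set: CT] (fun v : CT => hnorm (Xi z v x) ^+ 2 / hnorm x ^+ 2).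
  by apply: measurable_funM => //; apply: measurable_funX; exact: mX.
rewrite (eq_integral (fun v : CT => (hnorm x ^+ 2 * (hnorm (Xi z v x) ^+ 2 / hnorm x ^+ 2))%:E)).
  rewrite (ge0_integral_cstM mu mXx _ (sqr_ge0 _)); last first.
    by move=> v; rewrite mulr_ge0 ?invr_ge0 ?sqr_ge0.
  rewrite mulrC [leRHS]EFinM; apply: lee_wpmul2l; first by rewrite lee_fin sqr_ge0.
  apply: le_trans he; apply: ge0_le_integralT => v.
    by rewrite lee_fin mulr_ge0 ?invr_ge0 ?sqr_ge0.
  exact: hs_norm_sqr_ge.
by move=> v _; rewrite mulrC divfK// expf_neq0.
Qed.

(** The inner integral in the conclusion of the Schur test, with a fixed vector [x] in place of the
    value of the function at [z]. *)
Let j (x : H) z := (\int[V]_v (expR (- (7 / 8 * cnorm v ^+ 2)) * hnorm (Xi z v x) ^+ 2)%:E)%E.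

Let mj z x : measurable_fun [set: CT]
  (fun v : CT => expR (- (7 / 8 * cnorm v ^+ 2)) * hnorm (Xi z v x) ^+ 2).
Proof.
by apply: measurable_funM; [apply: measurable_gauss; exact: measurable_idCn|
  apply: measurable_funX; exact: mX].
Qed.

Let dj z v x : expR (- (7 / 8 * cnorm v ^+ 2)) * hnorm (Xi z v x) ^+ 2 <=
  B ^+ 2 * hnorm x ^+ 2 * expR (- (3 / 8 * cnorm v ^+ 2)).
Proof.
have h : hnorm (Xi z v x) ^+ 2 <= (B * expR (1 / 4 * cnorm v ^+ 2) * hnorm x) ^+ 2.
  rewrite ler_pXn2r ?nnegrE ?mulr_ge0 ?expR_ge0 ?hnorm_ge0//.
  exact: (Xi_bound dot_norm sepH B0 lPhi mPhi bPhi).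
apply: le_trans (ler_wpM2l (expR_ge0 _) h) _.
have <- : expR (- (7 / 8 * cnorm v ^+ 2)) * expR (1 / 4 * cnorm v ^+ 2) ^+ 2 =
    expR (- (3 / 8 * cnorm v ^+ 2)).
  by rewrite -expRM_natl -expRD; congr expR; field.
by rewrite le_eqVlt; apply/orP; left; apply/eqP; ring.
Qed.

Lemma j_cvg z (x : nat -> H) M : (forall k, hnorm (x k) <= M) ->
  (forall h, rdot (x k) h @[k --> \oo] --> (0 : R)) ->
  (j (x k) z @[k --> \oo] --> 0)%E.
Proof.
move=> xM x0; have M0 : 0 <= M by apply: le_trans (xM 0%N); exact: hnorm_ge0.
have mg : measurable_fun [set: CT] (fun v : CT => expR (- (3 / 8 * cnorm v ^+ 2))).
  by apply: measurable_gauss; exact: measurable_idCn.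
have [I hI] := @gaussC_integrable R n (3 / 8) ltac:(lra).
have k0 : 0 <= B ^+ 2 * M ^+ 2 by rewrite mulr_ge0 ?sqr_ge0.
rewrite -[X in _ --> X](_ : (\int[V]_v (0 : R)%:E)%E = _); last by rewrite integral0_eq.
apply: (@real_dominated_convergence _ CT R V _ _
  (fun v : CT => B ^+ 2 * M ^+ 2 * expR (- (3 / 8 * cnorm v ^+ 2)))).
- by move=> k; exact: mj.
- exact: measurable_cst.
- move=> v; rewrite -[X in _ --> X](mulr0 (expR (- (7 / 8 * cnorm v ^+ 2)))).
  apply: cvgMl_tmp; rewrite -[X in _ --> X](mulr0 0); apply: cvgM;
    apply: (hs_bounded_compact dot_norm (lXi z v) (Xi_hs_bounded dot_norm sepH B0 lPhi mPhi bPhi hPhi z v) xM x0).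
- by apply: measurable_funM => //; exact: measurable_cst.
- by rewrite (ge0_integral_cstM V mg (fun v => expR_ge0 _) k0) hI -EFinM ltry.
move=> k v; rewrite ger0_norm; last by rewrite mulr_ge0 ?expR_ge0 ?sqr_ge0.
apply: le_trans (dj z v _) _; rewrite ler_wpM2r ?expR_ge0// ler_wpM2l ?sqr_ge0//.
by rewrite ler_pXn2r ?nnegrE ?hnorm_ge0.
Qed.

(** Relative to the Gaussian, the weight of [j] leaves a factor [exp (|v|^2 / 8)]. AM-GM splits it
    into [1 / eta], which meets the hypothesis on [Xi], and [eta exp (|v|^2 / 4)], which meets the
    square of [Xi_bound], of growth [exp (|v|^2 / 2)]. The rates add up to 3/4, below 1. *)
Lemma j_tail z x (eta del I : R) : 0 < eta -> 0 <= del -> 0 <= I ->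
  (\int[mu]_u (expR (3 / 4 * cnorm u ^+ 2))%:E <= I%:E)%E ->
  (\int[mu]_v (hs_norm dot (Xi z v) ^+ 2) <= del%:E)%E ->
  (j x z <= (pi ^+ n * (del / eta + eta * B ^+ 2 * I) * hnorm x ^+ 2)%:E)%E.
Proof.
move=> eta0 del0 I0 hI hdel.
have p0 : 0 < pi ^+ n :> R by rewrite exprn_gt0// pi_gt0.
have mX2 : measurable_fun [set: CT] (fun v : CT => hnorm (Xi z v x) ^+ 2).
  by apply: measurable_funX; exact: mX.
have mexp (a : R) : measurable_fun [set: CT] (fun v : CT => expR (a * cnorm v ^+ 2)).
  have ml : measurable_fun [set: CT] (fun v : CT => a * cnorm v ^+ 2).
    by apply: measurable_funM => //; apply: measurable_funX; apply: measurable_cnorm; exact: measurable_idCn.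
  exact: measurableT_comp ml.
have mf : measurable_fun [set: CT]
    (fun v : CT => pi ^+ n * (expR (1 / 8 * cnorm v ^+ 2) * hnorm (Xi z v x) ^+ 2)).
  by apply: measurable_funM => //; exact: measurable_funM.
have k1 : 0 <= pi ^+ n / eta by rewrite divr_ge0 ?ltW.
have k2 : 0 <= pi ^+ n * eta * (B ^+ 2 * hnorm x ^+ 2).
  by apply: mulr_ge0; apply: mulr_ge0; rewrite ?sqr_ge0// ltW.
have -> : j x z = (\int[mu]_v (pi ^+ n * (expR (1 / 8 * cnorm v ^+ 2) *
    hnorm (Xi z v x) ^+ 2))%:E)%E.
  rewrite (ge0_integral_mu mf); last by move=> v; rewrite !mulr_ge0 ?expR_ge0 ?sqr_ge0 ?hnorm_ge0 ?ltW.
  apply: eq_integral => v _; congr EFin; rewrite /gauss_density.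
  have -> : expR (- (7 / 8 * cnorm v ^+ 2)) = expR (1 / 8 * cnorm v ^+ 2) * expR (- cnorm v ^+ 2).
    by rewrite -expRD; congr expR; field.
  by field; rewrite gt_eqF.
apply: (@le_trans _ _ (\int[mu]_v ((pi ^+ n / eta * hnorm (Xi z v x) ^+ 2)%:E +
    (pi ^+ n * eta * (B ^+ 2 * hnorm x ^+ 2) * expR (3 / 4 * cnorm v ^+ 2))%:E)%E)%E).
  apply: ge0_le_integralT => v; first by rewrite lee_fin !mulr_ge0 ?expR_ge0 ?sqr_ge0 ?hnorm_ge0 ?ltW.
  rewrite -EFinD lee_fin.
  have hX : hnorm (Xi z v x) ^+ 2 <= B ^+ 2 * hnorm x ^+ 2 * expR (1 / 2 * cnorm v ^+ 2).
    have -> : expR (1 / 2 * cnorm v ^+ 2) = expR (1 / 4 * cnorm v ^+ 2) ^+ 2.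
      by rewrite -expRM_natl; congr expR; field.
    rewrite -!exprMn ler_pXn2r ?nnegrE ?mulr_ge0 ?expR_ge0 ?hnorm_ge0//.
    apply: le_trans (Xi_bound dot_norm sepH B0 lPhi mPhi bPhi _ _ _) _.
    by rewrite mulrAC.
  (* AM-GM: [t <= 1 / eta + eta * t ^+ 2] *)
  have amgm : expR (1 / 8 * cnorm v ^+ 2) <= eta^-1 + eta * expR (1 / 4 * cnorm v ^+ 2).
    have -> : expR (1 / 4 * cnorm v ^+ 2) = expR (1 / 8 * cnorm v ^+ 2) ^+ 2.
      by rewrite -expRM_natl; congr expR; field.
    set t := expR _; have t0 : 0 <= t by exact: expR_ge0.
    rewrite -(ler_pM2l eta0) mulrDr mulfV ?gt_eqF//.
    have := sqr_ge0 (eta * t - 1 / 2); rewrite sqrrB => h; nra.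
  apply: (@le_trans _ _ (pi ^+ n * ((eta^-1 + eta * expR (1 / 4 * cnorm v ^+ 2)) *
      hnorm (Xi z v x) ^+ 2))).
    by rewrite (ler_wpM2l (ltW p0))// ler_wpM2r ?sqr_ge0.
  have -> : expR (3 / 4 * cnorm v ^+ 2) = expR (1 / 4 * cnorm v ^+ 2) * expR (1 / 2 * cnorm v ^+ 2).
    by rewrite -expRD; congr expR; field.
  rewrite [leLHS](_ : _ = pi ^+ n / eta * hnorm (Xi z v x) ^+ 2 +
    pi ^+ n * (eta * expR (1 / 4 * cnorm v ^+ 2) * hnorm (Xi z v x) ^+ 2)); last by ring.
  rewrite lerD2l.
  rewrite [leRHS](_ : _ = pi ^+ n * (eta * expR (1 / 4 * cnorm v ^+ 2) *
    (B ^+ 2 * hnorm x ^+ 2 * expR (1 / 2 * cnorm v ^+ 2)))); last by ring.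
  by rewrite (ler_wpM2l (ltW p0))// ler_wpM2l// mulr_ge0 ?expR_ge0// ltW.
rewrite (ge0_integralD mu measurableT); last 4 first.
- by move=> v _; rewrite lee_fin mulr_ge0 ?sqr_ge0.
- by apply/measurable_EFinP; apply: measurable_funM.
- by move=> v _; rewrite lee_fin mulr_ge0 ?expR_ge0.
- by apply/measurable_EFinP; apply: measurable_funM.
rewrite (ge0_integral_cstM mu mX2 (fun v => sqr_ge0 _) k1).
rewrite (ge0_integral_cstM mu (mexp _) (fun v => expR_ge0 _) k2).
apply: (@le_trans _ _ ((pi ^+ n / eta)%:E * (del * hnorm x ^+ 2)%:E +
    (pi ^+ n * eta * (B ^+ 2 * hnorm x ^+ 2))%:E * I%:E)%E).
  by apply: leeD; apply: lee_wpmul2l; rewrite ?lee_fin//; exact: Xi_sqr_int.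
by rewrite -!EFinM -EFinD lee_fin le_eqVlt; apply/orP; left; apply/eqP; ring.
Qed.

Lemma toeplitz_weakly_null (D : nat -> 'rV[C]_n -> H) M :
  (\int[mu]_w (hs_norm dot (Xi z w) ^+ 2) @[z --> @cinfty R n] --> 0)%E ->
  (forall k, l2bd (D k) M) -> (forall k z, gproj (D k) z = D k z) ->
  (forall z h, rdot (D k z) h @[k --> \oo] --> (0 : R)) ->
  forall e : R, 0 < e -> \forall k \near \oo,
    (\int[mu]_w (hnorm (gproj (fun z => Phi z (D k z)) w) ^+ 2)%:E <= e%:E)%E.
Proof.
move=> Xlim DM PD D0 e e0.
have M0 : 0 <= M by have [] := DM 0%N.
have [c c0 hc] := @schur_test R n.
have [I I0 hI] := @integral_mu_exp R n (3 / 4) ltac:(lra).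
have [I38 hI38] := @gaussC_integrable R n (3 / 8) ltac:(lra).
have I380 : 0 <= I38.
  by rewrite -lee_fin -hI38; apply: integral_ge0 => v _; rewrite lee_fin expR_ge0.
have p0 : 0 < pi ^+ n :> R by rewrite exprn_gt0// pi_gt0.
(* [q] is the coefficient of [|D k z|^2] allowed in the tail; after multiplication by [c] the tail
   then contributes at most [e / 2]. The summands 1 guard against [c = 0] and [M = 0]. *)
pose q := e / (2 * (c + 1) * (M ^+ 2 + 1)).
have q0 : 0 < q by rewrite divr_gt0// !mulr_gt0 ?ltr_wpDl ?sqr_ge0.
pose b := pi ^+ n * (B ^+ 2 * I).
have b0 : 0 <= b.
  by apply: mulr_ge0; [exact: ltW|apply: mulr_ge0; [exact: sqr_ge0|exact: ltW]].
(* [eta] is fixed first, so that the a priori term is at most [q / 2]; then [del] is taken small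
   enough to absorb the factor [1 / eta]. *)
pose eta := q / (2 * (b + 1)).
have eta0 : 0 < eta by rewrite divr_gt0// mulr_gt0// ltr_wpDl.
pose del := eta * q / (2 * pi ^+ n).
have del0 : 0 < del by rewrite divr_gt0// mulr_gt0.
have tailE : pi ^+ n * (del / eta + eta * B ^+ 2 * I) <= q.
  rewrite [leLHS](_ : _ = q / 2 + eta * b); last first.
    by rewrite /del /b; field; rewrite !gt_eqF.
  have : eta * b <= q / 2.
    rewrite /eta mulrAC ler_pdivrMr ?mulr_gt0 ?ltr_wpDl//.
    by rewrite [leRHS](_ : _ = q * (b + 1)); [rewrite (ler_wpM2l (ltW q0))// lerDl|field].
  lra.
have [R0 hR0] : exists R0 : R, forall z, R0 < cnorm z ->
    (\int[mu]_v (hs_norm dot (Xi z v) ^+ 2) <= del%:E)%E.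
  have nd : nbhs (0 : \bar R)%E [set y : \bar R | (y < del%:E)%E].
    by apply: open_nbhs_nbhs; split; [exact: open_ereal_lt_ereal|rewrite /= lte_fin].
  have [R0 hR0] := Xlim _ nd; exists R0 => z /hR0 h; exact: ltW.
have mD k : wmeas dot (D k : CT -> H) by have [] := DM k.
have Dz k z : hnorm (D k z) <= expR (cnorm z ^+ 2 / 2) * M.
  by rewrite -PD; exact: gproj_bound dot_norm sepH _ _ _ (DM k).
have j0 x z : (0 <= j x z)%E.
  by apply: integral_ge0 => v _; rewrite lee_fin mulr_ge0 ?expR_ge0 ?sqr_ge0.
have mg : measurable_fun [set: CT] (fun v : CT => expR (- (3 / 8 * cnorm v ^+ 2))).
  by apply: measurable_gauss; exact: measurable_idCn.
have jB x z : (j x z <= (B ^+ 2 * hnorm x ^+ 2 * I38)%:E)%E.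
  have k0 : 0 <= B ^+ 2 * hnorm x ^+ 2 by rewrite mulr_ge0 ?sqr_ge0.
  rewrite EFinM -hI38 -(ge0_integral_cstM V mg (fun v => expR_ge0 _) k0).
  apply: ge0_le_integralT => v; rewrite lee_fin; last exact: dj.
  by rewrite mulr_ge0 ?expR_ge0 ?sqr_ge0.
have jfin x z : j x z = (fine (j x z))%:E.
  by rewrite fineK// ge0_fin_numE//; exact: le_lt_trans (jB x z) (ltry _).
pose m k (p : CT * CT) := hnorm (Xi p.1 p.2 (D k p.1)).
have mm k : measurable_fun setT (m k).
  apply: mXi; [exact: measurable_fst|exact: measurable_snd|].
  exact: wmeas_comp measurable_fst (mD k).
have mjk k : measurable_fun [set: CT] (fun z : CT => j (D k z) z).
  apply: (@measurable_fun_fubini_tonelli_F _ _ CT CT R V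
    (fun p : CT * CT => (expR (- (7 / 8 * cnorm p.2 ^+ 2)) * m k p ^+ 2)%:E)).
    apply/measurable_EFinP; apply: measurable_funM; last by apply: measurable_funX; exact: mm.
    by apply: measurable_gauss; exact: measurable_snd.
  by move=> p; rewrite lee_fin mulr_ge0 ?expR_ge0 ?sqr_ge0.
pose S : set CT := [set z | cnorm z <= R0].
have mS : measurable S.
  have mc : measurable_fun [set: CT] (fun z : CT => cnorm z) by apply: measurable_cnorm; exact: measurable_idCn.
  have := mc measurableT `]-oo, R0]%classic (measurable_itv _).
  by rewrite setTI (_ : _ @^-1` _ = S)//; apply/seteqP; split => z /=; rewrite in_itv.
pose p k z : R := \1_S z * fine (j (D k z) z).
have mp k : measurable_fun [set: CT] (fun z : CT => p k z).
  apply: measurable_funM; first exact: measurable_indic.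
  by apply: measurableT_comp => //; exact: mjk.
have p0' k z : 0 <= p k z by rewrite mulr_ge0 ?indicE// fine_ge0.
(* Dominating constant: on the ball [cnorm z <= R0] the pointwise bound for reproduced functions is
   uniform in [k]. *)
pose W := B ^+ 2 * (expR (R0 ^+ 2 / 2) * M) ^+ 2 * I38.
have W0 : 0 <= W by rewrite !mulr_ge0 ?sqr_ge0.
have plim : (\int[mu]_z (p k z)%:E @[k --> \oo] --> 0)%E.
  rewrite -[X in _ --> X](_ : (\int[mu]_z (0 : R)%:E)%E = _); last by rewrite integral0_eq.
  apply: (@real_dominated_convergence _ CT R mu _ _ (fun _ => W)).
  - exact: mp.
  - exact: measurable_cst.
  - move=> z; rewrite -[X in _ --> X](mulr0 (\1_S z)); apply: cvgMl_tmp.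
    have := @j_cvg z (fun k => D k z) _ (fun k => Dz k z) (D0 z).
    exact: fine_cvg.
  - exact: measurable_cst.
  - have -> : (\int[mu]_x W%:E = W%:E)%E; last exact: ltry.
    by rewrite integral_cst// -[RHS]mule1; congr (_ * _)%E; exact: muG_setT.
  move=> k z; rewrite ger0_norm//; rewrite /p indicE.
  case: (boolP (z \in S)) => zS; last by rewrite mul0r.
  rewrite mul1r -lee_fin -jfin; apply: le_trans (jB _ _) _.
  rewrite lee_fin /W ler_wpM2r// ler_wpM2l ?sqr_ge0// ler_pXn2r ?nnegrE ?mulr_ge0 ?expR_ge0 ?hnorm_ge0//.
  apply: le_trans (Dz k z) _; rewrite ler_wpM2r// ler_expR ler_wpM2r//.
  move: zS; rewrite inE /S/= => zR.
  by rewrite ler_pXn2r ?nnegrE ?cnorm_ge0//; exact: le_trans (cnorm_ge0 z) zR.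
pose e1 := e / (2 * (c + 1)).
have e10 : 0 < e1 by rewrite divr_gt0// mulr_gt0// ltr_wpDl.
have np : nbhs (0 : \bar R)%E [set y : \bar R | (y < e1%:E)%E].
  by apply: open_nbhs_nbhs; split; [exact: open_ereal_lt_ereal|rewrite /= lte_fin].
have : \forall k \near \oo, (\int[mu]_z (p k z)%:E < e1%:E)%E by exact: plim _ np.
apply: filterS => k pk.
have [_ _ iD] := DM k.
have mN2 := measurable_hnorm_sqr dot_norm sepH (mD k).
apply: (@le_trans _ _ (c%:E * \int[mu]_z j (D k z) z)%E).
  apply: le_trans (hc (m k) (mm k) (fun p => hnorm_ge0 _)).
  apply: ge0_le_integralT => w; first by rewrite lee_fin sqr_ge0.
  rewrite EFin_expe lee_sqr ?lee_fin ?hnorm_ge0//; last first.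
    by apply: integral_ge0 => z _; rewrite lee_fin mulr_ge0 ?expR_ge0 ?hnorm_ge0.
  exact: (toeplitz_kernel_bound dot_norm sepH B0 lPhi mPhi bPhi w (DM k) (PD k)).
apply: (@le_trans _ _ (c%:E * (e1%:E + (q * M ^+ 2)%:E))%E).
  apply: lee_wpmul2l; first by rewrite lee_fin.
  apply: (@le_trans _ _ (\int[mu]_z ((p k z)%:E + (q * hnorm (D k z) ^+ 2)%:E))%E).
    apply: ge0_le_integralT => z //; rewrite -EFinD.
    have [zR|Rz] := leP (cnorm z) R0.
      rewrite jfin lee_fin /p indicE mem_set// mul1r lerDl.
      by rewrite mulr_ge0 ?sqr_ge0 ?ltW.
    apply: le_trans (j_tail (D k z) eta0 (ltW del0) (ltW I0) hI (hR0 z Rz)) _.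
    rewrite lee_fin; apply: le_trans (_ : q * hnorm (D k z) ^+ 2 <= _).
      by rewrite ler_wpM2r ?sqr_ge0.
    by rewrite lerDr.
  rewrite (ge0_integralD mu measurableT); last 4 first.
  - by move=> z _; rewrite lee_fin.
  - by apply/measurable_EFinP; exact: mp.
  - by move=> z _; rewrite lee_fin mulr_ge0 ?sqr_ge0 ?ltW.
  - by apply/measurable_EFinP; apply: measurable_funM.
  rewrite (ge0_integral_cstM mu mN2 (fun z => sqr_ge0 _) (ltW q0)).
  apply: leeD; first exact: ltW.
  rewrite [leRHS]EFinM; apply: lee_wpmul2l => //; by rewrite lee_fin ltW.
rewrite -EFinD -EFinM lee_fin.
have c1 : 0 < c + 1 by rewrite ltr_wpDl.
have M1 : 0 < M ^+ 2 + 1 by rewrite ltr_wpDl ?sqr_ge0.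
have h1 : q * M ^+ 2 <= e1.
  have -> : e1 = q * (M ^+ 2 + 1) by rewrite /q /e1; field; rewrite !gt_eqF.
  by rewrite (ler_wpM2l (ltW q0))// lerDl.
have h2 : e = (c + 1) * (e1 + e1) by rewrite /e1; field; rewrite gt_eqF.
rewrite h2; apply: ler_pM => //; first by rewrite addr_ge0 ?(ltW e10)// mulr_ge0 ?sqr_ge0// ltW.
  by rewrite lerDl.
by rewrite lerD2l.
Qed.

End compactness_core.

(** * Weakly convergent subsequences *)

Section extraction.
Context {R : realType}.

(** Compactness of the segment gives a cluster point, and for an ultrafilter a cluster point is a
    limit. *)
Lemma ultra_bounded_cvg (U : set_system nat) (a : nat -> R) (M : R) : UltraFilter U ->
  (forall k, `|a k| <= M) -> exists c : R, a k @[k --> U] --> c.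
Proof.
move=> UU aM; have PU : ProperFilter U by exact: ultra_proper.
have Ua : (a @ U) `[- M, M]%classic.
  have h : U (fun k => `[- M, M]%classic (a k)).
    by apply: filterE => k /=; rewrite in_itv/= -ler_norml.
  exact: h.
have [c [_ cc]] := @segment_compact R (- M) M (a @ U) _ Ua.
exists c => A Ac; have [//|nA] := @in_ultra_setVsetC _ U (a @^-1` A) UU.
have [x [/= xA xA']] := cc _ _ (nA : (a @ U) (~` A)) Ac.
by [].
Qed.

(** Returns from the filter [U] to a genuine subsequence: every set of [U] contains arbitrarily
    large indices, so [s j] can be chosen beyond [s (j - 1)] with the first [j + 1] sequences within
    [1 / (j + 1)] of their limits. *)
Lemma diagonal_extraction (U : set_system nat) (a : nat -> nat -> R) (c : nat -> R) :
  ProperFilter U -> \oo `<=` U -> (forall m, a m k @[k --> U] --> c m) ->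
  exists s : nat -> nat, {homo s : i j / (i < j)%N} /\
    forall m, a m (s j) @[j --> \oo] --> c m.
Proof.
move=> PU oU ac.
have pick j N : exists k, (N < k)%N /\ forall m, (m <= j)%N -> `|c m - a m k| <= j.+1%:R^-1.
  have : U [set k | (N < k)%N /\ forall m, (m <= j)%N -> `|c m - a m k| <= j.+1%:R^-1].
    apply: filterI; first by apply: oU; exact: nbhs_infty_gt.
    have e0 : 0 < j.+1%:R^-1 :> R by rewrite invr_gt0.
    move: (j.+1%:R^-1) e0 => e e0; elim: j => [|j IH].
      have /cvgrPdist_le/(_ _ e0) := ac 0%N.
      by apply: filterS => k h m; rewrite leqn0 => /eqP ->.
    have /cvgrPdist_le/(_ _ e0) := ac j.+1.
    apply: filterS2 IH => k h1 h2 m; rewrite leq_eqVlt => /predU1P[->//|].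
    by rewrite ltnS; exact: h1.
  exact: filter_ex.
pose p j N := projT1 (cid (pick j N)).
have pP j N : (N < p j N)%N /\ forall m, (m <= j)%N -> `|c m - a m (p j N)| <= j.+1%:R^-1.
  exact: projT2 (cid (pick j N)).
pose s := fix s j := if j is i.+1 then p i.+1 (s i) else p 0%N 0%N.
have sP j m : (m <= j)%N -> `|c m - a m (s j)| <= j.+1%:R^-1.
  by case: j => [|j] mj; exact: (pP _ _).2.
exists s; split.
  apply: homo_ltn; first exact: ltn_trans.
  by move=> i; exact: (pP i.+1 (s i)).1.
move=> m; apply/cvgrPdist_le => e e0.
near=> j; apply: le_trans (sP j m _) _.
  by near: j; exact: nbhs_infty_ge.
apply: ltW; near: j; exact: (near_infty_natSinv_lt (PosNum e0)).
Unshelve. all: by end_near. Qed.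

End extraction.

Section weak_extraction.
Local Open Scope complex_scope.
Context {R : realType} {n : nat} {H : completeNormedModType R[i]}.
Context {dot : {dot H for @conjc R}}.
Hypothesis dot_norm : forall x : H, dot x x = `|x| ^+ 2.
Hypothesis sepH : separable H.
Local Notation rdot := (rdot dot).
Local Notation l2bd := (l2bd dot).
Local Notation gproj := (gproj dot).
Local Notation C := R[i].
Local Notation CT := (Cn R n).
Local Notation V := (@lebesgueC R n).
Local Notation mu := (@muG R n).
Local Notation mnorm v := (complex.Re `|v|).
Implicit Types (z w u v : 'rV[C]_n) (F G K D : 'rV[C]_n -> H) (M : R).

Lemma cvg_norm_le (U : set_system nat) (a : nat -> R) (c M : R) : ProperFilter U ->
  a k @[k --> U] --> c -> (forall k, `|a k| <= M) -> `|c| <= M.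
Proof.
move=> PU ac aM; rewrite leNgt; apply/negP => Mc.
have [k] := filter_ex (cvgr_norm_gt _ ac _ Mc : \forall k \near U, M < `|a k|).
by rewrite ltNge aM.
Qed.

Lemma mnorm_le v (e : R) : 0 <= e -> (forall j, cabs (v 0 j) <= e) -> mnorm v <= e.
Proof.
move=> e0 ve; rewrite -lecR -mnormE [leLHS]/Num.norm/=.
have [->|/mx_norm_neq0[[i j] ->]] := eqVneq (mx_norm v) 0; first by rewrite lecR.
by rewrite /= cabsE lecR (ord1 i).
Qed.

Lemma dense_points : exists q : nat -> 'rV[C]_n,
  forall z (e : R), 0 < e -> exists i, mnorm (q i - z) <= e.
Proof.
pose pt (f : {ffun 'I_n -> rat * rat}) : 'rV[C]_n :=
  \row_j (ratr (f j).1 +i* ratr (f j).2).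
exists (fun i => if unpickle i is Some f then pt f else 0) => z e e0.
have approx (x : R) : exists r : rat, `|ratr r - x| <= e / 2.
  have [|r] := @rat_in_itvoo R (x - e / 2) (x + e / 2); first by lra.
  rewrite in_itv/= => /andP[r1 r2]; exists r.
  by rewrite ler_norml; lra.
pose r x := projT1 (cid (approx x)).
have rP x : `|ratr (r x) - x| <= e / 2 by exact: projT2 (cid (approx x)).
exists (pickle [ffun j => (r (complex.Re (z 0 j)), r (complex.Im (z 0 j)))]).
rewrite pickleK; apply: mnorm_le (ltW e0) _ => j.
apply: le_trans (cabs_le _) _; rewrite !mxE ffunE/=.
case: (z 0 j) => a b /=; have := rP a; have := rP b; lra.
Qed.

(** Local equicontinuity of bounded families: the constant in [gproj_expansion] does not depend on
    the function. *)
Lemma gproj_lipschitz z : exists2 B : R, 0 < B & forall F M v, l2bd F M ->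
  (forall w, gproj F w = F w) -> mnorm v <= 1 ->
  hnorm (F (z + v) - F z) <= B * M * mnorm v.
Proof.
have [B B0 hB] := @gproj_expansion R n H dot dot_norm sepH z.
exists (2 * B); first by rewrite mulr_gt0.
move=> F M v FM PF v1; have [_ M0 _] := FM; have [D [_ D1 D2]] := hB F M FM.
have := D2 v v1; rewrite !PF => h.
rewrite -(subrK (D v) (F (z + v) - F z)).
apply: le_trans (hnormD _ _) (le_trans (lerD h (D1 v)) _).
have m0 := mnorm_ge0 v.
have k0 : 0 <= B * M by rewrite mulr_ge0// ltW.
have : B * M * mnorm v ^+ 2 <= B * M * mnorm v.
  by rewrite ler_wpM2l// expr2 ler_piMr.
lra.
Qed.

Section sequence.
Variables (F : nat -> 'rV[C]_n -> H) (M : R).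
Hypothesis FM : forall k, l2bd (F k) M.
Hypothesis PF : forall k w, gproj (F k) w = F k w.

Let M0 : 0 <= M. Proof. by have [] := FM 0%N. Qed.

Let Fb k z : hnorm (F k z) <= expR (cnorm z ^+ 2 / 2) * M.
Proof. by rewrite -PF; exact: gproj_bound dot_norm sepH _ _ _ (FM k). Qed.

(** Along an ultrafilter all the bounded scalar sequences converge at once; for each [z] their
    limits form a bounded linear functional of [h], which Riesz represents by a vector. *)
Lemma ultra_weak_limit (U : set_system nat) : UltraFilter U ->
  exists Finf : 'rV[C]_n -> H,
    forall z h, rdot (F k z) h @[k --> U] --> rdot (Finf z) h.
Proof.
move=> UU; have PU : ProperFilter U by exact: ultra_proper.
suff lim z : exists y, forall h, rdot (F k z) h @[k --> U] --> rdot y h.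
  by exists (fun z => projT1 (cid (lim z))) => z; exact: projT2 (cid (lim z)).
pose b := expR (cnorm z ^+ 2 / 2) * M.
have b0 : 0 <= b by rewrite mulr_ge0 ?expR_ge0.
have Fh k h : `|rdot (F k z) h| <= b * hnorm h.
  by apply: le_trans (cauchy_schwarz dot_norm _ _) _; rewrite ler_wpM2r ?hnorm_ge0.
have cv h := ultra_bounded_cvg UU (fun k => Fh k h).
pose l h := projT1 (cid (cv h)).
have lP h : rdot (F k z) h @[k --> U] --> l h by exact: projT2 (cid (cv h)).
have uniq h (c : R) : rdot (F k z) h @[k --> U] --> c -> l h = c.
  by move=> hc; apply: cvg_unique (lP h) hc.
have [y hy] : exists y, forall h, rdot y h = l h.
  apply: (riesz dot_norm b0).
  - move=> x y; apply: uniq; under eq_fun do rewrite rdotDr.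
    exact: cvgD (lP x) (lP y).
  - move=> a x; apply: uniq; under eq_fun do rewrite rdotZr.
    exact: cvgMl_tmp (lP x).
  - by move=> x; exact: cvg_norm_le (lP x) (fun k => Fh k x).
by exists y => h; rewrite hy.
Qed.

(** The limit is found along an ultrafilter, for all [z] and [h] simultaneously. The subsequence
    only has to reproduce it on the countably many pairs of a dense point and a dense vector;
    equicontinuity carries it to all pairs. *)
Lemma weak_extraction : exists s Finf, [/\ {homo s : i j / (i < j)%N},
  l2bd Finf M, forall w, gproj Finf w = Finf w &
  forall z h, rdot (F (s k) z) h @[k --> \oo] --> rdot (Finf z) h].
Proof.
have [U [UU oU]] := ultraFilterLemma (@eventually_filter : ProperFilter \oo).
have PU : ProperFilter U by exact: ultra_proper.
have [Finf FU] := ultra_weak_limit UU.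
have [q hq] := dense_points; have [d hd] := dense_sequence sepH.
(* Pairs are numbered by [pickle]; numbers that code no pair give the zero sequence. *)
pose a (m k : nat) : R := if unpickle m is Some (i, j) then rdot (F k (q i)) (d j) else 0.
pose c (m : nat) : R := if unpickle m is Some (i, j) then rdot (Finf (q i)) (d j) else 0.
have ac m : a m k @[k --> U] --> c m.
  rewrite /a /c; case: unpickle => [[i j]|]; [exact: FU|exact: cvg_cst].
have [s [sm sc]] := diagonal_extraction PU oU ac.
have cvs z h : rdot (F (s k) z) h @[k --> \oo] --> rdot (Finf z) h.
  apply/cvgrPdist_le => e e0.
  have [B B0 hB] := gproj_lipschitz z.
  pose b := expR (cnorm z ^+ 2 / 2) * M.
  have b0 : 0 <= b by rewrite mulr_ge0 ?expR_ge0.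
  have BM : 0 <= B * M by rewrite mulr_ge0// ltW.
  have h1 : 0 < hnorm h + 1 by rewrite ltr_wpDl ?hnorm_ge0.
  pose dl := Num.min 1 (e / (6 * (B * M + 1) * (hnorm h + 1))).
  have dl0 : 0 < dl.
    by rewrite lt_min ltr01/= divr_gt0// !mulr_gt0// ltr_wpDl.
  pose dh := Num.min 1 (e / (6 * (b + 1))).
  have dh0 : 0 < dh by rewrite lt_min ltr01/= divr_gt0// mulr_gt0// ltr_wpDl.
  have [i hi] := hq z _ dl0; have [j hj] := hd h _ dh0.
  have i1 : mnorm (q i - z) <= 1 by apply: le_trans hi _; rewrite ge_min lexx.
  have dj : hnorm (d j) <= hnorm h + 1.
    rewrite -(subrK h (d j)); apply: le_trans (hnormD _ _) _.
    rewrite addrC lerD2l hdistC; apply: le_trans (ltW hj) _.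
    by rewrite ge_min lexx.
  (* This estimate is uniform in [k] and therefore inherited by the limit in [near_inf]. One sixth
     of [e] is for the change of vector, one for the change of point. *)
  have near_q k : `|rdot (F k z) h - rdot (F k (q i)) (d j)| <= e / 3.
    rewrite (_ : _ - _ = rdot (F k z) (h - d j) - rdot (F k (z + (q i - z)) - F k z) (d j)); last first.
      by rewrite [z + _]addrC subrK rdotBr rdotBl; ring.
    have e1 : `|rdot (F k z) (h - d j)| <= e / 6.
      apply: le_trans (cauchy_schwarz dot_norm _ _) _.
      apply: (@le_trans _ _ ((b + 1) * dh)).
        apply: ler_pM; rewrite ?hnorm_ge0// ?(ltW hj)//.
        by apply: le_trans (Fb k z) _; rewrite lerDl.
      have : dh <= e / (6 * (b + 1)) by rewrite ge_min lexx orbT.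
      move/(ler_wpM2l (addr_ge0 b0 ler01))/le_trans; apply.
      by rewrite le_eqVlt; apply/orP; left; apply/eqP; field; rewrite gt_eqF// ltr_wpDl.
    have e2 : `|rdot (F k (z + (q i - z)) - F k z) (d j)| <= e / 6.
      apply: le_trans (cauchy_schwarz dot_norm _ _) _.
      apply: (@le_trans _ _ ((B * M + 1) * dl * (hnorm h + 1))).
        apply: ler_pM; rewrite ?hnorm_ge0//.
        apply: le_trans (hB _ _ _ (FM k) (PF k) i1) _.
        by apply: ler_pM; rewrite ?mnorm_ge0// lerDl.
      have : dl <= e / (6 * (B * M + 1) * (hnorm h + 1)) by rewrite ge_min lexx orbT.
      move/(ler_wpM2l (addr_ge0 BM ler01))/(ler_wpM2r (ltW h1))/le_trans; apply.
      rewrite le_eqVlt; apply/orP; left; apply/eqP; field.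
      by rewrite !gt_eqF// ltr_wpDl.
    apply: le_trans (ler_normB _ _) (le_trans (lerD e1 e2) _); lra.
  have near_inf : `|rdot (Finf z) h - rdot (Finf (q i)) (d j)| <= e / 3.
    have hh : (rdot (F k z) h - rdot (F k (q i)) (d j)) @[k --> U] -->
      rdot (Finf z) h - rdot (Finf (q i)) (d j) by apply: cvgB; exact: FU.
    exact: cvg_norm_le hh near_q.
  have e3 : 0 < e / 3 by rewrite divr_gt0.
  have /cvgrPdist_le/(_ _ e3) := sc (pickle (i, j)).
  apply: filterS => k; rewrite /a /c pickleK => hk.
  rewrite (_ : _ - _ = (rdot (Finf z) h - rdot (Finf (q i)) (d j)) +
    (rdot (Finf (q i)) (d j) - rdot (F (s k) (q i)) (d j)) -
    (rdot (F (s k) z) h - rdot (F (s k) (q i)) (d j))); last by ring.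
  apply: le_trans (ler_normB _ _) _.
  apply: le_trans (lerD (ler_normD _ _) (near_q (s k))) _.
  move: near_inf hk; lra.
have mF k : wmeas dot (F k : CT -> H) by have [] := FM k.
have mI : wmeas dot (Finf : CT -> H).
  move=> h; apply: (@measurable_fun_cvg _ CT R setT (fun k (z : CT) => rdot (F (s k) z) h)).
    by move=> k; exact: mF.
  by move=> z _; exact: cvs.
have IM : l2bd Finf M.
  split => //.
  have mI2 := measurable_hnorm_sqr dot_norm sepH mI.
  (* Weak convergence does not make the norms converge. Fatou is applied instead to minorants of
     [|F (s k)|^2] that do converge, to [|Finf|^2]; the maximum with 0 makes them nonnegative. *)
  pose g k z := 2 * rdot (F (s k) z) (Finf z) - hnorm (Finf z) ^+ 2.
  pose gp k z : \bar R := (Num.max 0 (g k z))%:E.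
  have mgp k : measurable_fun [set: CT] (fun z : CT => gp k z).
    apply/measurable_EFinP; apply: measurable_maxr; first exact: measurable_cst.
    apply: measurable_funB => //; apply: measurable_funM => //.
    exact: (measurable_rdot dot_norm sepH).
  have gp0 k z : (0 <= gp k z)%E by rewrite lee_fin le_max lexx.
  have gple k z : (gp k z <= (hnorm (F (s k) z) ^+ 2)%:E)%E.
    rewrite lee_fin ge_max sqr_ge0/= /g lerBlDr.
    have := hnormB_sqr dot_norm (F (s k) z) (Finf z).
    have := sqr_ge0 (hnorm (F (s k) z - Finf z)); lra.
  have gplim z : gp k z @[k --> \oo] --> (hnorm (Finf z) ^+ 2)%:E.
    apply: cvg_EFin; first exact: nearW.
    have gl : g k z @[k --> \oo] --> hnorm (Finf z) ^+ 2.
      rewrite -[X in _ --> X](_ : 2 * rdot (Finf z) (Finf z) - hnorm (Finf z) ^+ 2 = _).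
        by apply: cvgB; [apply: cvgMl_tmp; exact: cvs|exact: cvg_cst].
      by rewrite (rdotxx dot_norm); ring.
    apply/cvgrPdist_le => e e0; move/cvgrPdist_le : gl => /(_ _ e0).
    apply: filterS => k; apply: le_trans.
    have := sqr_ge0 (hnorm (Finf z)); set l := hnorm (Finf z) ^+ 2; set y := g k z => l0.
    rewrite [(fine \o _) k](_ : _ = Num.max 0 y)//.
    have [y0|/ltW y0] := lerP y 0; last exact: lexx.
    rewrite subr0 !ger0_norm ?lerDl ?oppr_ge0// subr_ge0; exact: le_trans l0.
  have := @fatou _ CT R mu setT measurableT gp mgp (fun k z _ => gp0 k z).
  rewrite (eq_integral (fun z : CT => (hnorm (Finf z) ^+ 2)%:E)); last first.
    move=> z _; rewrite is_cvg_limn_einfE; first exact/cvg_lim/gplim.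
    by apply/cvg_ex; exists (hnorm (Finf z) ^+ 2)%:E; exact: gplim.
  move/le_trans; apply; rewrite limn_einf_lim; apply: lime_le; first exact: is_cvg_einfs.
  apply: nearW => k; apply: (@le_trans _ _ (\int[mu]_z gp k z)%E).
    by apply: ereal_inf_lbound; exists k => //=.
  have [_ _ h] := FM (s k); apply: le_trans h.
  by apply: ge0_le_integralT => z.
exists s, Finf; split => // w.
apply: (rdot_inj dot_norm) => h.
have [_ e] := gprojP dot_norm sepH w IM h.
apply: EFin_inj; rewrite -e.
have t1 : (rdot (F (s k) w) h)%:E @[k --> \oo] --> (rdot (Finf w) h)%:E.
  by apply: cvg_EFin; [exact: nearW|exact: cvs].
apply: cvg_unique t1 => //=.
rewrite (_ : (fun k => _) = fun k => (\int[mu]_u (rdot ((bargmann_kernel w u)^*%R *: F (s k) u) h)%:E)%E); last first.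
  by apply/funext => k; have [_ ->] := gprojP dot_norm sepH w (FM (s k)) h; rewrite PF.
(* For the majorant, 1/2 comes from the pointwise bound for [F (s k)] and 1/8 from the kernel
   through [b x <= 2 b^2 + x^2 / 8]; the sum 5/8 is below 1. *)
have [I I0 hI] := @integral_mu_exp R n (5 / 8) ltac:(lra).
pose b := n%:R * mnorm w.
have k0 : 0 <= M * hnorm h * expR (2 * b ^+ 2) by rewrite !mulr_ge0 ?hnorm_ge0 ?expR_ge0.
have me : measurable_fun [set: CT] (fun v : CT => expR (5 / 8 * cnorm v ^+ 2)).
  have ml : measurable_fun [set: CT] (fun v : CT => 5 / 8 * cnorm v ^+ 2).
    by apply: measurable_funM => //; apply: measurable_funX; apply: measurable_cnorm; exact: measurable_idCn.
  exact: measurableT_comp ml.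
have mk G : wmeas dot (G : CT -> H) ->
    measurable_fun [set: CT] (fun u : CT => rdot ((bargmann_kernel w u)^*%R *: G u) h).
  move=> mG; have /(_ h) : wmeas dot (fun u : CT => (bargmann_kernel w u)^*%R *: G u).
    by apply: wmeasZ => //; exact: cmeasurable_conj_kernel.
  exact.
apply: (@real_dominated_convergence _ CT R mu _ _
  (fun u : CT => M * hnorm h * expR (2 * b ^+ 2) * expR (5 / 8 * cnorm u ^+ 2))).
- by move=> k; exact: mk.
- exact: mk.
- by move=> u; under eq_fun do rewrite rdotZ_adj; rewrite rdotZ_adj; exact: cvs.
- by apply: measurable_funM => //; exact: measurable_cst.
- rewrite (ge0_integral_cstM mu me (fun u => expR_ge0 _) k0).
  apply: le_lt_trans (_ : _ <= (M * hnorm h * expR (2 * b ^+ 2))%:E * I%:E)%E _.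
    by apply: lee_wpmul2l; rewrite ?lee_fin.
  by rewrite -EFinM ltry.
move=> k u; apply: le_trans (cauchy_schwarz dot_norm _ _) _.
rewrite hnorm_kernelZ.
have e1 : expR (complex.Re (cdot w u)) * expR (cnorm u ^+ 2 / 2) <=
    expR (2 * b ^+ 2) * expR (5 / 8 * cnorm u ^+ 2).
  rewrite -!expRD ler_expR.
  have : complex.Re (cdot w u) <= b * cnorm u.
    by apply: le_trans (cabs_cdot w u); apply: le_trans (Re_le_cabs _); exact: ler_norm.
  have := sqr_ge0 (2 * b - cnorm u / 2); nra.
apply: (@le_trans _ _ (expR (complex.Re (cdot w u)) * (expR (cnorm u ^+ 2 / 2) * M) * hnorm h)).
  by rewrite ler_wpM2r ?hnorm_ge0// ler_wpM2l ?expR_ge0.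
rewrite mulrA -mulrA mulrC -[leRHS]mulrA ler_wpM2l// mulr_ge0 ?hnorm_ge0//.
Qed.

End sequence.

End weak_extraction.

(** * Compactness *)

Section null_modification.
Local Open Scope complex_scope.
Context {R : realType} {H : completeNormedModType R[i]}.
Context {dot : {dot H for @conjc R}}.
Hypothesis dot_norm : forall x : H, dot x x = `|x| ^+ 2.
Hypothesis sepH : separable H.
Local Notation rdot := (rdot dot).
Context d (T : measurableType d) (mu : {measure set T -> \bar R}) (N : set T).
Hypotheses (mN : measurable N) (N0 : mu N = 0%E).

Lemma null_eq_integral (f g : T -> R) : measurable_fun setT f -> measurable_fun setT g ->
  (forall x, ~ N x -> f x = g x) -> (\int[mu]_x (f x)%:E = \int[mu]_x (g x)%:E)%E.
Proof.
move=> mf mg fg; apply: ae_eq_integral => //; [exact/measurable_EFinP|exact/measurable_EFinP|].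
exists N; split => // x /= h; apply: contrapT => Nx; apply: h => _.
by rewrite fg.
Qed.

Variables F G : T -> H.
Hypotheses (mF : wmeas dot F) (mG : wmeas dot G) (FG : forall x, ~ N x -> F x = G x).

Lemma null_wint x : wint dot mu F x -> wint dot mu G x.
Proof.
move=> Fx h; have [/integrableP[_ iF] eF] := Fx h.
have mf := mF h; have mg := mG h.
have fg y : ~ N y -> rdot (F y) h = rdot (G y) h by move=> /FG ->.
split; last by rewrite -eF (null_eq_integral mf mg fg).
apply/integrableP; split; first exact/measurable_EFinP.
apply: le_lt_trans iF; rewrite le_eqVlt; apply/orP; left; apply/eqP.
apply: (@null_eq_integral (fun y => `|rdot (G y) h|) (fun y => `|rdot (F y) h|)).
- exact: measurableT_comp.
- exact: measurableT_comp.
- by move=> y /fg ->.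
Qed.

(** For integrands built from two symbols that agree off a null set this makes [Xi] and [gproj]
    coincide at every point, not only almost everywhere. *)
Lemma null_weak_integral : (\int[mu]_x (hnorm (G x))%:E < +oo)%E ->
  weak_integral mu dot F = weak_integral mu dot G.
Proof.
move=> iG; have iF : (\int[mu]_x (hnorm (F x))%:E < +oo)%E.
  rewrite (@null_eq_integral _ (fun x => hnorm (G x)))//.
  - exact: (measurable_hnorm dot_norm sepH mF).
  - exact: (measurable_hnorm dot_norm sepH mG).
  - by move=> x /FG ->.
exact: (wint_inj dot_norm (null_wint (wint_weak_integral dot_norm sepH mF iF))
  (wint_weak_integral dot_norm sepH mG iG)).
Qed.

End null_modification.

Section compact_toeplitz.
Local Open Scope complex_scope.
Context {R : realType} {n : nat} {H : completeNormedModType R[i]}.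
Context {dot : {dot H for @conjc R}}.
Hypothesis dot_norm : forall x : H, dot x x = `|x| ^+ 2.
Hypothesis sepH : separable H.
Local Notation rdot := (rdot dot).
Local Notation l2bd := (l2bd dot).
Local Notation gproj := (gproj dot).
Local Notation C := R[i].
Local Notation CT := (Cn R n).
Local Notation V := (@lebesgueC R n).
Local Notation mu := (@muG R n).
Local Notation gd := (@gauss_density R n).
Implicit Types (z w u v : 'rV[C]_n) (F G K D : 'rV[C]_n -> H) (M : R).

(** [Xi] evaluates the symbol at [u + z], so the exceptional set occurs translated. The image of the
    Gaussian under translation by [z] has density [exp (2 Re <u, z> - |z|^2)] with respect to it. *)
Lemma muG_translate_null (N : set CT) z : measurable N -> mu N = 0%E ->
  measurable [set u : CT | N ((u : 'rV_n) + z)] /\ mu [set u : CT | N ((u : 'rV_n) + z)] = 0%E.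
Proof.
move=> mN N0; pose t (u : CT) : CT := (u : 'rV_n) + z.
have mt : measurable_fun [set: CT] t by apply: measurable_CnD; [exact: measurable_idCn|exact: measurable_cstCn].
have mA : measurable [set u : CT | N ((u : 'rV_n) + z)].
  by have := mt measurableT N mN; rewrite setTI.
split => //.
have me : measurable_fun [set: CT] (fun u : CT => expR (2 * complex.Re (cdot u z) - cnorm z ^+ 2)).
  have mr : measurable_fun [set: CT] (fun u : CT => complex.Re (cdot u z)).
    by apply: measurable_Re_cdot; [exact: measurable_idCn|exact: measurable_cstCn].
  have ml : measurable_fun [set: CT] (fun u : CT => 2 * complex.Re (cdot u z) - cnorm z ^+ 2).
    by apply: measurable_funB => //; apply: measurable_funM.
  exact: measurableT_comp ml.
have mgd := @measurable_gauss_density R n.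
have mi : measurable_fun [set: CT] (\1_N : CT -> R) by exact: measurable_indic.
pose f (u : CT) : R := \1_N u * expR (2 * complex.Re (cdot u z) - cnorm z ^+ 2).
have mf : measurable_fun [set: CT] f by exact: measurable_funM.
have mfg : measurable_fun [set: CT] (fun u : CT => f u * gd u) by exact: measurable_funM.
pose iA (u : CT) : R := \1_N ((u : 'rV_n) + z).
have miA : measurable_fun [set: CT] iA by exact: (measurableT_comp mi mt).
transitivity (\int[mu]_u (iA u)%:E)%E.
  rewrite (eq_integral (fun u : CT => (\1_[set u : CT | N ((u : 'rV_n) + z)] u : R)%:E)).
    by rewrite integral_indic// setIT.
  by move=> u _; rewrite /iA !indicE.
rewrite (integral_muG miA).
transitivity (\int[V]_u (f ((u : 'rV_n) + z) * gd ((u : 'rV_n) + z))%:E)%E.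
  apply: eq_integral => u _; congr EFin; rewrite /f /iA -mulrA; congr (_ * _).
  rewrite /gauss_density mulrCA; congr (_ * _); rewrite -expRD; congr expR.
  by rewrite cnormD_sqr cdotDl cdotzz raddfD/=; ring.
rewrite (integral_Cshift z mfg) -(integral_muG mf).
rewrite (null_eq_integral mN N0 mf (@measurable_cst _ _ CT _ setT (0 : R))).
  by rewrite integral0_eq.
by move=> u Nu; rewrite /f indicE memNset// mul0r.
Qed.

Variable Phi : 'rV[C]_n -> H -> H.
Hypothesis Phi_Linfty : Linfty_HS dot Phi.

Let bPhi z : bounded_op (Phi z). Proof. by have [h _ _] := Phi_Linfty; have [] := h z. Qed.

Let mPhi g : wmeas dot (fun z : CT => Phi z g).
Proof. by have [h m _] := Phi_Linfty; exact: (@hs_measurable_wmeas _ _ _ dot_norm _ CT Phi h m g). Qed.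

Lemma Linfty_modification : exists (N : set CT) (B : R), [/\ measurable N, mu N = 0%E, 0 <= B &
  forall z, ~ N z -> (hs_norm dot (Phi z) <= B%:E)%E].
Proof.
have [_ _ fin] := Phi_Linfty.
have p1 : (0 < mu setT)%E by rewrite (_ : mu setT = 1%E) ?lte01//; exact: muG_setT.
have e0 : (0 <= ess_sup mu (fun z => hs_norm dot (Phi z)))%E.
  by apply: ess_sup_gee => //; apply: nearW => z; exact: sqrte_ge0.
have [N [mN N0 NS]] := @ess_sup_ge _ CT R mu (fun z => hs_norm dot (Phi z)).
exists N, (fine (ess_sup mu (fun z => hs_norm dot (Phi z)))); split => //.
  exact: fine_ge0.
move=> z Nz; rewrite fineK ?ge0_fin_numE//; apply: contrapT => h; apply: Nz; apply: NS.
exact: h.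
Qed.

Theorem compact_toeplitz :
  ((\int[mu]_w (hs_norm dot (Xi dot Phi z w) ^+ 2))%E @[z --> @cinfty R n] --> 0%E) ->
  compact_operator (toeplitz dot Phi).
Proof.
move=> Xlim; have [N [B [mN N0 B0 hN]]] := Linfty_modification.
(* [Psi] is [Phi] cut off to 0 on the exceptional null set, so that its bounds hold at every
   point. *)
pose Psi (z : 'rV[C]_n) (g : H) : H := (\1_(~` N) (z : CT) : R)%:C *: Phi z g.
have PsiN z g : N z -> Psi z g = 0.
  by move=> Nz; rewrite /Psi indicE memNset ?scale0r//=; exact.
have PsiE z g : ~ N z -> Psi z g = Phi z g.
  by move=> Nz; rewrite /Psi indicE mem_set// scale1r.
have lPsi z : linear (Psi z).
  have [lP _] := bPhi z.
  by move=> a x y; rewrite /Psi lP scalerDr !scalerA [_ * a]mulrC.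
have mPsi g : wmeas dot (fun z : CT => Psi z g).
  apply: wmeasZ; last exact: mPhi.
  split => /=; last exact: measurable_cst.
  by apply: measurable_indic; exact: measurableC.
have bPsi z x : hnorm (Psi z x) <= B * hnorm x.
  have [Nz|Nz] := pselect (N z); first by rewrite PsiN// hnorm0 mulr_ge0 ?hnorm_ge0.
  rewrite PsiE//; have [lP _] := bPhi z.
  exact: (hnorm_le_hs_bound dot_norm x lP B0 (hN z Nz)).
have hPsi z : hs_bounded dot (Psi z) (B ^+ 2).
  move=> J uJ oJ; have [Nz|Nz] := pselect (N z).
    by rewrite big1 ?sqr_ge0// => e _; rewrite PsiN// hnorm0 expr0n.
  under eq_bigr do rewrite PsiE//.
  exact: sum_le_hs_bound (hN z Nz) uJ oJ.
have XiE z w : Xi dot Phi z w = Xi dot Psi z w.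
  apply/funext => g; have [mA A0] := muG_translate_null z mN N0.
  apply: (null_weak_integral dot_norm sepH mA A0).
  - apply: wmeasZ; first exact: cmeasurable_conj_kernel.
    apply: (@wmeas_comp _ _ _ _ _ _ _ (fun u : CT => (u : 'rV_n) + z : CT) (fun z => Phi z g)).
      by apply: measurable_CnD; [exact: measurable_idCn|exact: measurable_cstCn].
    exact: mPhi.
  - apply: wmeasZ; first exact: cmeasurable_conj_kernel.
    apply: (@wmeas_comp _ _ _ _ _ _ _ (fun u : CT => (u : 'rV_n) + z : CT) (fun z => Psi z g)).
      by apply: measurable_CnD; [exact: measurable_idCn|exact: measurable_cstCn].
    exact: mPsi.
  - by move=> u Nu; rewrite PsiE.
  have k0 : 0 <= B * hnorm g by rewrite mulr_ge0 ?hnorm_ge0.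
  apply: (@le_lt_trans _ _ (\int[mu]_u (B * hnorm g * expR (complex.Re (cdot w u)))%:E)%E).
    apply: ge0_le_integralT => u; first by rewrite lee_fin hnorm_ge0.
    by rewrite lee_fin hnorm_kernelZ mulrC ler_wpM2r ?expR_ge0.
  rewrite (ge0_integral_cstM mu (measurable_exp_Re w) (fun u => expR_ge0 _) k0).
  by rewrite kernel_l1 -EFinM ltry.
have mPhiF F : wmeas dot (F : CT -> H) -> wmeas dot (fun z : CT => Phi z (F z)).
  by move=> mF; apply: (@wmeas_app _ _ _ dot_norm sepH _ CT Phi F).
have mPsiF F : wmeas dot (F : CT -> H) -> wmeas dot (fun z : CT => Psi z (F z)).
  move=> mF; apply: (@wmeas_app _ _ _ dot_norm sepH _ CT Psi F) => // z.
  by split; [exact: lPsi|exists B; exact: bPsi].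
have PsiF_l2bd F M : l2bd F M -> l2bd (fun z => Psi z (F z)) (B * M).
  exact: (Phi_l2bd dot_norm sepH B0 lPsi mPsi bPsi).
have PhiF_l2bd F M : l2bd F M -> l2bd (fun z => Phi z (F z)) (B * M).
  move=> FM; have [mF _ _] := FM; have [mS S0 iS] := PsiF_l2bd F M FM.
  split => //; first exact: mPhiF.
  rewrite (@null_eq_integral R _ CT mu N mN N0 _ (fun z => hnorm (Psi z (F z)) ^+ 2))//.
  - exact: (measurable_hnorm_sqr dot_norm sepH (mPhiF F mF)).
  - exact: (measurable_hnorm_sqr dot_norm sepH mS).
  - by move=> z Nz; rewrite PsiE.
have gprojE F M w : l2bd F M -> gproj (fun z => Phi z (F z)) w = gproj (fun z => Psi z (F z)) w.
  move=> FM; have [mF _ _] := FM.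
  apply: (null_weak_integral dot_norm sepH mN N0).
  - by apply: wmeasZ; [exact: cmeasurable_conj_kernel|exact: mPhiF].
  - by apply: wmeasZ; [exact: cmeasurable_conj_kernel|exact: mPsiF].
  - by move=> z Nz; rewrite PsiE.
  apply: le_lt_trans (_ : _ <= _)%E
    (le_lt_trans (kernel_int_bound dot_norm sepH w (PsiF_l2bd F M FM)) (ltry _)).
  apply: ge0_le_integralT => u; first by rewrite lee_fin hnorm_ge0.
  by rewrite lee_fin hnorm_kernelZ.
have XlimPsi : (\int[mu]_w (hs_norm dot (Xi dot Psi z w) ^+ 2) @[z --> @cinfty R n] --> 0)%E.
  by under eq_fun do under eq_integral do rewrite -XiE.
split.
  move=> F BF; have [M FM] := bargmann_l2bd dot_norm BF.
  exists (gproj (fun z => Phi z (F z))); split => //.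
    exact: (l2bd_L2 dot_norm sepH (PhiF_l2bd F M FM)).
  exact: (gproj_bargmann_proj dot_norm sepH (PhiF_l2bd F M FM)).
move=> F_ G_ TFG [M0 FM0]; pose M := Num.max 0 M0.
have M_ge0 : 0 <= M by rewrite le_max lexx.
have FM k : l2bd (F_ k) M.
  have [[_ LF] _ _] := TFG k; apply: (L2_l2bdM dot_norm LF M_ge0).
  by apply: le_trans (FM0 k) _; rewrite lee_fin le_max lexx orbT.
have PF k w : gproj (F_ k) w = F_ k w.
  by have [BF _ _] := TFG k; exact: (bargmann_gproj dot_norm sepH).
have [s [Finf [sm IM PI cvs]]] := weak_extraction dot_norm sepH FM PF.
have PsiI := PsiF_l2bd Finf M IM.
(* The limit is the Toeplitz image of [Finf]; by linearity the differences are the images of the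
   weakly null functions [D k]. *)
exists s, (gproj (fun z => Psi z (Finf z))); split => //.
  exact: (gproj_bargmann dot_norm sepH PsiI).
pose D k z := F_ (s k) z - Finf z.
have DM k : l2bd (D k) (2 * (M + M)) by exact: (l2bdB dot_norm sepH (FM (s k)) IM).
have PD k z : gproj (D k) z = D k z.
  by rewrite (gprojB dot_norm sepH z (FM (s k)) IM) PF PI.
have D0 z h : rdot (D k z) h @[k --> \oo] --> (0 : R).
  under eq_fun do rewrite rdotBl.
  rewrite -(subrr (rdot (Finf z) h)); apply: cvgB; [exact: cvs|exact: cvg_cst].
have null := toeplitz_weakly_null dot_norm sepH B0 lPsi mPsi bPsi hPsi XlimPsi DM PD D0.
have GE k w : G_ (s k) w - gproj (fun z => Psi z (Finf z)) w = gproj (fun z => Psi z (D k z)) w.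
  have [_ _ pG] := TFG (s k).
  rewrite (bargmann_proj_unique dot_norm sepH (PhiF_l2bd _ _ (FM (s k))) pG w).
  rewrite (gprojE _ _ w (FM (s k))) -(gprojB dot_norm sepH w (PsiF_l2bd _ _ (FM (s k))) PsiI).
  congr (gproj _ w); apply/funext => z.
  by rewrite /D (linear_opB (lPsi z)).
pose E k : 'rV[C]_n -> H := G_ (s k) \- gproj (fun z => Psi z (Finf z)).
have near_le (e : R) : 0 < e -> \forall k \near \oo,
    (L2norm (E k) <= e%:E)%E.
  move=> e0; have := null (e ^+ 2) (exprn_gt0 2 e0); apply: filterS => k hk.
  apply: (L2norm_le (ltW e0)); apply: le_trans hk.
  by apply: ge0_le_integralT => w; rewrite lee_fin ?sqr_ge0// -GE.
apply/fine_cvgP; split.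
  have := near_le 1 ltr01; apply: filterS => k hk.
  by rewrite ge0_fin_numE ?sqrte_ge0//; exact: le_lt_trans hk (ltry _).
apply/cvgrPdist_le => e e0; have := near_le e e0; apply: filterS => k hk.
have n0 : (0 <= L2norm (E k))%E by exact: sqrte_ge0.
rewrite sub0r normrN ger0_norm ?fine_ge0// -lee_fin fineK//.
by rewrite ge0_fin_numE//; exact: le_lt_trans hk (ltry _).
Qed.

End compact_toeplitz.

Theorem theorem3p6 (R : realType) (n : nat) (H : completeNormedModType R[i])
    (dot : {dot H for @conjc R})
    (dot_norm : forall x : H, dot x x = `|x| ^+ 2)
    (H_separable : separable H)
    (Phi : 'rV[R[i]]_n -> H -> H)
    (Phi_Linfty : Linfty_HS dot Phi)
    (Xi_lim : (\int[@muG R n]_w (hs_norm dot (Xi dot Phi z w) ^+ 2))%E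
                @[z --> @cinfty R n] --> 0%E) :
  compact_operator (toeplitz dot Phi).
Proof. exact: (compact_toeplitz dot_norm H_separable Phi_Linfty Xi_lim). Qed.
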